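(* (a) The canonical basis $\mathbf B_d^\jmath=\{\{A\}\mid A\in\Xi_d\}$ of $\mathbf S^{\jmath}$ is almost orthonormal: $(\{A\},\{A'\})_D\in\delta_{A,A'}+v^{-1}\mathbb Z[v^{-1}]$ for all $A,A'\in\Xi_d$. (b) The signed canonical basis $(-\mathbf B_d^\jmath)\cup\mathbf B_d^\jmath$ of the $\mathcal A$-module $\mathbf S^{\jmath}$ is characterized by almost orthonormality together with bar-invariance: an element $b\in\mathbf S^{\jmath}$ lies in $(-\mathbf B_d^\jmath)\cup\mathbf B_d^\jmath$ if and only if $\overline b=b$ and $(b,b)_D\in1+v^{-1}\mathbb Z[v^{-1}]$.
   Context: Let $\mathcal A=\mathbb Z[v,v^{-1}]$, $n,d\ge1$, $N=2n+1$, $D=2d+1$; $\mathbb N=\{0,1,2,\dots\}$, and $|U|=\dim U$. For an odd prime power $q$ equip $\mathbb F_q^D$ with a nondegenerate symmetric bilinear form with isometry group $O(D)$, and let $X$ be the set of flags $V=(0=V_0\subseteq V_1\subseteq\cdots\subseteq V_N=\mathbb F_q^D)$ with $V_i=V_{N-i}^\perp$ for all $i$. Let $\Xi_d$ be the set of $N\times N$ matrices $A=(a_{ij})$ over $\mathbb N$ with $\sum a_{ij}=D$ and $a_{ij}=a_{N+1-i,N+1-j}$. The $O(D)$-orbits $\mathcal O_A$ on $X\times X$ are indexed by $A\in\Xi_d$: $(V,V')\in\mathcal O_A$ iff $a_{ij}=|(V_{i-1}+V_i\cap V'_j)/(V_{i-1}+V_i\cap V'_{j-1})|$ for all $i,j$.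 $\mathbf S^{\jmath}$ is the free $\mathcal A$-module with basis $e_A$ ($A\in\Xi_d$), $e_A$ being the characteristic function of $\mathcal O_A$ (it is an $\mathcal A$-algebra under convolution). Standard basis: $[A]=v^{-d_A}e_A$, where $d_A$ is the dimension (over $\overline{\mathbb F}_q$) of $\mathcal O_A$ minus the dimension of its image under the first projection $X\times X\to X$; explicitly $$d_A=\sum_{i>k,\,j<l,\,i+k<N+1}a_{ij}a_{kl}+\sum_{j<l,\ (i<n+1\text{ or }j<N+1-l)}a_{ij}a_{il}+\sum_{i\ge n+1>j}\frac{a_{ij}(a_{ij}-1)}2 .$$ Canonical basis: over $\overline{\mathbb F}_q$ let $d(A)=\dim\mathcal O_A$, write $A'\le A$ if $\mathcal O_{A'}\subseteq\overline{\mathcal O_A}$, and let $\mathrm{IC}_A$ be the intersection complex of $\overline{\mathcal O_A}$ shifted so that its restriction to $\mathcal O_A$ is the constant sheaf (in degree $0$); $\mathscr H^i_{\mathcal O_{A'}}(\mathrm{IC}_A)$ denotes the stalk of its $i$-th cohomology sheaf at any point of $\mathcal O_{A'}$. Put $P_{A',A}=\sum_i\dim\mathscr H^i_{\mathcal O_{A'}}(\mathrm{IC}_A)\,v^{i-d(A)+d(A')}$ and $\{A\}=\sum_{A'\le A}P_{A',A}[A']$. The $\{A\}$ form an $\mathcal A$-basis $\mathbf B_d^\jmath$ of $\mathbf S^{\jmath}$. The bar involution of $\mathbf S^{\jmath}$ is the additive map with $\overline{v^kx}=v^{-k}\overline x$ and $\overline{\{A\}}=\{A\}$ for all $A$. Bilinear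 form: for $A\in\Xi_d$ fix a flag $L'\in X$ with $|L'_i/L'_{i-1}|=\sum_k a_{ki}$ for all $i$, and let $f_A(v)\in\mathbb Z[v,v^{-1}]$ be the Laurent polynomial whose value at $v=\sqrt q$ is $\#\{L\in X\mid(L',L)\in\mathcal O_{{}^tA}\}$ (${}^tA$ the transpose). The $\mathcal A$-bilinear form $(\cdot,\cdot)_D:\mathbf S^{\jmath}\times\mathbf S^{\jmath}\to\mathbb Q(v)$ is given by $(e_A,e_{A'})_D=\delta_{A,A'}\,v^{2(d_A-d_{{}^tA})}f_A(v)$. *)

(* Defs.v *)
From HB Require Import structures.
From mathcomp Require Import all_boot all_order all_algebra all_field.
From mathcomp Require Import boolp.

Set Implicit Arguments.
Unset Strict Implicit.
Unset Printing Implicit Defensive.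

Import Order.TTheory GRing.Theory Num.Theory.

Local Open Scope ring_scope.

(* N = 2n+1 and D = 2d+1.  Rows and columns of N x N matrices are numbered
   from 0 to N-1 here, i.e. shifted by one from the usual 1, ..., N. *)
Notation odim n := (n.*2.+1).

(* Q(v), as the fraction field of Z[v] *)
Definition Qv := {fraction {poly int}}.
Definition vQ : Qv := tofrac ('X : {poly int}).

Lemma vQ_neq0 : vQ != 0.
Proof. by rewrite /vQ tofrac_eq0 polyX_eq0. Qed.

Definition laurent_pred : {pred Qv} :=
  fun x => `[< exists (m : nat) (p : {poly int}), x * vQ ^+ m = tofrac p >].

Fact laurent_subring : GRing.subring_closed laurent_pred.
Proof.
split.
- by apply/asboolP; exists 0%N, 1; rewrite mul1r tofrac1.
- move=> x y /asboolP[m [p hp]] /asboolP[m' [p' hp']]; apply/asboolP.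
  exists (m + m')%N, (p * 'X^m' - p' * 'X^m).
  rewrite tofracB !tofracM !tofracXn -hp -hp' exprD mulrBl mulrA.
  by rewrite -[y * _ * _]mulrA [vQ ^+ m' * _]mulrC.
- move=> x y /asboolP[m [p hp]] /asboolP[m' [p' hp']]; apply/asboolP.
  exists (m + m')%N, (p * p').
  by rewrite tofracM -hp -hp' exprD mulrACA.
Qed.

HB.instance Definition _ :=
  GRing.isSubringClosed.Build Qv laurent_pred laurent_subring.

Record laurent := Laurent { lval :> Qv; _ : lval \in laurent_pred }.

HB.instance Definition _ := [isSub for lval].
HB.instance Definition _ := [Choice of laurent by <:].
HB.instance Definition _ := [SubChoice_isSubComNzRing of laurent by <:].

Fact vpow_subproof (m : int) : vQ ^ m \in laurent_pred.
Proof.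
apply/asboolP; case: m => m.
  by exists 0%N, 'X^m; rewrite mulr1 tofracXn.
exists m.+1, 1; rewrite tofrac1 NegzE -exprnN mulVf //.
by rewrite expf_neq0 // vQ_neq0.
Qed.

Definition vpow (m : int) : laurent := Laurent (vpow_subproof m).

(* y is the value at v = z of the Laurent polynomial x (for z nonzero) *)
Definition laurent_eval (x : laurent) (z y : algC) : Prop :=
  exists (m : nat) (p : {poly int}),
    lval x * vQ ^+ m = tofrac p /\ y * z ^+ m = (map_poly intr p).[z].

Definition in_vinv_Zvinv (z : Qv) : Prop :=
  exists p : {poly int}, z = vQ^-1 * (map_poly intr p).[vQ^-1].

(* The entries of a matrix over N whose entries add up to D are at most D,
   so that they may be taken in 'I_D.+1; this makes Xi_d a finType. *)
Definition Xi_pred (n d : nat) (A : 'M['I_(odim d).+1]_(odim n)) : bool :=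
  (\sum_i \sum_j (A i j : nat) == odim d)%N &&
  [forall i, forall j, A i j == A (rev_ord i) (rev_ord j)].

Definition Xi (n d : nat) :=
  {A : 'M['I_(odim d).+1]_(odim n) | Xi_pred A}.

Definition entry n d (A : Xi n d) (i j : 'I_(odim n)) : nat := val A i j.

Fact trXi_subproof n d (A : Xi n d) : Xi_pred (val A)^T.
Proof.
case: A => A /= /andP[/eqP sA /forallP hA]; apply/andP; split.
  apply/eqP; rewrite -[RHS]sA exchange_big /=.
  by apply: eq_bigr => i _; apply: eq_bigr => j _; rewrite mxE.
apply/forallP => i; apply/forallP => j; rewrite !mxE.
by have /forallP := hA j; apply.
Qed.

Definition trXi n d (A : Xi n d) : Xi n d := Sub (val A)^T (trXi_subproof A).

(* d_A; the conditions are those of the explicit formula with 1-based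
   indices i.+1, j.+1, k.+1, l.+1 *)
Definition dXi n d (A : Xi n d) : nat :=
  (\sum_(i < odim n) \sum_(j < odim n) \sum_(k < odim n)
     \sum_(l < odim n | [&& i.+1 > k.+1, j.+1 < l.+1
                          & i.+1 + k.+1 < odim n + 1])
       entry A i j * entry A k l
   + \sum_(i < odim n) \sum_(j < odim n)
     \sum_(l < odim n | (j.+1 < l.+1) &&
                        ((i.+1 < n + 1) || (j.+1 < odim n + 1 - l.+1)))
       entry A i j * entry A i l
   + \sum_(i < odim n | i.+1 >= n + 1) \sum_(j < odim n | n + 1 > j.+1)
       (entry A i j * (entry A i j - 1)) %/ 2)%N.

(* A subspace of F^D is represented by the canonical matrix <<M>> with that
   row space.  [kermx (B *m M^T)] is the orthogonal of the row space of M for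
   the form (u, w) |-> u B w^T. *)
Definition is_flag (F : fieldType) n d (B : 'M[F]_(odim d))
    (V : {ffun 'I_(odim n).+1 -> 'M[F]_(odim d)}) : bool :=
  [&& [forall i, <<V i>>%MS == V i], V ord0 == 0, V ord_max == 1%:M,
      [forall i : 'I_(odim n).+1, forall j : 'I_(odim n).+1,
         (i <= j)%N ==> (V i <= V j)%MS]
    & [forall i, (V i == kermx (B *m (V (rev_ord i))^T))%MS]].

Definition flag (F : fieldType) n d (B : 'M[F]_(odim d)) :=
  {V : {ffun 'I_(odim n).+1 -> 'M[F]_(odim d)} | is_flag B V}.

(* For i : 'I_N of 1-based value i+1, these are V_i and V_{i+1}. *)
Definition flag_lo (F : fieldType) n d (B : 'M[F]_(odim d)) (V : flag n B)
  (i : 'I_(odim n)) : 'M[F]_(odim d) := val V (widen_ord (leqnSn _) i).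
Definition flag_hi (F : fieldType) n d (B : 'M[F]_(odim d)) (V : flag n B)
  (i : 'I_(odim n)) : 'M[F]_(odim d) := val V (lift ord0 i).

Definition relpos (F : fieldType) n d (B : 'M[F]_(odim d)) (V V' : flag n B)
    (i j : 'I_(odim n)) : nat :=
  (\rank (flag_lo V i + (flag_hi V i :&: flag_hi V' j))%MS
   - \rank (flag_lo V i + (flag_hi V i :&: flag_lo V' j))%MS)%N.

Definition in_orbit (F : fieldType) n d (B : 'M[F]_(odim d)) (A : Xi n d)
    (x : flag n B * flag n B) : bool :=
  [forall i, forall j, relpos x.1 x.2 i j == entry A i j].

(* f is the Laurent polynomial f_A: for all odd q, all nondegenerate symmetric
   forms on F_q^D and all choices of the base flag L' *)
Definition is_count n d (A : Xi n d) (f : laurent) : Prop :=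
  forall (F : finFieldType) (B : 'M[F]_(odim d)),
    odd #|F| -> B^T = B -> B \in unitmx ->
  forall L' : flag n B,
    (forall i, (\rank (flag_hi L' i) - \rank (flag_lo L' i))%N
               = (\sum_k entry A k i)%N) ->
  laurent_eval f (sqrtC #|F|%:R)
    #|[set L : flag n B | in_orbit (trXi A) (L', L)]|%:R.

Section Zariski.
Context (k : fieldType).

Inductive polyfun (J : Type) : ((J -> k) -> k) -> Prop :=
| Pf_const c : polyfun (fun=> c)
| Pf_coord j : polyfun (fun e => e j)
| Pf_add P Q : polyfun P -> polyfun Q -> polyfun (fun e => P e + Q e)
| Pf_mul P Q : polyfun P -> polyfun Q -> polyfun (fun e => P e * Q e).

(* A variety T is described by a smooth surjection Y -> T with local sections
   from a closed subset Y of the affine space J -> k: [lift e x] says that e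
   lies in Y and is mapped to x.  T carries the quotient topology, and a
   function on T is regular iff its pullback to Y is. *)
Context (J T : Type) (lift : (J -> k) -> T -> Prop).

Definition zclosed (C : T -> Prop) : Prop :=
  exists E : ((J -> k) -> k) -> Prop,
    (forall P, E P -> polyfun P) /\
    (forall e x, lift e x -> (C x <-> forall P, E P -> P e = 0)).

Definition zopen (W : T -> Prop) : Prop := zclosed (fun x => ~ W x).

Definition zclosure (Y : T -> Prop) (x : T) : Prop :=
  forall C, zclosed C -> (forall y, Y y -> C y) -> C x.

Definition regular_on (U : T -> Prop) (phi : T -> k) : Prop :=
  forall x, U x -> exists e P Q,
    [/\ lift e x, polyfun P, polyfun Q, Q e != 0 &
      forall y e', U y -> lift e' y -> Q e' != 0 -> phi y = P e' / Q e'].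

Definition closed_in (Y F : T -> Prop) : Prop :=
  exists2 C, zclosed C & forall x, F x <-> Y x /\ C x.

Definition irreducible_set (F : T -> Prop) : Prop :=
  (exists x, F x) /\
  forall C1 C2, zclosed C1 -> zclosed C2 ->
    (forall x, F x -> C1 x \/ C2 x) ->
    (forall x, F x -> C1 x) \/ (forall x, F x -> C2 x).

Definition irr_chain (Y : T -> Prop) (m : nat) : Prop :=
  exists F : nat -> T -> Prop,
    (forall i, (i <= m)%N -> closed_in Y (F i) /\ irreducible_set (F i)) /\
    (forall i, (i < m)%N ->
       (forall x, F i x -> F i.+1 x) /\ ~ (forall x, F i.+1 x -> F i x)).

Definition krull_dim (Y : T -> Prop) (m : nat) : Prop :=
  irr_chain Y m /\ ~ irr_chain Y m.+1.

End Zariski.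

Section EtaleSheaves.
Context (k : closedFieldType) (n d : nat) (B : 'M[k]_(odim d)).

Let pt := (flag n B * flag n B)%type.

(* Coordinates on X x X (Jouanolou's trick): a pair of flags is lifted to a
   family of idempotent matrices whose row spaces are the members of the
   flags.  The set of all such families is closed in an affine space and is an
   affine-space bundle over X x X. *)
Definition coordXX := (bool * 'I_(odim n).+1 * 'I_(odim d) * 'I_(odim d))%type.

Definition liftXX (e : coordXX -> k) (x : pt) : Prop :=
  forall (b : bool) (i : 'I_(odim n).+1),
    let M : 'M[k]_(odim d) := \matrix_(s, t) e (b, i, s, t) in
    M *m M = M /\ (M == val (if b then x.2 else x.1) i)%MS.

Definition liftXX1 (e : option coordXX -> k) (z : pt * k) : Prop :=
  liftXX (fun j => e (Some j)) z.1 /\ e None = z.2.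

Definition orbit_closure (A : Xi n d) : pt -> Prop :=
  zclosure liftXX (fun x => in_orbit A x).

Definition leXi (A' A : Xi n d) : Prop :=
  forall x : pt, in_orbit A' x -> orbit_closure A x.

Definition is_orbit_dim (A : Xi n d) (m : nat) : Prop :=
  krull_dim liftXX (fun x => in_orbit A x) m.

(* The objects are the standard etale schemes over open subsets W of X x X,
     U = {(x,t) | x in W, f_x(t) = 0, g_x(t) <> 0}  with f_x'(t) <> 0 on U,
   the coefficients of f and g being regular on W.  Every etale X x X-scheme
   is covered by such U (structure theorem for etale morphisms), so this full
   subcategory, with surjective families as coverings, has the same sheaves as
   the small etale site.  All these schemes are reduced, being etale over the
   smooth variety X x X, so they are determined by their k-points and a
   morphism between them over X x X is a regular function giving the
   coordinate t on the target. *)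
Definition poly_family (W : pt -> Prop) (f : pt -> {poly k}) : Prop :=
  (exists m, forall x, W x -> (size (f x) <= m)%N) /\
  (forall j, regular_on liftXX W (fun x => (f x)`_j)).

Definition std_etale (U : pt * k -> Prop) : Prop :=
  exists (W : pt -> Prop) (f g : pt -> {poly k}),
    [/\ zopen liftXX W, poly_family W f, poly_family W g,
        forall x t, U (x, t) <->
          [/\ W x, root (f x) t & ~~ root (g x) t] &
        forall x t, U (x, t) -> ~~ root ((f x)^`()) t].

Record etale := Etale { et_pts :> pt * k -> Prop; _ : std_etale et_pts }.

Record et_hom (U V : etale) := EtHom {
  et_fun :> pt * k -> k;
  et_reg : regular_on liftXX1 U et_fun;
  et_maps : forall x t, U (x, t) -> V (x, et_fun (x, t)) }.

(* Presheaves of abelian groups; functoriality is stated for every morphism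
   that agrees on points with an identity or with a composite, which also
   makes [res f] depend only on the values of f on its source. *)
Record presheaf := Presheaf {
  sec :> etale -> zmodType;
  res : forall U V : etale, et_hom U V -> {additive sec V -> sec U};
  res_id : forall (U : etale) (f : et_hom U U),
    (forall x t, U (x, t) -> f (x, t) = t) -> forall s, res f s = s;
  res_comp : forall (U V W : etale)
      (f : et_hom U V) (g : et_hom V W) (h : et_hom U W),
    (forall x t, U (x, t) -> h (x, t) = g (x, f (x, t))) ->
    forall s, res h s = res f (res g s) }.

Arguments res {p U V} _.

Definition surjective_family (U : etale) (I : Type) (V : I -> etale)
    (f : forall i, et_hom (V i) U) : Prop :=
  forall x t, U (x, t) -> exists i s, V i (x, s) /\ f i (x, s) = t.

Definition is_sheaf (F : presheaf) : Prop :=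
  forall (U : etale) (I : Type) (V : I -> etale)
         (f : forall i, et_hom (V i) U),
    surjective_family f ->
  forall s : forall i, F (V i),
    (forall i j (W : etale) (a : et_hom W (V i)) (b : et_hom W (V j)),
       (forall x t, W (x, t) -> f i (x, a (x, t)) = f j (x, b (x, t))) ->
       res a (s i) = res b (s j)) ->
  exists! u : F U, forall i, res (f i) u = s i.

Record sh_mor (F G : presheaf) := ShMor {
  sh_app :> forall U : etale, {additive F U -> G U};
  sh_nat : forall (U V : etale) (f : et_hom U V) (s : F V),
    sh_app U (res f s) = res f (sh_app V s) }.

Definition is_injective_sheaf (K : presheaf) : Prop :=
  is_sheaf K /\
  forall (F G : presheaf) (i : sh_mor F G) (f : sh_mor F K),
    is_sheaf F -> is_sheaf G -> (forall U, injective (i U)) ->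
  exists g : sh_mor G K, forall U (s : F U), g U (i U s) = f U s.

Record complex := Complex {
  cpx :> nat -> presheaf;
  cdiff : forall i, sh_mor (cpx i) (cpx i.+1);
  cdiffK : forall i U (s : cpx i U), cdiff i.+1 U (cdiff i U s) = 0 }.

Arguments cdiff : clear implicits.

Definition supp_in (S : pt -> Prop) (F : presheaf) (U : etale) (s : F U)
    : Prop :=
  forall (V : etale) (f : et_hom V U),
    (forall z, V z -> ~ S z.1) -> res f s = 0.

Definition coboundary (S : pt -> Prop) (K : complex) (i : nat) (U : etale)
    : K i U -> Prop :=
  match i return K i U -> Prop with
  | 0%N => fun s => s = 0
  | j.+1 => fun s => exists2 u : K j U, supp_in S u & cdiff K j U u = s
  end.

Arguments coboundary S {K i U} _.

(* Vanishing of the colimit, over the etale neighbourhoods U of x, of the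
   i-th cohomology of the sections of K over U supported in S.  If K consists
   of injectives this is H^i(K)_x for S the whole space, and H^i(i_S^! K)_x
   for x in S, S locally closed. *)
Definition stalk_vanish (S : pt -> Prop) (K : complex) (x : pt) (i : nat)
    : Prop :=
  forall (U : etale) (t : k) (s : K i U),
    U (x, t) -> cdiff K i U s = 0 -> supp_in S s ->
  exists (U' : etale) (f : et_hom U' U) (t' : k),
    [/\ U' (x, t'), f (x, t') = t & coboundary S (res f s)].

Definition everywhere (x : pt) : Prop := True.

(* Two cocycles, on the etale neighbourhoods (U,t) and (U',t') of x, have the
   same class in H^i(K)_x. *)
Definition same_class (K : complex) (x : pt) (i : nat)
    (U : etale) (t : k) (s : K i U) (U' : etale) (t' : k) (s' : K i U')
    : Prop :=
  exists (V : etale) (f : et_hom V U) (f' : et_hom V U') (u : k),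
    [/\ V (x, u), f (x, u) = t, f' (x, u) = t' &
        coboundary everywhere (res f s - res f' s')].

(* A projective system of complexes (K_r) of abelian sheaves; K_r is meant to
   have coefficients Z/l^r. *)
Record adic_complex := AdicComplex {
  acpx :> nat -> complex;
  atr : forall r i, sh_mor (acpx r.+1 i) (acpx r i);
  atr_diff : forall r i U (s : acpx r.+1 i U),
    cdiff (acpx r) i U (atr r i U s)
      = atr r i.+1 U (cdiff (acpx r.+1) i U s) }.

Arguments atr : clear implicits.

(* K is an injective resolution of the l-adic intersection complex of the
   closure of O_A, extended by zero to X x X and normalized to be the constant
   sheaf in degree 0 on O_A.  On each stratum O_{A'} with A' < A, of
   codimension c, the support and cosupport conditions are H^i(i^* K) = 0 for
   i >= c and H^i(i^! K) = 0 for i <= c.  They are imposed on every K_r: these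
   are given by Deligne's formula (iterated truncated direct images) with
   coefficients Z/l^r, and the system they form represents the intersection
   complex over Q_l.  Injectivity is required for sheaves of abelian groups
   rather than of Z/l^r-modules, which gives the same derived functors but
   allows maps K_(r+1) -> K_r of actual complexes. *)
Definition is_IC (l : nat) (dimO : Xi n d -> nat) (A : Xi n d)
    (K : adic_complex) : Prop :=
  [/\ forall r i, is_injective_sheaf (K r i),
      forall r i x, ~ orbit_closure A x -> stalk_vanish everywhere (K r) x i,
      (* on O_A, K is the constant system (Z/l^r)_r in degree 0, generated by
         a section sigma over some open subset Om containing O_A *)
      (forall r i x, in_orbit A x -> (0 < i)%N ->
         stalk_vanish everywhere (K r) x i) /\
      (exists (Om : etale) (sigma : forall r, K r 0%N Om),
         [/\ (forall x t, Om (x, t) -> t = 0) /\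
             (forall x, in_orbit A x -> Om (x, 0)),
             forall r, cdiff (K r) 0 Om (sigma r) = 0,
             forall r, atr K r 0 Om (sigma r.+1) = sigma r,
             forall r x (m : int), in_orbit A x ->
               (same_class x 0 (sigma r *~ m) 0 (0 : K r 0%N Om) <->
                ((l ^ r)%:Z %| m)%Z) &
             forall r x (U : etale) t (s : K r 0%N U),
               in_orbit A x -> U (x, t) -> cdiff (K r) 0 U s = 0 ->
               exists m : int, same_class x t s 0 (sigma r *~ m)]),
      forall r i A' x, leXi A' A -> A' != A -> in_orbit A' x ->
        (dimO A <= i + dimO A')%N -> stalk_vanish everywhere (K r) x i &
      forall r i A' x, leXi A' A -> A' != A -> in_orbit A' x ->
        (i + dimO A' <= dimO A)%N ->
        stalk_vanish (fun y => in_orbit A' y) (K r) x i].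

(* m elements of lim_r H^i(K_r)_x, the j-th one being represented for each r
   by the cocycle s r j on a neighbourhood (U r, t r) of x *)
Record limit_family (K : adic_complex) (x : pt) (i m : nat) := LimitFamily {
  lf_nbhd : nat -> etale;
  lf_pt : nat -> k;
  lf_sec : forall r, 'I_m -> K r i (lf_nbhd r);
  lf_mem : forall r, lf_nbhd r (x, lf_pt r);
  lf_cocycle : forall r j, cdiff (K r) i (lf_nbhd r) (lf_sec r j) = 0;
  lf_compat : forall r j,
    same_class x (lf_pt r.+1) (atr K r i _ (lf_sec r.+1 j))
                 (lf_pt r) (lf_sec r j) }.

(* An element of Z_l, as a coherent sequence of integers a r mod l^r *)
Definition is_adic_int (l : nat) (a : nat -> int) : Prop :=
  forall r, (a r.+1 = a r %[mod (l ^ r)%:Z])%Z.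

(* The stalk H^i(K)_x = (lim_r H^i(K_r)_x) (x) Q_l has dimension m over Q_l:
   it has a basis consisting of m elements of lim_r H^i(K_r)_x. *)
Definition stalk_dim (l : nat) (K : adic_complex) (x : pt) (i m : nat)
    : Prop :=
  exists e : limit_family K x i m,
    let comb (a : 'I_m -> nat -> int) r :=
      \sum_(j < m) lf_sec e r j *~ a j r in
    (forall a : 'I_m -> nat -> int, (forall j, is_adic_int l (a j)) ->
       (forall r, same_class x (lf_pt e r) (comb a r)
                               (lf_pt e r) (0 : K r i (lf_nbhd e r))) ->
       forall j r, ((l ^ r)%:Z %| a j r)%Z) /\
    (forall y : limit_family K x i 1,
       exists (c : nat) (a : 'I_m -> nat -> int),
         (forall j, is_adic_int l (a j)) /\
         (forall r, same_class x (lf_pt y r) (lf_sec y r ord0 *+ l ^ c)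
                                 (lf_pt e r) (comb a r))).

(* P = P_{A',A}, computed from the complex K = IC_A *)
Definition is_IC_poly (l : nat) (dimO : Xi n d -> nat) (K : adic_complex)
    (A' A : Xi n d) (P : laurent) : Prop :=
  exists (h : nat -> nat) (b : nat),
    [/\ forall i x, in_orbit A' x -> stalk_dim l K x i (h i),
        forall i, (b <= i)%N -> h i = 0%N &
        P = \sum_(i < b) vpow (i%:Z - (dimO A)%:Z + (dimO A')%:Z) *+ h i].

End EtaleSheaves.

(* The free A-module on the e_A, as coordinate vectors *)
Definition Sj (n d : nat) := {ffun Xi n d -> laurent^o}.

Definition eXi n d (A : Xi n d) : Sj n d := [ffun A' => (A' == A)%:R].

Definition std n d (A : Xi n d) : Sj n d := vpow (- (dXi A)%:Z) *: eXi A.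

Definition canon_elt n d (le : Xi n d -> Xi n d -> Prop)
    (P : Xi n d -> Xi n d -> laurent) (A : Xi n d) : Sj n d :=
  \sum_(A' | `[< le A' A >]) P A' A *: std A'.

Definition is_bar n d (b : Xi n d -> Sj n d) (bar : Sj n d -> Sj n d) : Prop :=
  [/\ forall x y, bar (x + y) = bar x + bar y,
      forall m x, bar (vpow m *: x) = vpow (- m) *: bar x &
      forall A, bar (b A) = b A].

Definition Sj_form n d (f : Xi n d -> laurent) (x y : Sj n d) : Qv :=
  \sum_A lval (x A) * lval (y A) *
    (vQ ^ (2 * ((dXi A)%:Z - (dXi (trXi A))%:Z)) * lval (f A)).

(* Main.v *)
Require Import Defs.
From mathcomp Require Import all_boot all_order all_algebra all_field.
From mathcomp Require Import perm boolp ring zify.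
From mathcomp Require mxabelem.

Set Implicit Arguments.
Unset Strict Implicit.
Unset Printing Implicit Defensive.

Import Order.TTheory GRing.Theory Num.Theory.

(* The form.  Modulo v^-1 Z[v^-1] everything depends only on the leading term
   of f_A, which is v^(2 d_(tA)).  To find it, count over F_p: a flag L in the
   fibre over L' is enriched to a sequence of isotropic vectors, one for each
   unit of the entries c_ij of tA with j <= n, which spans L_1, ..., L_n and is
   adapted to L'.  Going through the rows of tA in increasing order, each vector
   can be chosen in q^e (1 + O(1/q)) ways, both among all isotropic vectors and
   for a given L.  The exponents for the two counts differ by d_(tA) in total,
   and a Laurent polynomial is determined by its growth at the square roots of
   the primes.

   The polynomials P.  For A' < A the support condition makes P_(A',A) vanish or
   lie in v^-1 Z[v^-1].  That P_(A,A) = 1 amounts to the stalk in degree 0 on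
   O_A having rank one: its elements are compatible systems of multiples of one
   section sigma, and two such systems a sigma and b sigma satisfy the relation
   b (a sigma) - a (b sigma) = 0.  To compute with germs one needs that etale
   neighbourhoods of a point are filtered; a common refinement of two of them is
   written down explicitly, with the eigenvalues of a companion matrix in place
   of the coordinate on the first.

   Hence the Gram matrix of the {A} is congruent to 1.  If b = sum c_A {A} is
   almost normal, the coefficients of the highest power of v in the c_A
   contribute a nonzero sum of squares, so this power is v^0; bar-invariance
   then makes the c_A integers, with sum of squares 1. *)

(** * Counting sequences step by step *)

(** Counting sequences makes both numbers products of one-step counts in linear algebra. Each step
    is estimated only up to a relative error O(1/q), which the leading coefficient of a polynomial
    in q does not see. The delicate step is the middle row. There the orthogonal of the forbidden
    subspace is no longer isotropic, and an isotropic vector outside that subspace has to be found;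
    it is taken from an isotropic subspace of dimension d lying between the two middle members of
    the flag. As f_A is the same polynomial for all forms, it may be tested on a form and a flag for
    which such a subspace is visible. On the etale side, an object of the site carries one
    coordinate t over X x X, whereas the fibre product of two objects carries two. A common
    refinement therefore requires a primitive element, from which both old coordinates are recovered
    by rational functions; a resultant written as a determinant, together with its adjugate,
    provides them. *)

Section SequentialCount.
Variables (T : finType) (L : Type) (step : L -> seq L -> seq T -> T -> bool).

(* Lists are built from the tail: the head is the latest choice. *)
Fixpoint frame (ls : seq L) (vs : seq T) : bool :=
  match ls, vs with
  | l :: ls', v :: vs' => frame ls' vs' && step l ls' vs' v
  | [::], [::] => true
  | _, _ => false
  end.

Fixpoint all_suffix (Pr : L -> seq L -> Prop) (ls : seq L) : Prop :=
  if ls is l :: ls' then Pr l ls' /\ all_suffix Pr ls' else True.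

Fixpoint suffix_sum (e : L -> seq L -> nat) (ls : seq L) : nat :=
  if ls is l :: ls' then e l ls' + suffix_sum e ls' else 0.

Definition frames (ls : seq L) : {set (size ls).-tuple T} :=
  [set t : (size ls).-tuple T | frame ls t].

Lemma card_frames_cons l ls :
  #|frames (l :: ls)| = \sum_(t in frames ls) #|[set v | step l ls t v]|.
Proof.
rewrite -sum1_card (eq_bigr (fun t : (size ls).-tuple T =>
  \sum_(v | step l ls t v) 1)); last by move=> t _; rewrite sum1dep_card.
rewrite pair_big_dep /=.
rewrite (reindex (fun p : (size ls).-tuple T * T => [tuple of p.2 :: p.1])) /=.
  by apply: eq_bigl => -[t v]; rewrite !inE.
exists (fun t : (size ls).+1.-tuple T => ([tuple of behead t], thead t)).
  by move=> [t v] _; congr (_, _); apply: val_inj.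
by move=> t _; rewrite [RHS]tuple_eta.
Qed.

(** The one-step estimates multiply along the list. Division is avoided: a factor 1 - a/q appears as
    q - a, with a matching q on the side of the cardinal, whence [q ^ size ls] in front of the
    count. *)
Lemma card_frames_bounds (Pr : L -> seq L -> Prop) (e : L -> seq L -> nat)
    (q a b : nat) (ls : seq L) :
  0 < q ->
  (forall l ls vs, Pr l ls -> all_suffix Pr ls -> frame ls vs ->
     (q - a) * q ^ e l ls <= q * #|[set v | step l ls vs v]| <= (q + b) * q ^ e l ls) ->
  all_suffix Pr ls ->
  (q - a) ^ size ls * q ^ suffix_sum e ls <= q ^ size ls * #|frames ls|
    <= (q + b) ^ size ls * q ^ suffix_sum e ls.
Proof.
move=> q0 H; elim: ls => [|l ls IH] /= => [_|[Pl Pls]].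
  have -> : #|frames [::]| = 1.
    by apply: (@eq_card1 _ [tuple]) => t; rewrite !inE (tuple0 t) eqxx.
  by [].
have /andP[IH1 IH2] := IH Pls.
rewrite card_frames_cons !expnSr !expnD -!mulnA.
have bnd (t : (size ls).-tuple T) : t \in frames ls ->
    (q - a) * q ^ e l ls <= q * #|[set v | step l ls t v]| <= (q + b) * q ^ e l ls.
  by rewrite inE => ft; apply: H.
have E : q ^ size ls * (q * \sum_(t in frames ls) #|[set v | step l ls t v]|)
  = q ^ size ls * \sum_(t in frames ls) q * #|[set v | step l ls t v]|.
  by rewrite big_distrr.
rewrite E; apply/andP; split.
  apply: leq_trans (_ : _ <= q ^ size ls * \sum_(t in frames ls) (q - a) * q ^ e l ls) _.
    rewrite sum_nat_const !mulnA [_ * (q - a) * _]mulnAC.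
    have := leq_mul IH1 (leqnn ((q - a) * q ^ e l ls)); rewrite !mulnA.
    by rewrite [X in X * _ <= _ -> _]mulnC; apply: leq_trans; apply: eq_leq; ring.
  by rewrite leq_mul2l; apply/orP; right; apply: leq_sum => t /bnd/andP[].
apply: leq_trans (_ : q ^ size ls * \sum_(t in frames ls) (q + b) * q ^ e l ls <= _).
  by rewrite leq_mul2l; apply/orP; right; apply: leq_sum => t /bnd/andP[].
rewrite sum_nat_const.
have := leq_mul IH2 (leqnn ((q + b) * q ^ e l ls)) => h.
apply: leq_trans (leq_trans (eq_leq _) h) (eq_leq _); ring.
Qed.

End SequentialCount.

(** * Labels and exponents *)

Lemma all_suffix_imp (L : Type) (P Q : L -> seq L -> Prop) ls :
  (forall l ls, P l ls -> Q l ls) -> all_suffix P ls -> all_suffix Q ls.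
Proof. by move=> PQ; elim: ls => //= l ls IH [/PQ ? /IH]. Qed.

Lemma all_suffix_and (L : Type) (P Q : L -> seq L -> Prop) ls :
  all_suffix P ls -> all_suffix Q ls -> all_suffix (fun l ls => P l ls /\ Q l ls) ls.
Proof. by elim: ls => //= l ls IH [? /IH h] [? /h]. Qed.

Lemma all_suffix_count (L : Type) (labs : seq L) :
  all_suffix (fun l ls => forall Q : pred L, (count Q (l :: ls) <= count Q labs)) labs.
Proof.
suff H ls : (forall Q : pred L, count Q ls <= count Q labs) ->
    all_suffix (fun l ls => forall Q : pred L, (count Q (l :: ls) <= count Q labs)) ls.
  exact: H.
elim: ls => //= l ls IH h; split=> //; apply: IH => Q.
by apply: leq_trans (h Q); rewrite leq_addl.
Qed.

Lemma all_suffix_pairwise (L : Type) (R : rel L) (labs : seq L) :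
  pairwise R labs -> all_suffix (fun l ls => all (R l) ls) labs.
Proof. by elim: labs => //= l ls IH /andP[? /IH]. Qed.

Lemma pairwise_rev (L : Type) (R : rel L) s :
  pairwise R (rev s) = pairwise (fun x y => R y x) s.
Proof.
elim: s => //= x s IH; rewrite rev_cons -cats1 pairwise_cat IH /= andbT.
by rewrite allrel1r all_rev.
Qed.

Section Labels.
Variables (c : nat -> nat -> nat) (N n : nat).
Local Notation label := (nat * nat)%type.

Definition label_blocks : seq label :=
  flatten [seq flatten [seq nseq (c i j) (i, j) | j <- iota 0 n] | i <- iota 0 N].
(** Reversed because frames grow at the head: the vectors of row 0 are chosen before all others, so
    their labels must come last. *)
Definition labs : seq label := rev label_blocks.

Definition lex_le : rel label :=
  fun l l' => (l.1 < l'.1) || ((l.1 == l'.1) && (l.2 <= l'.2)).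

Lemma count_labs (Q : pred label) :
  count Q labs = \sum_(0 <= i < N) \sum_(0 <= j < n | Q (i, j)) c i j.
Proof.
rewrite count_rev count_flatten sumnE !big_map /index_iota subn0.
apply: eq_bigr => i _; rewrite count_flatten sumnE !big_map [RHS]big_mkcond subn0.
by apply: eq_bigr => j _; rewrite count_nseq; case: (Q _); rewrite ?mul1n.
Qed.

Lemma pairwise_flatten (L : Type) (R : rel L) (f : nat -> seq L) s :
  pairwise ltn s -> (forall i, pairwise R (f i)) ->
  (forall i j, i < j -> allrel R (f i) (f j)) -> pairwise R (flatten [seq f i | i <- s]).
Proof.
move=> + hf hij; elim: s => //= i s IH /andP[is_ /IH ps]; rewrite pairwise_cat hf ps !andbT.
elim: s is_ {IH ps} => [|j s IH] /=; first by rewrite allrel0r.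
by move=> /andP[ij /IH h]; rewrite allrel_catr hij.
Qed.

Lemma labs_sorted : pairwise (fun l l' => lex_le l' l) labs.
Proof.
rewrite pairwise_rev; apply: pairwise_flatten => [|i|i i' ii'].
- by rewrite -sorted_pairwise; [exact: iota_ltn_sorted|exact: ltn_trans].
- apply: pairwise_flatten => [|j|j j' jj'].
  + by rewrite -sorted_pairwise; [exact: iota_ltn_sorted|exact: ltn_trans].
  + elim: (c i j) => //= m ->; rewrite andbT all_nseq /lex_le /= eqxx leqnn.
    by rewrite ltnn orbT.
  + apply/allrelP => x y /nseqP[-> _] /nseqP[-> _].
    by rewrite /lex_le /= eqxx (ltnW jj') orbT.
- apply/allrelP => x y /flattenP[s /mapP[j _ ->] /nseqP[-> _]].
  by move=> /flattenP[s' /mapP[j' _ ->] /nseqP[-> _]]; rewrite /lex_le /= ii'.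
Qed.

Lemma mem_labs l : l \in labs -> l.1 < N /\ l.2 < n.
Proof.
rewrite mem_rev => /flattenP[s /mapP[i + ->]]; rewrite mem_iota add0n => /andP[_ iN].
by case/flattenP => s' /mapP[j + ->]; rewrite mem_iota add0n => /andP[_ jn] /nseqP[-> _].
Qed.

(** The last clause, for [Q] selecting one row or part of it, bounds the number of earlier vectors
    there by entries of the matrix, with the new vector already included; this is the source of all
    strict inequalities below. *)
Definition label_ok (l : label) (ls : seq label) : Prop :=
  [/\ l.1 < N, l.2 < n, forall l', l' \in ls -> lex_le l' l &
      forall Q : pred label, count Q (l :: ls) <= count Q labs].

Lemma labs_ok : all_suffix label_ok labs.
Proof.
have h1 := all_suffix_pairwise labs_sorted; have h2 := all_suffix_count labs.
apply: all_suffix_imp (all_suffix_and h1 h2) => l ls [h hQ].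
have /mem_labs[lN ln] : l \in labs.
  by rewrite -has_pred1 has_count (leq_trans _ (hQ _)) //= eqxx.
by split=> // l' l'ls; move/allP: h; apply.
Qed.

Lemma sum_labs (g : label -> nat) :
  \sum_(l <- labs) g l = \sum_(0 <= i < N) \sum_(0 <= j < n) c i j * g (i, j).
Proof.
rewrite (perm_big label_blocks) /=; last by rewrite perm_rev.
rewrite big_flatten big_map /index_iota !subn0; apply: eq_bigr => i _.
rewrite big_flatten big_map; apply: eq_bigr => j _.
by rewrite big_nseq iter_addn_0 mulnC.
Qed.

(** An unordered pair of distinct positions is seen once by the suffix sum and twice by the full
    sum; a position paired with itself is seen only by the latter. *)
Lemma suffix_sum_pairs (R : rel label) ls : symmetric R ->
  2 * suffix_sum (fun l ls => count (R l) ls) ls + count (fun l => R l l) ls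
    = \sum_(l <- ls) count (R l) ls.
Proof.
move=> symR; elim: ls => [|l ls IH] /=; first by rewrite big_nil.
rewrite big_cons /= big_split /= -IH.
have -> : \sum_(i <- ls) R i l = count (R l) ls.
  by rewrite -sum1_count [RHS]big_mkcond; apply: eq_bigr => i _; rewrite symR; case: (R l i).
by lia.
Qed.

End Labels.

(** * The dimension formula as a sum over pairs of matrix entries *)

Section Exponents.
Variables (n : nat).
Local Notation N := (n.*2.+1).
Variable c : 'I_N -> 'I_N -> nat.
Hypothesis c_sym : forall i j, c (rev_ord i) (rev_ord j) = c i j.
Local Notation pred4 := (nat -> nat -> nat -> nat -> nat).

Definition pair_sum (P : pred4) : nat :=
  \sum_(i < N) \sum_(j < N) \sum_(k < N) \sum_(l < N) P i j k l * (c i j * c k l).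

Lemma pair_sum_ext (P P' : pred4) :
  (forall i j k l, i < N -> j < N -> k < N -> l < N -> P i j k l = P' i j k l) ->
  pair_sum P = pair_sum P'.
Proof.
move=> h; apply: eq_bigr => i _; apply: eq_bigr => j _; apply: eq_bigr => k _.
by apply: eq_bigr => l _; rewrite h.
Qed.

Lemma pair_sumD (P P' : pred4) :
  pair_sum (fun i j k l => P i j k l + P' i j k l) = pair_sum P + pair_sum P'.
Proof.
rewrite /pair_sum -big_split; apply: eq_bigr => i _; rewrite -big_split.
apply: eq_bigr => j _; rewrite -big_split; apply: eq_bigr => k _; rewrite -big_split.
by apply: eq_bigr => l _; rewrite mulnDl.
Qed.

Lemma pair_sum_swap (P : pred4) : pair_sum P = pair_sum (fun i j k l => P k l i j).
Proof.
rewrite /pair_sum pair_big /=.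
transitivity (\sum_(p : 'I_N * 'I_N) \sum_(p' : 'I_N * 'I_N)
  P p.1 p.2 p'.1 p'.2 * (c p.1 p.2 * c p'.1 p'.2)).
  by apply: eq_bigr => p _; rewrite pair_big.
rewrite exchange_big /= [RHS]pair_big /=; apply: eq_bigr => p _.
by rewrite [RHS]pair_big; apply: eq_bigr => p' _; rewrite [c p'.1 _ * _]mulnC.
Qed.

(** As c is centrally symmetric, the symmetry may be applied to one factor alone. This exchanges
    conditions on i + k with conditions comparing i and k. *)
Lemma pair_sum_rev2 (P : pred4) :
  pair_sum P = pair_sum (fun i j k l => P i j (n.*2 - k) (n.*2 - l)).
Proof.
apply: eq_bigr => i _; apply: eq_bigr => j _.
rewrite (reindex_inj rev_ord_inj); apply: eq_bigr => k _.
by rewrite (reindex_inj rev_ord_inj); apply: eq_bigr => l _; rewrite c_sym /= !subSS.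
Qed.

Lemma pair_sum_rev (P : pred4) :
  pair_sum P = pair_sum (fun i j k l => P (n.*2 - k) (n.*2 - l) (n.*2 - i) (n.*2 - j)).
Proof.
rewrite pair_sum_rev2 pair_sum_swap pair_sum_rev2; apply: pair_sum_ext => *.
by [].
Qed.

Lemma pair_sum_diag_row (Q : nat -> nat -> nat -> nat) :
  pair_sum (fun i j k l => (i == k) * Q i j l) =
  \sum_(i < N) \sum_(j < N) \sum_(l < N) Q i j l * (c i j * c i l).
Proof.
apply: eq_bigr => i _; apply: eq_bigr => j _; rewrite (bigD1 i) //=.
rewrite [X in _ + X]big1 ?addn0 => [|k ki]; last first.
  by apply: big1 => l _; rewrite eq_sym (negbTE ki : (k == i :> nat) = false) mul0n.
by apply: eq_bigr => l _; rewrite eqxx mul1n.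
Qed.

Lemma pair_sum_diag (Q : nat -> nat -> nat) :
  pair_sum (fun i j k l => (i == k) * ((j == l) * Q i j)) =
  \sum_(i < N) \sum_(j < N) Q i j * (c i j * c i j).
Proof.
rewrite (pair_sum_diag_row (fun i j l => (j == l) * Q i j)).
apply: eq_bigr => i _; apply: eq_bigr => j _; rewrite (bigD1 j) //=.
rewrite big1 ?addn0 ?eqxx ?mul1n // => l lj.
by rewrite eq_sym (negbTE lj : (l == j :> nat) = false) mul0n.
Qed.

(* [P_one], [P_two] and [P_three] are the index sets of the three sums in d_A;
   folding [P_all] by the symmetry of c gives 2 d_A up to a linear term. *)
Definition P_all : pred4 := fun i j k l => (k <= i) && (j < l).
Definition P_one : pred4 := fun i j k l => [&& k < i, j < l & i + k < n.*2].
Definition P_two : pred4 := fun i j k l =>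
  (i == k) * ((j < l) && ((i < n) || (j + l < n.*2))).
Definition P_three : pred4 := fun i j k l => (i == k) * ((j == l) * ((n <= i) && (j < n))).

(** Split by k < i or k = i, by the position of i + k relative to 2n, and in row n by that of j + l.
    Parts beyond 2n mirror those below it under central symmetry combined with exchange of the
    factors. On the line i + k = 2n, reflecting (k, l) puts both entries into one row; the terms
    with j = l obtained in this way, and likewise from row n, make up [P_three]. *)
Lemma dim_pair_sum : pair_sum P_all = 2 * pair_sum P_one + 2 * pair_sum P_two + pair_sum P_three.
Proof.
pose Pgt : pred4 := fun i j k l => [&& k < i, j < l & n.*2 < i + k].
pose Peq : pred4 := fun i j k l => [&& k < i, j < l & i + k == n.*2].
pose Rlt : pred4 := fun i j k l => [&& i == k, j < l & i < n].
pose Rgt : pred4 := fun i j k l => [&& i == k, j < l & n < i].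
pose Mlt : pred4 := fun i j k l => [&& i == k, j < l, i == n & j + l < n.*2].
pose Meq : pred4 := fun i j k l => [&& i == k, j < l, i == n & j + l == n.*2].
pose Mgt : pred4 := fun i j k l => [&& i == k, j < l, i == n & n.*2 < j + l].
pose PA : pred4 := fun i j k l => (k < i) && (j < l).
pose PB : pred4 := fun i j k l => (i == k) && (j < l).
pose PM : pred4 := fun i j k l => [&& i == k, j < l & i == n].
have E1 : pair_sum P_all = pair_sum PA + pair_sum PB.
  rewrite -pair_sumD; apply: pair_sum_ext => i j k l *.
  by rewrite /P_all /PA /PB; lia.
have EA : pair_sum PA = pair_sum P_one + pair_sum Pgt + pair_sum Peq.
  rewrite -!pair_sumD; apply: pair_sum_ext => i j k l *.
  by rewrite /PA /P_one /Pgt /Peq; lia.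
have EB : pair_sum PB = pair_sum Rlt + pair_sum Rgt + pair_sum PM.
  rewrite -!pair_sumD; apply: pair_sum_ext => i j k l *.
  by rewrite /PB /Rlt /Rgt /PM; lia.
have EM : pair_sum PM = pair_sum Mlt + pair_sum Meq + pair_sum Mgt.
  rewrite -!pair_sumD; apply: pair_sum_ext => i j k l *.
  by rewrite /PM /Mlt /Meq /Mgt; lia.
have E2 : pair_sum Pgt = pair_sum P_one.
  rewrite pair_sum_rev; apply: pair_sum_ext => i j k l *.
  rewrite /Pgt /P_one; lia.
pose Qlt : pred4 := fun i j k l => [&& i == k, j < l, n < i & j + l < n.*2].
pose Qgt : pred4 := fun i j k l => [&& i == k, l < j, n < i & j + l < n.*2].
pose Qeq : pred4 := fun i j k l => [&& i == k, j == l, n < i & j < n].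
have E3 : pair_sum Peq = pair_sum Qlt + pair_sum Qgt + pair_sum Qeq.
  rewrite pair_sum_rev2 -!pair_sumD; apply: pair_sum_ext => i j k l *.
  rewrite /Peq /Qlt /Qgt /Qeq; lia.
have E4 : pair_sum Qgt = pair_sum Qlt.
  rewrite pair_sum_swap; apply: pair_sum_ext => i j k l *.
  rewrite /Qlt /Qgt; lia.
have E5 : pair_sum Rgt = pair_sum Rlt.
  rewrite pair_sum_rev; apply: pair_sum_ext => i j k l *.
  rewrite /Rlt /Rgt; lia.
have E6 : pair_sum Mgt = pair_sum Mlt.
  rewrite pair_sum_rev; apply: pair_sum_ext => i j k l *.
  rewrite /Mlt /Mgt; lia.
pose Ndiag : pred4 := fun i j k l => [&& i == k, j == l, i == n & j < n].
have E7 : pair_sum Meq = pair_sum Ndiag.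
  rewrite pair_sum_rev2; apply: pair_sum_ext => i j k l *.
  rewrite /Meq /Ndiag; lia.
have E8 : pair_sum P_two = pair_sum Rlt + pair_sum Qlt + pair_sum Mlt.
  rewrite -!pair_sumD; apply: pair_sum_ext => i j k l *.
  rewrite /P_two /Rlt /Qlt /Mlt; lia.
have E9 : pair_sum P_three = pair_sum Qeq + pair_sum Ndiag.
  rewrite -!pair_sumD; apply: pair_sum_ext => i j k l *.
  rewrite /P_three /Qeq /Ndiag; lia.
by rewrite E1 EA EB EM E2 E3 E4 E5 E6 E7 E8 E9; clear; ring.
Qed.

(** Everything is compared with the pairs j < n < l, k <= i. Central symmetry carries the part of
    [P_all] with n <= j onto the pairs with j < l <= n, and reflecting the second factor alone
    carries the last sum onto j < n < l. *)
Lemma count_pair_sum :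
  2 * pair_sum (fun i j k l => [&& j < n, k <= i & j < l]) =
  pair_sum P_all + pair_sum (fun i j k l => [&& j < n, l < n & n.*2 <= i + k]).
Proof.
pose L : pred4 := fun i j k l => [&& j < n, k <= i & j < l].
pose U : pred4 := fun i j k l => [&& n <= j, k <= i & j < l].
pose X : pred4 := fun i j k l => [&& j < n, n < l & k <= i].
have E1 : pair_sum P_all = pair_sum L + pair_sum U.
  by rewrite -pair_sumD; apply: pair_sum_ext => i j k l *; rewrite /P_all /L /U; lia.
have E2 : pair_sum L = pair_sum U + pair_sum X.
  rewrite (pair_sum_rev U) -pair_sumD; apply: pair_sum_ext => i j k l *.
  rewrite /L /U /X; lia.
have E3 : pair_sum (fun i j k l => [&& j < n, l < n & n.*2 <= i + k]) = pair_sum X.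
  rewrite pair_sum_rev2; apply: pair_sum_ext => i j k l *.
  rewrite /X; lia.
by rewrite E3 -/L E1 E2; lia.
Qed.

End Exponents.

(** The linear term is what a(a - 1), twice the summand of the third sum in d_A, lacks to be a^2. *)
Lemma dXi_pair_sum n d (A : Xi n d) (c := fun i j => entry A i j) :
  2 * dXi A + \sum_(i < odim n) \sum_(j < odim n) ((n <= i) && (j < n)) * c i j
    = pair_sum c P_all.
Proof.
have c_sym i j : c (rev_ord i) (rev_ord j) = c i j.
  rewrite /c /entry; case: A {c} => A /= /andP[_ /forallP/(_ i)/forallP/(_ j)/eqP ->].
  by [].
pose S3 := \sum_(i < odim n | i.+1 >= n + 1) \sum_(j < odim n | n + 1 > j.+1)
  (entry A i j * (entry A i j - 1)) %/ 2.
have -> : dXi A = pair_sum c (P_one n) + pair_sum c (P_two n) + S3.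
  rewrite /dXi; congr (_ + _ + _).
  - apply: eq_bigr => i _; apply: eq_bigr => j _; apply: eq_bigr => k _.
    rewrite big_mkcond; apply: eq_bigr => l _; rewrite /P_one /c.
    have -> : (i.+1 + k.+1 < odim n + 1) = (i + k < n.*2) by clear; lia.
    by rewrite !ltnS; case: ifP => _; rewrite ?mul1n.
  - rewrite (pair_sum_diag_row c (fun i j l => (j < l) && ((i < n) || (j + l < n.*2)))).
    apply: eq_bigr => i _; apply: eq_bigr => j _; rewrite big_mkcond.
    apply: eq_bigr => l _.
    have -> : (j.+1 < odim n + 1 - l.+1) = (j + l < n.*2) by clear; lia.
    have -> : (i.+1 < n + 1) = (i < n) by clear; lia.
    by rewrite !ltnS /c; case: ifP => _; rewrite ?mul1n.
have E3 : 2 * S3 + \sum_(i < odim n) \sum_(j < odim n) ((n <= i) && (j < n)) * c i j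
    = pair_sum c (P_three n).
  rewrite (pair_sum_diag c (fun i j => (n <= i) && (j < n))).
  rewrite /S3 big_distrr big_mkcond -big_split; apply: eq_bigr => i _ /=.
  have -> : (n + 1 <= i.+1) = (n <= i) by clear; lia.
  case: ifP => ni; last by rewrite add0n; apply: eq_bigr => j _; rewrite mul0n.
  rewrite big_distrr big_mkcond -big_split; apply: eq_bigr => j _ /=.
  have -> : (n + 1 > j.+1) = (j < n) by clear; lia.
  case: ifP => jn; last by rewrite !mul0n.
  rewrite !mul1n /c; case: (entry A i j) => // m.
  have dv : 2 %| m.+1 * m by rewrite dvdn2 oddM /= andNb.
  by rewrite subn1 /= [2 * _]mulnC divnK // [in RHS]mulnS addnC.
by rewrite (dim_pair_sum c_sym) -E3 !mulnDr -!addnA.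
Qed.

Section FrameExponents.
Variables (n d : nat) (A : Xi n d).
Local Notation N := (odim n).
Local Notation label := (nat * nat)%type.

(* entries indexed by naturals; meaningful for i, j < N only *)
Definition nentry (i j : nat) : nat := entry A (inord i) (inord j).

Lemma nentry_ord (i j : 'I_N) : nentry i j = entry A i j.
Proof. by rewrite /nentry !inord_val. Qed.

Definition corner (a b : nat) : nat := \sum_(0 <= i < a) \sum_(0 <= j < b) nentry i j.

Lemma big_widen_ord (a m : nat) (g : nat -> nat) : a <= m ->
  \sum_(0 <= i < a) g i = \sum_(i < m) (i < a) * g i.
Proof.
move=> am; rewrite (big_nat_widen _ _ _ _ _ am) big_mkord big_mkcond /=.
by apply: eq_bigr => i _; case: (i < a); rewrite ?mul1n.
Qed.

Lemma corner_ord a b : a <= N -> b <= N ->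
  corner a b = \sum_(i < N) \sum_(j < N) ((i < a) && (j < b)) * entry A i j.
Proof.
move=> aN bN; rewrite /corner (big_widen_ord _ aN); apply: eq_bigr => i _.
rewrite (big_widen_ord _ bN) big_distrr /=; apply: eq_bigr => j _.
by rewrite nentry_ord mulnA mulnb.
Qed.

Local Notation labs := (labs nentry N n).

Lemma sum_labs_ord (g : label -> nat) :
  \sum_(l <- labs) g l = \sum_(i < N) \sum_(j < N) (j < n) * entry A i j * g (i : nat, j : nat).
Proof.
have nN : n <= N by clear; lia.
rewrite sum_labs big_mkord; apply: eq_bigr => i _; rewrite (big_widen_ord _ nN).
by apply: eq_bigr => j _; rewrite nentry_ord mulnA.
Qed.

Lemma count_labs_ord (Q : pred label) :
  count Q labs = \sum_(i < N) \sum_(j < N) ((j < n) && Q (i : nat, j : nat)) * entry A i j.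
Proof.
rewrite -sum1_count big_mkcond sum_labs_ord; apply: eq_bigr => i _.
apply: eq_bigr => j _; rewrite -mulnA [entry _ _ _ * _]mulnC mulnA.
by case: (Q _); case: (j < n).
Qed.

(** The exponent for isotropic choices in row i: the dimension of V_(i+1), less one for each earlier
    vector whose row is not orthogonal to V_(i+1), less one for the equation [bil v v = 0], which
    holds on all of V_(i+1) when i < n. In [e_in] it is the dimension of the intersection of V_(i+1)
    and L_(j+1). *)
Definition e_iso (l : label) (ls : seq label) : nat :=
  corner l.1.+1 N - count (fun l' : label => N - l.1.+1 <= l'.1) ls - (n <= l.1).
Definition e_in (l : label) (ls : seq label) : nat := corner l.1.+1 l.2.+1.

(** After doubling, this is an identity of pair sums. The earlier vectors subtracted in [e_iso] are
    those with i + i' >= 2n, a symmetric condition, so [suffix_sum_pairs] evaluates twice their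
    total. The hypothesis keeps the subtractions from being truncated at 0. *)
Lemma frame_exponents :
  all_suffix (fun l ls => count (fun l' : label => N - l.1.+1 <= l'.1) ls + (n <= l.1)
                          <= corner l.1.+1 N) labs ->
  suffix_sum e_iso labs = suffix_sum e_in labs + dXi A.
Proof.
pose R : rel label := fun l l' => n.*2 <= l.1 + l'.1.
have symR : symmetric R by move=> x y; rewrite /R addnC.
have Rcount (l : label) ls : count (fun l' : label => N - l.1.+1 <= l'.1) ls = count (R l) ls.
  by apply: eq_count => l'; rewrite /R /=; clear; lia.
have Rdiag : count (fun l => R l l) labs = count (fun l : label => n <= l.1) labs.
  by apply: eq_count => l; rewrite /R /=; clear; lia.
have E1 ls : all_suffix (fun l ls => count (fun l' : label => N - l.1.+1 <= l'.1) ls + (n <= l.1)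
                          <= corner l.1.+1 N) ls ->
    suffix_sum e_iso ls + suffix_sum (fun l ls => count (R l) ls) ls
      + count (fun l : label => n <= l.1) ls = \sum_(l <- ls) corner l.1.+1 N.
  elim: ls => [|l ls IH] /=; first by rewrite big_nil.
  by move=> [h /IH E]; rewrite big_cons -E /e_iso Rcount; rewrite Rcount in h; clear - h; lia.
have E2 ls : suffix_sum e_in ls = \sum_(l <- ls) corner l.1.+1 l.2.+1.
  by elim: ls => [|l ls IH] /=; rewrite ?big_nil // big_cons IH.
have E3 := suffix_sum_pairs labs symR.
move=> /E1 {}E1.
pose c := fun i j : 'I_N => entry A i j.
have c_sym i j : c (rev_ord i) (rev_ord j) = c i j.
  rewrite /c /entry; case: A => M /= /andP[_ /forallP/(_ i)/forallP/(_ j)/eqP ->].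
  by [].
have F (g : label -> nat) (Q : nat -> nat -> nat -> nat -> bool) :
    (forall i j : 'I_N, g (i : nat, j : nat) =
       \sum_(k < N) \sum_(l < N) Q i j k l * entry A k l) ->
    \sum_(l <- labs) g l = pair_sum c (fun i j k l => (j < n) && Q i j k l).
  move=> h; rewrite sum_labs_ord; apply: eq_bigr => i _; apply: eq_bigr => j _.
  rewrite h big_distrr /=; apply: eq_bigr => k _; rewrite big_distrr.
  apply: eq_bigr => l _; rewrite -mulnb /c /=; clear; ring.
have F1 : \sum_(l <- labs) corner l.1.+1 N = pair_sum c (fun i j k l => (j < n) && (k <= i)).
  apply: F => i j /=; rewrite corner_ord //; apply: eq_bigr => k _.
  by apply: eq_bigr => l _; rewrite ltnS ltn_ord andbT.
have F2 : \sum_(l <- labs) corner l.1.+1 l.2.+1 =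
    pair_sum c (fun i j k l => (j < n) && ((k <= i) && (l <= j))).
  by apply: F => i j /=; rewrite corner_ord.
have F3 : \sum_(l <- labs) count (R l) labs =
    pair_sum c (fun i j k l => (j < n) && ((l < n) && (n.*2 <= i + k))).
  by apply: F => i j /=; rewrite count_labs_ord.
have F12 : pair_sum c (fun i j k l => (j < n) && (k <= i)) =
    pair_sum c (fun i j k l => (j < n) && ((k <= i) && (l <= j))) +
    pair_sum c (fun i j k l => [&& j < n, k <= i & j < l]).
  rewrite -pair_sumD; apply: pair_sum_ext => i j k l *; clear; lia.
have G := count_pair_sum c_sym.
have H : 2 * dXi A + \sum_(i < N) \sum_(j < N) ((n <= i) && (j < n)) * c i j
    = pair_sum c P_all := dXi_pair_sum A.
have cnt : count (fun l : label => n <= l.1) labs =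
    \sum_(i < N) \sum_(j < N) ((n <= i) && (j < n)) * c i j.
  rewrite count_labs_ord; apply: eq_bigr => i _; apply: eq_bigr => j _.
  by rewrite andbC.
rewrite Rdiag F3 in E3; rewrite F1 F12 in E1; rewrite E2 F2.
rewrite cnt in E1 E3; move: E1 E3 G H.
move: (pair_sum c (fun i j k l => _ && (_ && (l <= j)))) => p1.
move: (pair_sum c P_all) => p2.
move: (pair_sum c (fun i j k l => [&& j < n, k <= i & j < l])) => p3.
move: (pair_sum c _) (suffix_sum _ _) (suffix_sum _ _) (dXi A) (\sum_(i < N) _).
by move=> p4 s1 s2 x y; clear; lia.
Qed.

End FrameExponents.

(** * Partial sums of a centrally symmetric matrix *)

Section Corner.
Variables (n d : nat) (A : Xi n d).
Local Notation N := (odim n).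
Local Notation corner := (corner A).
Local Notation c := (nentry A).

Definition row_sum (i b : nat) := \sum_(0 <= j < b) c i j.

Lemma cornerS a b : corner a.+1 b = corner a b + row_sum a b.
Proof. by rewrite /corner big_nat_recr. Qed.

Lemma row_sumS i b : row_sum i b.+1 = row_sum i b + c i b.
Proof. by rewrite /row_sum big_nat_recr. Qed.

Lemma corner0 b : corner 0 b = 0.
Proof. by rewrite /corner big_geq. Qed.

Lemma corner_0r a : corner a 0 = 0.
Proof. by rewrite /corner big1 // => i _; rewrite big_geq. Qed.

Lemma entry_rev (i j : 'I_N) : entry A (rev_ord i) (rev_ord j) = entry A i j.
Proof.
have /andP[_ /forallP/(_ i)/forallP/(_ j)/eqP h] := valP A.
by rewrite /entry h.
Qed.

Lemma sum_rev (P : nat -> nat -> nat) :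
  \sum_(i < N) \sum_(j < N) P i j * entry A i j =
  \sum_(i < N) \sum_(j < N) P (n.*2 - i) (n.*2 - j) * entry A i j.
Proof.
rewrite (reindex_inj rev_ord_inj); apply: eq_bigr => i _.
rewrite (reindex_inj rev_ord_inj); apply: eq_bigr => j _.
by rewrite entry_rev /= !subSS.
Qed.

(** Central symmetry turns the block of rows below a and columns from N - b on into the block of
    rows from N - a on and columns below b. *)
Lemma corner_rev a b : a <= N -> b <= N ->
  corner a (N - b) + corner N b = corner a N + corner (N - a) b.
Proof.
move=> aN bN; rewrite !corner_ord ?leq_subr //.
rewrite [X in _ + X = _](sum_rev (fun i j => (i < N) && (j < b))).
rewrite [X in _ = _ + X](sum_rev (fun i j => (i < N - a) && (j < b))).
rewrite -!big_split; apply: eq_bigr => i _; rewrite -!big_split; apply: eq_bigr => j _.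
rewrite /= -!mulnDl; congr (_ * _); have := ltn_ord i; have := ltn_ord j.
by move: (nat_of_ord i) (nat_of_ord j) aN bN => i' j'; clear; lia.
Qed.

Lemma corner_total : corner N N = odim d.
Proof.
rewrite corner_ord //; have /andP[/eqP sM _] := valP A; rewrite -[RHS]sM.
apply: eq_bigr => i _; apply: eq_bigr => j _.
by rewrite !ltn_ord mul1n.
Qed.

Lemma row_sum_ord (i : 'I_N) b : b <= N -> row_sum i b = \sum_(j < N) (j < b) * entry A i j.
Proof.
move=> bN; rewrite /row_sum (big_widen_ord _ bN); apply: eq_bigr => j _.
by rewrite nentry_ord.
Qed.

(** The first n entries of the dual row are the last n entries of row i in reverse order, so only
    the middle column is left over. *)
Lemma half_rows_ord (i : 'I_N) : row_sum i n + row_sum (rev_ord i) n <= row_sum i N.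
Proof.
have nN : n <= N by clear; lia.
rewrite !row_sum_ord // [X in _ + X](reindex_inj rev_ord_inj) -big_split.
apply: leq_sum => j _; rewrite /= entry_rev -mulnDl leq_mul2r.
by apply/orP; right; have := ltn_ord j; move: (nat_of_ord j) => j'; clear; lia.
Qed.

Lemma half_rows i : i < N -> row_sum i n + row_sum (n.*2 - i) n <= row_sum i N.
Proof. by move=> iN; have := half_rows_ord (Ordinal iN); rewrite /= subSS. Qed.

Local Notation labs := (labs c N n).
Local Notation label := (nat * nat)%type.

Lemma count_row i : i < N -> count (fun l : label => l.1 == i) labs = row_sum i n.
Proof.
move=> iN; rewrite count_labs big_mkord (bigD1 (Ordinal iN)) //=.
rewrite [X in _ + X]big1 ?addn0 => [|k ki]; first by rewrite /row_sum; apply: eq_bigl => j; rewrite eqxx.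
by rewrite big_pred0 // => j; apply: negbTE.
Qed.

(** The current label being counted as well, the earlier vectors of row i and of its dual row
    together fall short of the sum of row i. For i = n the two rows coincide, and the estimate takes
    another form. *)
Lemma label_ok_rows l ls : label_ok c N n l ls -> l.1 <> n ->
  count (fun l' : label => N - l.1.+1 <= l'.1 < N - l.1) ls
    + count (fun l' : label => l.1 <= l'.1) ls + corner l.1 N < corner l.1.+1 N.
Proof.
case=> lN ln srt cnt l_n; rewrite cornerS addnC ltn_add2l.
apply: leq_trans (half_rows lN); rewrite -count_row // -[row_sum (_ - _) _]count_row; last first.
  by move: lN; clear; lia.
have h1 := cnt (fun l' => l'.1 == l.1); have h2 := cnt (fun l' => l'.1 == n.*2 - l.1).
rewrite /= eqxx in h1; rewrite /= in h2.
have -> : count (fun l' : label => N - l.1.+1 <= l'.1 < N - l.1) ls =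
    count (fun l' : label => l'.1 == n.*2 - l.1) ls.
  by apply: eq_count => l' /=; move: lN; clear; lia.
have -> : count (fun l' : label => l.1 <= l'.1) ls = count (fun l' : label => l'.1 == l.1) ls.
  by apply: eq_in_count => l' /srt; rewrite /lex_le /=; clear; lia.
by move: h1 h2; clear; lia.
Qed.

(** D is odd, hence so is the sum of row n, and twice the left half of that row is strictly smaller.
    The current label, lying in that half, accounts for the summand 2. *)
Lemma label_ok_mid l ls : label_ok c N n l ls -> l.1 = n ->
  odim d = corner n N + corner n.+1 N ->
  (count (fun l' : label => l.1 <= l'.1) ls).*2.+2 + corner n N < corner n.+1 N.
Proof.
case=> lN ln srt cnt l_n E; move: E; rewrite cornerS addnC => E.
have nN : n < N by move: lN; rewrite l_n.
have nn : n.*2 - n = n by rewrite -addnn addnK.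
have := half_rows nN; rewrite nn.
have h1 := cnt (fun l' => l'.1 == l.1); rewrite /= eqxx l_n count_row // in h1.
have -> : count (fun l' : label => l.1 <= l'.1) ls = count (fun l' : label => l'.1 == n) ls.
  by apply: eq_in_count => l' /srt; rewrite /lex_le l_n /=; clear; lia.
by move: h1 E; clear; lia.
Qed.

Lemma label_ok_trunc l ls : label_ok c N n l ls ->
  count (fun l' : label => N - l.1.+1 <= l'.1) ls + (n <= l.1) <= corner l.1.+1 N.
Proof.
case=> lN ln srt cnt; case: (leqP n l.1) => nl; last first.
  rewrite addn0 (@eq_in_count _ _ pred0) ?count_pred0 // => l' /srt.
  by move: nl; rewrite /lex_le /=; clear; lia.
have h := cnt (fun l' => N - l.1.+1 <= l'.1 <= l.1).
have E : count (fun l' : label => N - l.1.+1 <= l'.1) ls =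
    count (fun l' : label => N - l.1.+1 <= l'.1 <= l.1) ls.
  by apply: eq_in_count => l' /srt; rewrite /lex_le /=; clear; lia.
have hl : N - l.1.+1 <= l.1 <= l.1 by move: nl; clear; lia.
rewrite /= hl in h; rewrite E addnC; apply: leq_trans h _.
rewrite count_labs_ord corner_ord //; apply: leq_sum => i _; apply: leq_sum => j _ /=.
by rewrite leq_mul2r; apply/orP; right; have := ltn_ord j; move: (nat_of_ord j) => j'; clear; lia.
Qed.

End Corner.

Local Open Scope ring_scope.

(** * Orthogonals and isotropic vectors *)

Lemma rank_adds_row (F : fieldType) (D m : nat) (X : 'M[F]_(m, D)) (v : 'rV[F]_D) :
  ~~ (v <= X)%MS -> \rank (X + v)%MS = (\rank X).+1.
Proof.
move=> vX; have v0 : v != 0 by apply: contraNneq vX => ->; exact: sub0mx.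
have := mxrank_sum_cap X v; rewrite rank_rV v0.
have -> : \rank (X :&: v)%MS = 0%N.
  apply/eqP; rewrite mxrank_eq0; apply: contraNT vX => cap0.
  have rv : (\rank v <= \rank (X :&: v)%MS)%N by rewrite rank_rV v0 /= lt0n mxrank_eq0.
  have := geq_leqif (mxrank_leqif_sup (capmxSr X v)); rewrite rv => /esym vc.
  by apply: submx_trans vc _; exact: capmxSl.
lia.
Qed.

Section Orthogonal.
Variables (F : fieldType) (D : nat) (B : 'M[F]_D).
Hypotheses (B_sym : B^T = B) (B_unit : B \in unitmx).

Definition perp m (U : 'M[F]_(m, D)) : 'M[F]_D := kermx (B *m U^T).

Lemma sub_perp m p (X : 'M_(p, D)) (U : 'M_(m, D)) :
  (X <= perp U)%MS = (X *m B *m U^T == 0).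
Proof. by rewrite -mulmxA; apply/sub_kermxP/eqP. Qed.

Lemma sub_perpC m p (X : 'M_(p, D)) (U : 'M_(m, D)) :
  (X <= perp U)%MS = (U <= perp X)%MS.
Proof.
rewrite !sub_perp -(inj_eq trmx_inj) trmx0 !trmx_mul trmxK B_sym.
by rewrite mulmxA.
Qed.

Lemma perpS m p (X : 'M_(p, D)) (U : 'M_(m, D)) :
  (X <= U)%MS -> (perp U <= perp X)%MS.
Proof. by move=> XU; rewrite sub_perpC (submx_trans XU) // -sub_perpC. Qed.

Lemma rank_perp m (U : 'M_(m, D)) : \rank (perp U) = (D - \rank U)%N.
Proof.
by rewrite mxrank_ker eqmxMfull ?row_full_unit // mxrank_tr.
Qed.

Lemma sub_perp_adds p m1 m2 (X : 'M_(p, D)) (U : 'M_(m1, D)) (V : 'M_(m2, D)) :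
  (X <= perp (U + V)%MS)%MS = (X <= perp U)%MS && (X <= perp V)%MS.
Proof. by rewrite sub_perpC addsmx_sub !(sub_perpC X). Qed.

Lemma perp_adds m1 m2 (U : 'M_(m1, D)) (V : 'M_(m2, D)) :
  (perp (U + V)%MS :=: perp U :&: perp V)%MS.
Proof.
apply/eqmxP/andP; split; last by rewrite sub_perp_adds capmxSl capmxSr.
by rewrite sub_capmx !perpS ?addsmxSl ?addsmxSr.
Qed.

Lemma perpK m (U : 'M_(m, D)) : (perp (perp U) :=: U)%MS.
Proof.
apply/eqmxP; rewrite andbC; have UP : (U <= perp (perp U))%MS by rewrite sub_perpC.
rewrite UP -(geq_leqif (mxrank_leqif_sup UP)) !rank_perp.
by have := rank_leq_col U; lia.
Qed.

Lemma eqmx_perp m1 m2 (U : 'M_(m1, D)) (V : 'M_(m2, D)) :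
  (U :=: V)%MS -> (perp U :=: perp V)%MS.
Proof. by move=> UV; apply/eqmxP; rewrite !perpS ?UV. Qed.

Definition bil (x y : 'rV[F]_D) : F := (x *m B *m y^T) 0 0.

Lemma bil_perp p (x : 'rV_D) (U : 'M_(p, D)) :
  (x <= perp U)%MS -> forall y : 'rV_D, (y <= U)%MS -> bil x y = 0.
Proof.
rewrite sub_perp => /eqP xU y /submxP[z ->].
by rewrite /bil trmx_mul mulmxA xU mul0mx mxE.
Qed.

Lemma bil_perpP p (x : 'rV_D) (U : 'M_(p, D)) :
  (forall y : 'rV_D, (y <= U)%MS -> bil x y = 0) -> (x <= perp U)%MS.
Proof.
move=> h; rewrite sub_perp; apply/eqP/rowP => j; rewrite [RHS]mxE.
have := h (row j U) (row_sub j U); rewrite /bil => <-.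
by rewrite tr_row [RHS]mxE [LHS]mxE; apply: eq_bigr => i _; rewrite !mxE.
Qed.

Lemma bilC x y : bil x y = bil y x.
Proof.
have {1}-> : bil x y = (x *m B *m y^T)^T 0 0 by rewrite mxE.
by rewrite !trmx_mul trmxK B_sym mulmxA.
Qed.

Lemma bilDl x y z : bil (x + y) z = bil x z + bil y z.
Proof. by rewrite /bil !mulmxDl mxE. Qed.
Lemma bilDr x y z : bil z (x + y) = bil z x + bil z y.
Proof. by rewrite bilC bilDl !(bilC z). Qed.
Lemma bilZl a x z : bil (a *: x) z = a * bil x z.
Proof. by rewrite /bil -!scalemxAl mxE. Qed.
Lemma bilZr a x z : bil z (a *: x) = a * bil z x.
Proof. by rewrite bilC bilZl bilC. Qed.
Lemma bil_sqrD x y : bil (x + y) (x + y) = bil x x + (bil x y *+ 2) + bil y y.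
Proof. by rewrite bilDl !bilDr (bilC y x) mulr2n; ring. Qed.

End Orthogonal.

(** * The proportion of isotropic vectors in a subspace or a difference of subspaces *)

Section IsotropicCount.
Variables (F : finFieldType) (D : nat) (B : 'M[F]_D).
Hypotheses (two_neq0 : (2%:R : F) != 0) (B_sym : B^T = B).
Local Notation bil := (bil B).
Local Notation q := #|F|.
Implicit Types (v w : 'rV[F]_D) (Y : {set 'rV[F]_D}).

Lemma card_rowspace m (A : 'M[F]_(m, D)) : #|[set v : 'rV[F]_D | (v <= A)%MS]| = (q ^ \rank A)%N.
Proof. exact: mxabelem.card_rowg. Qed.

Lemma card_sub_diff (S Z : 'M[F]_D) :
  #|[set v : 'rV[F]_D | (v <= S)%MS && ~~ (v <= Z)%MS]|
    = (q ^ \rank S - q ^ \rank (S :&: Z)%MS)%N.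
Proof.
rewrite -!card_rowspace.
have -> : [set v : 'rV[F]_D | (v <= S :&: Z)%MS] =
    [set v : 'rV[F]_D | (v <= S)%MS] :&: [set v : 'rV[F]_D | (v <= Z)%MS].
  by apply/setP => v; rewrite !inE sub_capmx.
rewrite -cardsD; apply: eq_card => v; rewrite !inE.
by case: (v <= S)%MS; rewrite ?andbT ?andbF.
Qed.

Definition iso Y := [set v in Y | bil v v == 0].

(** All fibres of a nonconstant affine function on W are translates of one another. Oddness of the
    characteristic keeps 2 [bil v w] from vanishing identically. *)
Lemma card_affine (W : 'M[F]_D) v (c : F) :
  (exists2 w, (w <= W)%MS & bil v w != 0) ->
  (q * #|[set w : 'rV[F]_D | (w <= W)%MS && (c + bil v w *+ 2 == 0)%R]|
    = #|[set w : 'rV[F]_D | (w <= W)%MS]|)%N.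
Proof.
case=> w0 w0W vw0.
pose fib a := [set w : 'rV[F]_D | (w <= W)%MS && (c + bil v w *+ 2 == a)].
have card_fib a : #|fib a| = #|fib 0|.
  pose u := (a / (bil v w0 *+ 2)) *: w0.
  have uW : (u <= W)%MS by rewrite scalemx_sub.
  have vu : bil v u *+ 2 = a.
    rewrite bilZr // -mulrnAr -mulrA mulVf ?mulr1 //.
    by rewrite -mulr_natr mulf_neq0.
  have -> : fib a = [set w + u | w in fib 0].
    apply/setP => w; apply/idP/imsetP => [|[w' + ->]]; rewrite !inE => /andP[wW /eqP E].
      exists (w - u); last by rewrite subrK.
      rewrite inE addmx_sub ?eqmx_opp //=.
      have := E; rewrite -{1}(subrK u w) bilDr // mulrnDl vu addrA => E'.
      by apply/eqP/(addIr a); rewrite E' add0r.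
    by rewrite addmx_sub //= bilDr // mulrnDl vu addrA E add0r.
  by rewrite card_imset //; apply: addIr.
rewrite -[RHS]sum1_card [RHS](partition_big (fun w => c + bil v w *+ 2) xpredT) //=.
rewrite [RHS](eq_bigr (fun=> #|fib 0|)).
  by rewrite sum_nat_const.
move=> a _; rewrite sum1_card -(card_fib a).
by apply: eq_card => w; rewrite [RHS]inE [LHS]unfold_in inE.
Qed.

(* double counting over the translates of Y by an isotropic subspace W *)
Lemma card_iso_translate Y (W : 'M[F]_D) :
  (forall v w, (w <= W)%MS -> (v + w \in Y) = (v \in Y)) ->
  (forall w, (w <= W)%MS -> bil w w = 0) ->
  (forall v, v \in Y -> exists2 w, (w <= W)%MS & bil v w != 0) ->
  (q * #|iso Y| = #|Y|)%N.
Proof.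
move=> YW Wiso Wv; pose WS := [set w : 'rV[F]_D | (w <= W)%MS].
have W0 : (0 < #|WS|)%N by apply/card_gt0P; exists 0; rewrite inE sub0mx.
apply/eqP; rewrite -(eqn_pmul2r W0) -mulnA; apply/eqP.
have e1 : (\sum_(v in Y) #|[set w in WS | (v + w)%R \in iso Y]| = #|iso Y| * #|WS|)%N.
  transitivity (\sum_(w in WS) #|[set v in Y | (v + w)%R \in iso Y]|)%N.
    rewrite (eq_bigr (fun v => \sum_(w in WS | (v + w)%R \in iso Y) 1%N)); last first.
      by move=> v _; rewrite sum1dep_card; apply: eq_card => w; rewrite !inE.
    rewrite (exchange_big_dep (mem WS)) /= => [|v w _ /andP[]] //.
    apply: eq_bigr => w wW; rewrite sum1dep_card; apply: eq_card => v.
    by rewrite !inE; move: wW; rewrite inE => ->.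
  rewrite (eq_bigr (fun=> #|iso Y|)); first by rewrite sum_nat_const mulnC.
  move=> w; rewrite inE => wW.
  rewrite -(card_imset _ (addIr w)); apply: eq_card => v.
  apply/imsetP/idP => [[v' + ->]|vY]; first by rewrite inE => /andP[].
  exists (v - w); last by rewrite subrK.
  rewrite inE subrK vY andbT -(YW _ w) // subrK.
  by move: vY; rewrite inE => /andP[].
rewrite -e1 big_distrr /= -sum_nat_const; apply: eq_bigr => v vY.
rewrite -(card_affine (bil v v) (Wv v vY)); congr (_ * _)%N.
apply: eq_card => w; rewrite !inE; case wW : (w <= W)%MS => //=.
by rewrite YW // vY /= bil_sqrD // (Wiso w) // addr0.
Qed.

(** On each line v + F u inside H the form is a polynomial of degree two in the parameter, with
    leading coefficient [bil u u], and so has at most two zeros. *)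
Lemma card_iso_le (H : 'M[F]_D) u : (u <= H)%MS -> bil u u != 0 ->
  (q * #|iso [set v : 'rV[F]_D | (v <= H)%MS]| <= 2 * q ^ \rank H)%N.
Proof.
move=> uH uu; rewrite -card_rowspace; set HS := [set v : 'rV[F]_D | (v <= H)%MS].
have e1 : (\sum_(v in HS) #|[set c : F | (v + c *: u)%R \in iso HS]| = q * #|iso HS|)%N.
  transitivity (\sum_(c : F) #|[set v in HS | (v + c *: u)%R \in iso HS]|)%N.
    rewrite (eq_bigr (fun v => \sum_(c : F | (v + c *: u)%R \in iso HS) 1%N)); last first.
      by move=> v _; rewrite sum1dep_card.
    rewrite (exchange_big_dep xpredT) //=; apply: eq_bigr => c _.
    by rewrite sum1dep_card; apply: eq_card => v; rewrite !inE.
  rewrite (eq_bigr (fun=> #|iso HS|)); first by rewrite sum_nat_const.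
  move=> c _; rewrite -(card_imset _ (addIr (c *: u))); apply: eq_card => v.
  apply/imsetP/idP => [[v' + ->]|vY]; first by rewrite inE => /andP[].
  exists (v - c *: u); last by rewrite subrK.
  rewrite inE subrK vY andbT inE addmx_sub ?eqmx_opp ?scalemx_sub //.
  by move: vY; rewrite !inE => /andP[].
rewrite -e1 mulnC -sum_nat_const; apply: leq_sum => v vH.
pose p : {poly F} := Poly [:: bil v v; bil v u *+ 2; bil u u].
have p0 : p != 0.
  apply: contraNneq uu => /(congr1 (fun r : {poly F} => r`_2)).
  by rewrite coef_Poly coef0 /= => ->.
have sp : (size p <= 3)%N by apply: leq_trans (size_Poly _) _.
rewrite -ltnS; apply: leq_trans sp; rewrite cardE; apply: max_poly_roots => //.
  apply/allP => c; rewrite mem_enum inE inE => /andP[_].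
  rewrite bil_sqrD // bilZr // bilZl // bilZr // => /eqP E.
  apply/rootP; rewrite -[RHS]E horner_Poly /= mul0r add0r.
  by ring.
exact: enum_uniq.
Qed.

End IsotropicCount.

(** * Isotropic sequences adapted to a flag *)

Lemma mid_bounds (t y h p z Q : nat) :
  (Q * y = Q * p - p -> Q * h <= 2 * p -> t <= y + h -> y <= t + z ->
   Q * z <= p -> 0 < Q -> (Q - 2) * p <= Q * t <= (Q + 2) * p)%N.
Proof. by move=> *; apply/andP; split; nia. Qed.

Section Frames.
Variables (F : finFieldType) (D n : nat) (B : 'M[F]_D).
Hypotheses (two_neq0 : (2%:R : F) != 0) (B_sym : B^T = B) (B_unit : B \in unitmx).
Local Notation bil := (bil B).
Local Notation perp := (perp B).
Local Notation q := #|F|.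
Local Notation N := (n.*2.+1).
Local Notation label := (nat * nat)%type.

Variable V : nat -> 'M[F]_D.
Hypothesis V_0 : V 0%N = 0.
Hypothesis V_mono : forall a b, (a <= b)%N -> (b <= N)%N -> (V a <= V b)%MS.
Hypothesis V_perp : forall a, (a <= N)%N -> (V a :=: perp (V (N - a)%N))%MS.

Local Notation rk a := (\rank (V a)).

Definition Sp (Q : pred label) (ls : seq label) (vs : seq 'rV[F]_D) : 'M[F]_D :=
  (\sum_(p <- zip ls vs | Q p.1) <<p.2>>)%MS.

Lemma Sp_cons Q l ls v vs :
  (Sp Q (l :: ls) (v :: vs) :=: if Q l then v + Sp Q ls vs else Sp Q ls vs)%MS.
Proof.
apply/eqmxP; rewrite /Sp /= big_cons /=; case: ifP => _; rewrite ?submx_refl //.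
by rewrite !addsmx_sub !addsmxSr !genmxE (submx_trans _ (addsmxSl _ _)) ?genmxE //
           (submx_trans _ (addsmxSl _ _)) ?genmxE.
Qed.

Lemma Sp_nil Q vs : Sp Q [::] vs = 0.
Proof. by rewrite /Sp; case: vs => [|? ?]; rewrite /= big_nil. Qed.

Lemma Sp_sub (Q Q' : pred label) ls vs : (forall l, Q l -> Q' l) ->
  (Sp Q ls vs <= Sp Q' ls vs)%MS.
Proof.
move=> QQ'; elim: ls vs => [|l ls IH] vs; first by rewrite Sp_nil sub0mx.
case: vs => [|v vs]; first by rewrite /Sp /= big_nil sub0mx.
rewrite !Sp_cons; case: ifP => [/QQ' ->|_].
  by rewrite addsmxS.
by case: ifP => // _; rewrite (submx_trans (IH vs)) // addsmxSr.
Qed.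

Lemma Sp_le (Q : pred label) ls vs (U : 'M[F]_D) :
  (forall p, p \in zip ls vs -> Q p.1 -> (p.2 <= U)%MS) -> (Sp Q ls vs <= U)%MS.
Proof.
move=> h; rewrite /Sp big_seq_cond; elim/big_ind: _ => [|X Y XU YU|p /andP[pz Qp]].
- exact: sub0mx.
- by rewrite addsmx_sub XU.
- by rewrite genmxE h.
Qed.

Lemma Sp_mem (Q : pred label) ls vs p : p \in zip ls vs -> Q p.1 -> (p.2 <= Sp Q ls vs)%MS.
Proof.
move=> pz Qp; rewrite /Sp (big_rem p pz) Qp.
by apply: submx_trans (addsmxSl _ _); rewrite genmxE.
Qed.

Implicit Type E : label -> 'M[F]_D -> 'rV[F]_D -> bool.

(** The middle clause makes the vectors of row i independent modulo V_i and the earlier vectors;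
    this adapts their span to V. [E] is the condition in which the two kinds of sequences differ:
    isotropy, or membership in a given flag. *)
Definition gstep E (l : label) (ls : seq label) (vs : seq 'rV[F]_D) (v : 'rV[F]_D) :=
  [&& (v <= V l.1.+1)%MS, ~~ (v <= V l.1 + Sp predT ls vs)%MS & E l (Sp predT ls vs) v].

Definition row_sorted (l : label) (ls : seq label) : Prop :=
  (l.1 < N)%N /\ forall l', l' \in ls -> (l'.1 <= l.1)%N.

Lemma frame_mem E ls vs p : frame (gstep E) ls vs -> p \in zip ls vs ->
  p.1 \in ls /\ (p.2 <= V p.1.1.+1)%MS.
Proof.
elim: ls vs => [|l ls IH] [|v vs] //= /andP[fr /andP[vV _]].
rewrite !inE => /orP[/eqP ->|/(IH _ fr)[-> ->]] /=; first by rewrite eqxx.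
by rewrite orbT.
Qed.

Lemma frame_memE E ls vs p : frame (gstep E) ls vs -> p \in zip ls vs ->
  exists X, E p.1 X p.2.
Proof.
elim: ls vs => [|l ls IH] [|v vs] //= /andP[fr /and3P[_ _ Ev]].
rewrite inE => /orP[/eqP -> /=|/(IH _ fr)//].
by exists (Sp predT ls vs).
Qed.

(** A vector of a row at least a enlarges V_a + Sp by one dimension, since it avoids an even larger
    sum; a vector of a lower row already lies in V_a. *)
Lemma rank_V_Sp E ls vs Q a : frame (gstep E) ls vs -> all_suffix row_sorted ls ->
  (a <= N)%N ->
  \rank (V a + Sp Q ls vs)%MS = (rk a + count (fun l => Q l && (a <= l.1)) ls)%N.
Proof.
move=> + + aN; elim: ls vs => [|l ls IH] [|v vs] //=.
  by rewrite Sp_nil addsmx0 addn0.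
move=> /andP[fr /and3P[vV vZ _]] [[lN lS] srt]; rewrite (adds_eqmx (eqmx_refl _) (Sp_cons _ _ _ _ _)).
have IHv := IH vs fr srt.
case Ql: (Q l) => /=; last by rewrite add0n.
case: (leqP a l.1) => al /=.
  have vX : ~~ (v <= V a + Sp Q ls vs)%MS.
    apply: contra vZ => h; apply: submx_trans h _.
    by rewrite addsmxS ?V_mono ?Sp_sub // ltnW.
  rewrite addnCA -IHv add1n -(rank_adds_row vX).
  by rewrite -addsmxA [(Sp _ _ _ + v)%MS]addsmxC.
rewrite add0n -IHv addsmxA.
have vVa : (v <= V a)%MS by rewrite (submx_trans vV) // V_mono.
by have := addsmx_idPl vVa => /(adds_eqmx)/(_ (eqmx_refl (Sp Q ls vs))) ->.
Qed.

Lemma rank_Sp E ls vs Q : frame (gstep E) ls vs -> all_suffix row_sorted ls ->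
  \rank (Sp Q ls vs) = count Q ls.
Proof.
move=> fr srt; have := rank_V_Sp Q fr srt (leq0n _).
rewrite V_0 adds0mx mxrank0 add0n => ->; apply: eq_count => l.
by rewrite leq0n andbT.
Qed.

Lemma count_split (Q : pred label) a ls :
  (count Q ls = count (fun l => Q l && (a <= l.1)) ls + count (fun l => Q l && (l.1 < a)) ls)%N.
Proof.
elim: ls => //= l ls ->; rewrite addnACA; congr (_ + _)%N.
by case: (Q l); case: leqP.
Qed.

Lemma rank_cap_Sp E ls vs Q a : frame (gstep E) ls vs -> all_suffix row_sorted ls ->
  (a <= N)%N ->
  \rank (V a :&: Sp Q ls vs)%MS = count (fun l => Q l && (l.1 < a)%N) ls.
Proof.
move=> fr srt aN; have := mxrank_sum_cap (V a) (Sp Q ls vs).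
rewrite (rank_V_Sp Q fr) // (rank_Sp Q fr) // -addnA => /addnI.
by rewrite (count_split Q a) => /addnI.
Qed.

(** V_a is the orthogonal of V_(N-a), so the intersection is the orthogonal of V_(N-a) + Sp, whose
    dimension is given by [rank_V_Sp]. *)
Lemma rank_cap_perp_Sp E ls vs a : frame (gstep E) ls vs -> all_suffix row_sorted ls ->
  (a <= N)%N ->
  (\rank (V a :&: perp (Sp predT ls vs))%MS
     = rk a - count (fun l => N - a <= l.1) ls)%N.
Proof.
move=> fr srt aN.
rewrite (cap_eqmx (V_perp aN) (eqmx_refl _)) -(perp_adds B_sym).
rewrite rank_perp // (rank_V_Sp predT fr) ?leq_subr //.
rewrite (eq_count (a2 := fun l : label => N - a <= l.1)%N) // subnDA.
by rewrite (V_perp aN) rank_perp.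
Qed.

Definition E_iso (l : label) (X : 'M[F]_D) (v : 'rV[F]_D) : bool :=
  (v <= perp X)%MS && (bil v v == 0).

Lemma Sp_isotropic ls vs : frame (gstep E_iso) ls vs ->
  (Sp predT ls vs <= perp (Sp predT ls vs))%MS.
Proof.
elim: ls vs => [|l ls IH] [|v vs] //=; first by rewrite Sp_nil sub0mx.
move=> /andP[/IH SS /and4P[_ _ vS /eqP vv]].
rewrite Sp_cons (eqmx_perp B_sym (Sp_cons predT l ls v vs)) /=.
rewrite sub_perp_adds // !addsmx_sub SS vS (sub_perpC B_sym _ v) vS !andbT.
by apply: bil_perpP => y /sub_rVP[a ->]; rewrite bilZr // vv mulr0.
Qed.

Lemma Sp_row_le E (Q : pred label) ls vs i : frame (gstep E) ls vs -> (i < N)%N ->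
  (forall l, l \in ls -> Q l -> (l.1 <= i)%N) -> (Sp Q ls vs <= V i.+1)%MS.
Proof.
move=> fr iN h; apply: Sp_le => p pz Qp; have [pl pV] := frame_mem fr pz.
by rewrite (submx_trans pV) // V_mono // ltnS h.
Qed.

Lemma count_perp_le E ls vs a : frame (gstep E) ls vs -> all_suffix row_sorted ls ->
  (a <= N)%N -> (count (fun l => (N - a <= l.1)%N) ls <= rk a)%N.
Proof.
move=> fr srt aN; have := rank_leq_col (V (N - a)%N + Sp predT ls vs)%MS.
rewrite (rank_V_Sp predT fr) ?leq_subr // (V_perp aN) rank_perp //.
have := rank_leq_col (V (N - a)%N); rewrite (eq_count (a2 := fun l : label => N - a <= l.1)%N) //.
lia.
Qed.

(** * Estimating one step of an isotropic sequence *)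

Section Step.
Variables (l : label) (ls : seq label) (vs : seq 'rV[F]_D).
Hypotheses (fr : frame (gstep E_iso) ls vs) (srt : all_suffix row_sorted ls).
Hypothesis rs : row_sorted l ls.
Let i := l.1.
Let X := Sp predT ls vs.
Let S := (V i.+1 :&: perp X)%MS.
Let Z := (V i + X)%MS.
Let iN : (i < N)%N := rs.1.

Lemma step_XS : (X <= S)%MS.
Proof.
rewrite sub_capmx Sp_isotropic // andbT; apply: Sp_row_le fr iN _ => l' l'ls _.
exact: rs.2.
Qed.

Lemma step_rank_S : (\rank S + count (fun l' => (N - i.+1 <= l'.1)%N) ls = rk i.+1)%N.
Proof. by rewrite (rank_cap_perp_Sp fr) // subnK // (count_perp_le fr). Qed.

(** Since X lies in S, the modular law splits the intersection of S and Z as X plus the intersection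
    of V_i and perp X. Since X is isotropic, these two summands meet in the intersection of V_i and
    X. *)
Lemma step_rank_SZ : (\rank (S :&: Z)%MS + count (fun l' => (N - i <= l'.1)%N) ls
  = rk i + count (fun l' => (i <= l'.1)%N) ls)%N.
Proof.
have ViS : (V i :&: perp X <= S)%MS.
  by rewrite capmxS // V_mono.
have SZ : (S :&: Z :=: X + (V i :&: perp X))%MS.
  apply/eqmxP/andP; split.
    have h := matrix_modl (V i) step_XS.
    by rewrite capmxC [Z]addsmxC -h addsmxS // capmxS // capmxSr.
  rewrite addsmx_sub sub_capmx step_XS addsmxSr /= sub_capmx ViS /=.
  by rewrite (submx_trans (capmxSl _ _)) // addsmxSl.
have XV : (X :&: (V i :&: perp X) :=: V i :&: X)%MS.
  apply/eqmxP/andP; split.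
    by rewrite sub_capmx capmxSl andbT (submx_trans (capmxSr _ _)) // capmxSl.
  rewrite !sub_capmx capmxSr capmxSl /= (submx_trans (capmxSr _ _)) //.
  exact: Sp_isotropic fr.
have := mxrank_sum_cap X (V i :&: perp X)%MS; rewrite -SZ XV.
have iN' := ltnW iN.
rewrite (rank_cap_Sp _ fr) // (rank_Sp _ fr) // (rank_cap_perp_Sp fr) //.
have := count_perp_le fr srt iN'; rewrite (count_split predT i) /=; lia.
Qed.

Lemma step_set :
  [set v | gstep E_iso l ls vs v] =
    iso B [set v : 'rV[F]_D | (v <= S)%MS && ~~ (v <= Z)%MS].
Proof.
apply/setP => v; rewrite !inE sub_capmx /gstep /E_iso -/X -/i -/Z.
by case: (v <= V i.+1)%MS; case: (v <= Z)%MS; case: (v <= perp X)%MS.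
Qed.

Lemma count_dual_row a b : (a <= b)%N ->
  count (fun l' : label => (a <= l'.1)%N) ls =
    (count (fun l' : label => (b <= l'.1)%N) ls
     + count (fun l' : label => (a <= l'.1 < b)%N) ls)%N.
Proof.
move=> ab; elim: ls => //= l' ls' ->; rewrite addnACA; congr (_ + _)%N.
by case: leqP => h; case: leqP => h' //=; lia.
Qed.

Let c_dual := count (fun l' : label => (N - i.+1 <= l'.1 < N - i)%N) ls.
Let c_row := count (fun l' : label => (i <= l'.1)%N) ls.

Lemma step_rank_diff : (\rank S + c_dual + c_row + rk i = \rank (S :&: Z)%MS + rk i.+1)%N.
Proof.
have := step_rank_S; have := step_rank_SZ.
have ab : (N - i.+1 <= N - i)%N by rewrite leq_sub2l.
rewrite (count_dual_row ab) -/c_dual -/c_row; lia.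
Qed.

Lemma leq_pow_bounds (Q s z : nat) : (z < s)%N -> (0 < Q)%N ->
  ((Q - 2) * Q ^ s <= Q * (Q ^ s - Q ^ z) <= (Q + 2) * Q ^ s)%N.
Proof.
move=> zs Q0; have h : (Q * Q ^ z <= Q ^ s)%N by rewrite -expnS leq_pexp2l.
by apply/andP; split; nia.
Qed.

(** For i < n the whole of V_(i+1) is isotropic, so the admissible vectors are exactly those of S
    outside Z. *)
Lemma step_small : (i < n)%N -> (c_dual + c_row + rk i < rk i.+1)%N ->
  ((q - 2) * q ^ \rank S <= q * #|[set v | gstep E_iso l ls vs v]|
    <= (q + 2) * q ^ \rank S)%N.
Proof.
move=> i_n cnt; have -> : [set v | gstep E_iso l ls vs v] =
    [set v : 'rV[F]_D | (v <= S)%MS && ~~ (v <= Z)%MS].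
  rewrite step_set; apply/setP => v; rewrite !inE andbC andb_idl // => /andP[vS _].
  have vV : (v <= V i.+1)%MS by rewrite (submx_trans vS) // capmxSl.
  apply/eqP/(bil_perp (U := V i.+1)) => //; apply: submx_trans vV _.
  apply: submx_trans (V_mono (b := (N - i.+1)%N) _ _) _; try lia.
  by rewrite (V_perp (leq_subr _ _)) subKn.
rewrite card_sub_diff; apply: leq_pow_bounds; last by apply/card_gt0P; exists 0.
have := step_rank_diff; lia.
Qed.

Lemma step_large : (n < i)%N -> (c_dual + c_row + rk i < rk i.+1)%N ->
  (0 < \rank S)%N /\
  ((q - 2) * q ^ (\rank S).-1 <= q * #|[set v | gstep E_iso l ls vs v]|
    <= (q + 2) * q ^ (\rank S).-1)%N.
Proof.
move=> n_i cnt; have diff := step_rank_diff.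
have q0 : (0 < q)%N by apply/card_gt0P; exists 0.
have s0 : (0 < \rank S)%N by lia.
split=> //; rewrite step_set.
(* perp Z is isotropic, contained in Z, and pairs nontrivially with every vector
   outside Z, so the isotropic vectors are a proportion 1/q of S minus Z *)
have VW : (perp Z <= V (N - i)%N)%MS.
  rewrite (V_perp (leq_subr _ _)) subKn 1?ltnW //.
  by rewrite (submx_trans (perpS _ (addsmxSl (V i) X))).
have WZ : (perp Z <= Z)%MS.
  apply: submx_trans VW (submx_trans _ (addsmxSl _ _)); apply: V_mono; lia.
have WS : (perp Z <= S)%MS.
  rewrite sub_capmx; apply/andP; split; last exact: perpS (addsmxSr _ _).
  apply: submx_trans VW _; apply: V_mono; lia.
rewrite (card_iso_translate two_neq0 B_sym (W := perp Z)).
- rewrite card_sub_diff; have sz : (\rank (S :&: Z)%MS < \rank S)%N by lia.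
  have h : (q ^ \rank (S :&: Z)%MS <= q ^ (\rank S).-1)%N by rewrite leq_pexp2l //; lia.
  have E : (q ^ \rank S = q * q ^ (\rank S).-1)%N by rewrite -expnS prednK.
  by rewrite E; apply/andP; split; nia.
- move=> v w wW; rewrite !inE; congr (_ && ~~ _); apply/idP/idP => h.
  + by rewrite -(addrK w v) addmx_sub // eqmx_opp (submx_trans wW).
  + by rewrite addmx_sub // (submx_trans wW).
  + by rewrite -(addrK w v) addmx_sub // eqmx_opp (submx_trans wW).
  + by rewrite addmx_sub // (submx_trans wW).
- by move=> w wW; apply: (bil_perp wW); apply: submx_trans wW WZ.
- move=> v; rewrite inE => /andP[_ vZ].
  have /existsP[w /andP[wW nz]] : [exists w : 'rV[F]_D, (w <= perp Z)%MS && (bil v w != 0)].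
    apply: contraNT vZ => /existsPn h.
    rewrite -(perpK B_sym B_unit Z); apply: bil_perpP => w wW.
    by have := h w; rewrite wW /= negbK => /eqP.
  by exists w.
Qed.

(** In the middle row S = perp Z, so translations by perp Z are of no use. They are replaced by
    translations along an isotropic vector e of S outside Z, found in [E0]. Off the hyperplane H of
    S orthogonal to e, the isotropic vectors are a proportion of exactly 1/q; those in H and those
    in Z amount to a relative error O(1/q). *)
Lemma step_mid (E0 : 'M[F]_D) : i = n -> (c_row.*2.+2 + rk i < rk i.+1)%N ->
  (V n <= E0)%MS -> (E0 <= V n.+1)%MS -> (E0 <= perp E0)%MS -> \rank E0 = D./2 ->
  (0 < \rank S)%N /\
  ((q - 2) * q ^ (\rank S).-1 <= q * #|[set v | gstep E_iso l ls vs v]|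
    <= (q + 2) * q ^ (\rank S).-1)%N.
Proof.
move=> i_n cnt VE EV EE rE; have diff := step_rank_diff.
have q1 : (1 < q)%N := card_finNzRing_gt1 F.
have NV : (perp (V n) :=: V n.+1)%MS.
  have h : (n.+1 <= N)%N by clear; lia.
  apply: eqmx_sym; apply: eqmx_trans (V_perp h) _.
  have -> : (N - n.+1 = n)%N by clear; lia.
  by [].
have SE : (S :=: perp Z)%MS.
  have -> : S = (V n.+1 :&: perp X)%MS by rewrite /S i_n.
  apply: eqmx_sym; apply: eqmx_trans (perp_adds B_sym _ _) _; apply: cap_eqmx => //.
  by rewrite i_n.
have Zn : Z = (V n + X)%MS by rewrite /Z i_n.
have XVn : (X <= V n.+1)%MS by rewrite -i_n; apply: submx_trans step_XS (capmxSl _ _).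
have cd : (c_dual <= c_row)%N.
  by apply: sub_count => l' /andP[h _]; rewrite /= (leq_trans _ h) // i_n; clear; lia.
have ZS : (Z <= S)%MS.
  rewrite {1}/Z addsmx_sub step_XS andbT i_n SE Zn sub_perp_adds // NV.
  rewrite V_mono // ?leqnSn //=; last by clear; lia.
  by rewrite sub_perpC // NV.
have rSZ : \rank (S :&: Z)%MS = \rank Z by rewrite (capmx_idPr ZS).
rewrite rSZ in diff.
have rX : \rank X = (count (fun l' : label => (l'.1 < n)%N) ls + c_row)%N.
  by rewrite (rank_Sp _ fr srt) (count_split predT i) /= addnC -i_n.
have VX : \rank (V n :&: X)%MS = count (fun l' : label => (l'.1 < n)%N) ls.
  by rewrite (rank_cap_Sp _ fr) //; clear; lia.
have rV1 : rk n.+1 = (D - rk n)%N by rewrite -NV rank_perp.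
(* If [E0 :&: perp X] were contained in Z, the modular law and a dimension count would give dim E0
   <= dim V_n + c_row. By [cnt] the right side is less than d. *)
have [e [eE eX eZ]] : exists e : 'rV[F]_D, [/\ (e <= E0)%MS, (e <= perp X)%MS & ~~ (e <= Z)%MS].
  have /row_subPn[k nk] : ~~ (E0 :&: perp X <= Z)%MS.
    apply/negP => GZ.
    have rG : (\rank E0 + \rank (E0 :&: X) <= \rank (E0 :&: perp X) + \rank X)%N.
      have GE : (E0 :&: perp X :=: perp (perp E0 + X)%MS)%MS.
        apply: eqmx_sym; apply: eqmx_trans (perp_adds B_sym (perp E0) X) _.
        exact: (cap_eqmx (perpK B_sym B_unit E0) (eqmx_refl (perp X))).
      rewrite GE rank_perp //; have := mxrank_sum_cap (perp E0) X.
      have := rank_leq_col (perp E0 + X)%MS; have := rank_leq_col E0.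
      have := mxrankS (capmxS EE (submx_refl X)); rewrite rank_perp //.
      move: (\rank E0) (\rank (E0 :&: X)%MS) (\rank (perp E0 :&: X)%MS) (\rank X)
        (\rank (perp E0 + X)%MS) => a b c d f; clear; lia.
    have GV : (E0 :&: perp X <= V n + (X :&: E0))%MS.
      rewrite (matrix_modl X VE) sub_capmx capmxSl andbT; move: GZ.
      by rewrite /Z i_n.
    have := mxrankS GV; have := mxrank_sum_cap (V n) (X :&: E0)%MS.
    have -> : (V n :&: (X :&: E0) :=: V n :&: X)%MS.
      apply/eqmxP/andP; split; first by rewrite capmxS // capmxSl.
      rewrite sub_capmx capmxSl sub_capmx capmxSr /=.
      by rewrite (submx_trans (capmxSl _ _)).
    rewrite VX (capmxC X E0); move: cnt rG; rewrite i_n rV1 rX rE.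
    move: (\rank (E0 :&: X)%MS) (\rank (E0 :&: perp X)%MS) (\rank (V n + _)%MS) => a b c.
    by move: c_row (rk n) (count _ _) => r v w; clear; lia.
  exists (row k (E0 :&: perp X)%MS); split=> //.
    by rewrite (submx_trans (row_sub _ _)) // capmxSl.
  by rewrite (submx_trans (row_sub _ _)) // capmxSr.
have ee : bil e e = 0.
  by apply: (bil_perp (U := E0)) => //; apply: submx_trans eE EE.
have eS : (e <= S)%MS.
  by rewrite sub_capmx eX andbT i_n (submx_trans eE).
pose H := (S :&: perp e)%MS.
have HE : (H :=: perp (Z + e)%MS)%MS.
  apply: eqmx_sym; apply: eqmx_trans (perp_adds B_sym Z e) _.
  exact: (cap_eqmx (eqmx_sym SE) (eqmx_refl (perp e))).
have rH : (\rank H).+1 = \rank S.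
  have zD : (\rank Z < D)%N by rewrite -(rank_adds_row eZ) rank_leq_col.
  by rewrite HE SE !rank_perp // (rank_adds_row eZ) subnSK.
(* The summand 2 in [cnt], together with c_dual <= c_row, leaves three dimensions between Z and
   S. *)
have s3 : (\rank Z + 3 <= \rank S)%N by clear - diff cd cnt; lia.
pose Y := [set v : 'rV[F]_D | (v <= S)%MS && ~~ (v <= perp e)%MS].
have cY : (q * #|iso B Y| = q ^ \rank S - q ^ \rank H)%N.
  rewrite (card_iso_translate two_neq0 B_sym (W := <<e>>%MS)); first exact: card_sub_diff.
  - move=> v w; rewrite genmxE => /sub_rVP[a ->].
    have ae : (a *: e <= perp e)%MS.
      by apply: bil_perpP => y /sub_rVP[b ->]; rewrite bilZl bilZr // ee !mulr0.
    have aS : (a *: e <= S)%MS by rewrite scalemx_sub.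
    rewrite !inE; congr (_ && ~~ _); apply/idP/idP => h.
    + by rewrite -(addrK (a *: e) v) addmx_sub // eqmx_opp.
    + by rewrite addmx_sub.
    + by rewrite -(addrK (a *: e) v) addmx_sub // eqmx_opp.
    + by rewrite addmx_sub.
  - by move=> w; rewrite genmxE => /sub_rVP[a ->]; rewrite bilZl bilZr // ee !mulr0.
  - move=> v; rewrite inE => /andP[_ ve]; exists e; first by rewrite genmxE.
    apply: contraNneq ve => ve; apply: bil_perpP => y /sub_rVP[a ->].
    by rewrite bilZr // ve mulr0.
(* A totally isotropic H would lie in perp H = Z + e, of dimension dim Z + 1, whereas dim H = dim S
   - 1 >= dim Z + 2. *)
have [u uH uu] : exists2 u : 'rV[F]_D, (u <= H)%MS & bil u u != 0.
  suff /existsP[u /andP[uH uu]] : [exists u : 'rV[F]_D, (u <= H)%MS && (bil u u != 0)].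
    by exists u.
  apply: contraT => /existsPn h.
  have iH u : (u <= H)%MS -> bil u u = 0.
    by move=> uH; have := h u; rewrite uH /= negbK => /eqP.
  have HH : (H <= perp H)%MS.
    apply/row_subP => k; apply: bil_perpP => w wH.
    have kH := row_sub k H; have := iH _ (addmx_sub kH wH).
    rewrite bil_sqrD // !iH // add0r addr0 -mulr_natr => /eqP.
    by rewrite mulf_eq0 (negbTE two_neq0) orbF => /eqP.
  have := mxrankS HH; rewrite (eqmx_perp B_sym HE) perpK // (rank_adds_row eZ); clear - s3 rH; lia.
have cH := card_iso_le B_sym uH uu.
have q0 : (0 < q)%N by apply: ltnW.
have E : (q ^ \rank S = q * q ^ (\rank S).-1)%N by rewrite -expnS prednK //; clear - s3; lia.
have qZ : (q * q ^ \rank Z <= q ^ (\rank S).-1)%N by rewrite -expnS leq_pexp2l //; clear - s3; lia.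
have rH' : \rank H = (\rank S).-1 by rewrite -rH.
split; first by clear - s3; lia.
rewrite rH' in cY cH; rewrite step_set; set T := iso B _.
have up : (#|T| <= #|iso B Y| + #|iso B [set v : 'rV[F]_D | (v <= H)%MS]|)%N.
  apply: leq_trans (subset_leq_card _) (leq_card_setU _ _).
  apply/subsetP => v; rewrite !inE.
  have -> : (v <= H)%MS = (v <= S)%MS && (v <= perp e)%MS by apply: sub_capmx.
  by move=> /andP[/andP[-> _] ->]; case: (v <= perp e)%MS.
have lo : (#|iso B Y| <= #|T| + q ^ \rank Z)%N.
  rewrite -card_rowspace; apply: leq_trans (subset_leq_card _) (leq_card_setU _ _).
  apply/subsetP => v; rewrite !inE => /andP[/andP[-> _] ->].
  by case: (v <= Z)%MS.
rewrite E in cY; exact: mid_bounds cY cH up lo qZ q0.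
Qed.

End Step.

End Frames.

(** * Fibres of the orbits *)

Section Flags.
Variables (F : fieldType) (n d : nat) (B : 'M[F]_(odim d)).
Hypotheses (B_sym : B^T = B) (B_unit : B \in unitmx).
Local Notation N := (odim n).
Implicit Types W : flag n B.

Definition flagn W (a : nat) : 'M[F]_(odim d) := val W (inord a).

Lemma flagn0 W : flagn W 0 = 0.
Proof.
have /and5P[_ /eqP h _ _ _] := valP W; rewrite -h /flagn; congr (val W _).
by apply: val_inj; rewrite /= inordK.
Qed.

Lemma flagn_mono W a b : (a <= b)%N -> (b <= N)%N -> (flagn W a <= flagn W b)%MS.
Proof.
move=> ab bN; have /and5P[_ _ _ /forallP/(_ (inord a))/forallP/(_ (inord b)) h _] := valP W.
by move/implyP: h; apply; rewrite !inordK // ltnS // (leq_trans ab).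
Qed.

Lemma flagn_perp W a : (a <= N)%N -> (flagn W a :=: perp B (flagn W (N - a)%N))%MS.
Proof.
move=> aN; have /and5P[_ _ _ _ /forallP/(_ (inord a)) h] := valP W.
apply/eqmxP; rewrite /flagn /perp; move: h.
have -> : rev_ord (inord a : 'I_N.+1) = inord (N - a).
  by apply: val_inj; rewrite /= !inordK ?subSS // ltnS leq_subr.
by [].
Qed.

Lemma flagn_ext W W' : (forall a, (a <= N)%N -> (flagn W a :=: flagn W' a)%MS) -> W = W'.
Proof.
move=> h; apply/val_inj/ffunP => i.
have iN : (i <= N)%N by rewrite -ltnS.
have := h i iN; rewrite /flagn inord_val => /eqmxP/genmxP.
have /and5P[/forallP/(_ i)/eqP -> _ _ _ _] := valP W.
by have /and5P[/forallP/(_ i)/eqP -> _ _ _ _] := valP W'.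
Qed.

Lemma flag_loE W (i : 'I_N) : flag_lo W i = flagn W i.
Proof.
rewrite /flag_lo /flagn; congr (val W _); apply: val_inj.
by rewrite /= inordK // ltnS ltnW.
Qed.

Lemma flag_hiE W (i : 'I_N) : flag_hi W i = flagn W i.+1.
Proof.
rewrite /flag_hi /flagn; congr (val W _); apply: val_inj.
by rewrite /= inordK // ltnS.
Qed.

Lemma rank_flagn_perp W a : (a <= N)%N ->
  (\rank (flagn W (N - a)%N) + \rank (flagn W a) = odim d)%N.
Proof.
move=> aN; rewrite (flagn_perp W aN) rank_perp // addnC subnK //.
exact: rank_leq_col.
Qed.

Definition rcap W W' a b := \rank (flagn W a :&: flagn W' b)%MS.

(** The entry a_ij is the second difference of the dimensions of the intersections of V_a and V'_b;
    summing up, an orbit is described by these dimensions, which are corner sums of its matrix. *)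
Lemma relposE W W' (i j : 'I_N) :
  (relpos W W' i j + (rcap W W' i.+1 j + rcap W W' i j.+1)
    = rcap W W' i.+1 j.+1 + rcap W W' i j)%N.
Proof.
rewrite /relpos !flag_loE !flag_hiE /rcap.
set U := flagn W i; set U1 := flagn W i.+1; set X := flagn W' j; set X1 := flagn W' j.+1.
have UU : (U <= U1)%MS by apply: flagn_mono.
have XX : (X <= X1)%MS by apply: flagn_mono.
have E Y : (U :&: (U1 :&: Y) :=: U :&: Y)%MS.
  by rewrite capmxA; apply: cap_eqmx => //; apply/capmx_idPl.
have le : (\rank (U + (U1 :&: X))%MS <= \rank (U + (U1 :&: X1))%MS)%N.
  by apply: mxrankS; rewrite addsmxS // capmxS.
have := mxrank_sum_cap U (U1 :&: X)%MS; have := mxrank_sum_cap U (U1 :&: X1)%MS.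
rewrite !E; move: le.
move: (\rank _) (\rank _) (\rank _) (\rank _) (\rank _) (\rank _) (\rank _).
by move=> a1 a2 a3 a4 a5 a6 a7; clear; lia.
Qed.

Lemma in_orbitP (A : Xi n d) W W' :
  reflect (forall a b, (a <= N)%N -> (b <= N)%N -> rcap W W' a b = corner A a b)
          (Defs.in_orbit A (W, W')).
Proof.
apply: (iffP idP) => [h a b|h].
  have rp (i j : 'I_N) : relpos W W' i j = entry A i j.
    by move/forallP/(_ i)/forallP/(_ j)/eqP: h.
  elim: a b => [|a IHa] b aN bN; first by rewrite corner0 /rcap flagn0 cap0mx mxrank0.
  elim: b bN => [|b IHb] bN; first by rewrite corner_0r /rcap flagn0 capmx0 mxrank0.
  have := relposE W W' (Ordinal aN) (Ordinal bN); rewrite rp /= -nentry_ord /=.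
  rewrite IHb ?(ltnW bN) // !IHa ?(ltnW aN) ?(ltnW bN) // !cornerS row_sumS.
  by move: (nentry A a b) => e; clear; lia.
apply/forallP => i; apply/forallP => j; apply/eqP.
have := relposE W W' i j; rewrite !h ?(ltnW (ltn_ord _)) // -nentry_ord.
rewrite !cornerS row_sumS.
by move: (nentry A i j) (relpos _ _ _ _) => e e'; clear; lia.
Qed.

End Flags.

Lemma diff_bounds (Q a b : nat) :
  (Q * b <= a -> (Q - 1) * a <= Q * (a - b) <= (Q + 0) * a)%N.
Proof. by move=> h; apply/andP; split; nia. Qed.

Section Fiber.
Variables (F : finFieldType) (n d : nat) (B : 'M[F]_(odim d)).
Hypotheses (two_neq0 : (2%:R : F) != 0) (B_sym : B^T = B) (B_unit : B \in unitmx).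
Variables (W : flag n B) (C : Xi n d) (E0 : 'M[F]_(odim d)).
Local Notation N := (odim n).
Local Notation q := #|F|.
Hypothesis W_rows : forall i, (\rank (flag_hi W i) - \rank (flag_lo W i))%N
  = (\sum_k entry C i k)%N.
Hypotheses (E0_lo : (flagn W n <= E0)%MS) (E0_hi : (E0 <= flagn W n.+1)%MS).
Hypotheses (E0_iso : (E0 <= perp B E0)%MS) (E0_rank : \rank E0 = (odim d)./2).

Local Notation V := (flagn W).
Local Notation labs := (labs (nentry C) N n).
Local Notation label := (nat * nat)%type.
Local Notation label_ok := (label_ok (nentry C) N n).

Lemma rankV a : (a <= N)%N -> \rank (V a) = corner C a N.
Proof.
elim: a => [|a IH] aN; first by rewrite flagn0 mxrank0 corner0.
have := W_rows (Ordinal aN); rewrite flag_loE flag_hiE /= IH ?(ltnW aN) //.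
have := mxrankS (flagn_mono W (leqnSn a) aN); rewrite IH ?(ltnW aN) // cornerS.
have -> : (\sum_k entry C (Ordinal aN) k = row_sum C a N)%N.
  rewrite -[row_sum C a N]/(row_sum C (Ordinal aN) N).
  by rewrite row_sum_ord //; apply: eq_bigr => j _; rewrite ltn_ord mul1n.
by clear; lia.
Qed.

Lemma label_ok_sorted l ls : label_ok l ls -> row_sorted n l ls.
Proof. by case=> lN _ srt _; split=> // l' /srt; rewrite /lex_le /=; clear; lia. Qed.

Lemma labels_sorted ls : all_suffix label_ok ls -> all_suffix (row_sorted n) ls.
Proof. by apply: all_suffix_imp; exact: label_ok_sorted. Qed.

Definition iso_frames := frames (gstep V (E_iso B)) labs.

Lemma card_iso_frames :
  ((q - 2) ^ size labs * q ^ suffix_sum (e_iso C) labs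
     <= q ^ size labs * #|iso_frames|
     <= (q + 2) ^ size labs * q ^ suffix_sum (e_iso C) labs)%N.
Proof.
have q0 : (0 < q)%N by apply/card_gt0P; exists 0.
apply: (card_frames_bounds (Pr := label_ok)) => //; last exact: labs_ok.
move=> l ls vs ok oks fr; have rs := label_ok_sorted ok; have srt := labels_sorted oks.
have V0 := flagn0 W; have Vm := flagn_mono W; have Vp := flagn_perp W.
have iN := rs.1.
have rS := step_rank_S two_neq0 B_sym B_unit Vm Vp fr srt rs.
have /= := rankV iN; rewrite -rS /e_iso => <-; rewrite addnK.
have rk1 := rankV iN; have rk0 := rankV (ltnW iN).
case: (ltngtP l.1 n) => ln.
- rewrite subn0; apply: (step_small two_neq0 B_sym B_unit V0 Vm Vp fr srt rs ln).
  by rewrite rk0 rk1; apply: label_ok_rows => // E; rewrite E ltnn in ln.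
- rewrite subn1; apply: (step_large two_neq0 B_sym B_unit V0 Vm Vp fr srt rs ln _).2.
  by rewrite rk0 rk1; apply: label_ok_rows => // E; rewrite E ltnn in ln.
- rewrite subn1.
  apply: (step_mid two_neq0 B_sym B_unit V0 Vm Vp fr srt rs ln _ E0_lo E0_hi E0_iso E0_rank).2.
  have dE : odim d = (corner C n N + corner C n.+1 N)%N.
    have nN : (n <= N)%N by clear; lia.
    rewrite -(rank_flagn_perp B_unit W nN) -!rankV //; last by clear; lia.
    rewrite addnC; congr (_ + \rank (V _))%N; by clear; lia.
  by rewrite rk0 rk1; have := label_ok_mid ok ln dE; rewrite ln.
Qed.

Section Inside.
Variable L : flag n B.
Hypothesis L_orbit : Defs.in_orbit C (W, L).
Let rc a b : (a <= N)%N -> (b <= N)%N -> \rank (V a :&: flagn L b)%MS = corner C a b.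
Proof. by have /in_orbitP := L_orbit; apply. Qed.

Definition E_in (l : label) (X : 'M[F]_(odim d)) (v : 'rV[F]_(odim d)) : bool :=
  (v <= flagn L l.2.+1)%MS.

Definition in_frames := frames (gstep V E_in) labs.

(** By the lexicographic order the earlier vectors of row i lie in L_(j+1), and those of lower rows
    lie in V_i. They are too few, together with V_i, to cover U, the intersection of V_(i+1) and
    L_(j+1); hence at least a proportion 1 - 1/q of U is admissible. *)
Lemma card_in_frames :
  ((q - 1) ^ size labs * q ^ suffix_sum (e_in C) labs
     <= q ^ size labs * #|in_frames|
     <= (q + 0) ^ size labs * q ^ suffix_sum (e_in C) labs)%N.
Proof.
have q0 : (0 < q)%N by apply/card_gt0P; exists 0.
apply: (card_frames_bounds (Pr := label_ok)) => //; last exact: labs_ok.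
move=> l ls vs ok oks fr; have rs := label_ok_sorted ok; have srt := labels_sorted oks.
have V0 := flagn0 W; have Vm := flagn_mono W.
have iN := rs.1; have [_ jn ls_lex cnt] := ok.
have jN : (l.2 < N)%N by apply: leq_trans jn _; clear; lia.
pose X := Sp predT ls vs; pose U := (V l.1.+1 :&: flagn L l.2.+1)%MS; pose Z := (V l.1 + X)%MS.
have -> : [set v | gstep V E_in l ls vs v] =
    [set v : 'rV[F]_(odim d) | (v <= U)%MS && ~~ (v <= Z)%MS].
  apply/setP => v; rewrite !inE /gstep /E_in -/X -/Z.
  have -> : (v <= U)%MS = (v <= V l.1.+1)%MS && (v <= flagn L l.2.+1)%MS by apply: sub_capmx.
  by rewrite andbAC andbA.
rewrite card_sub_diff /e_in -rc // -/U.
suff lt : (\rank (U :&: Z)%MS < \rank U)%N.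
  have h : (q * q ^ \rank (U :&: Z)%MS <= q ^ \rank U)%N by rewrite -expnS leq_pexp2l.
  exact: diff_bounds.
pose Q : pred label := fun l' => l'.1 == l.1.
have memfr := frame_mem fr.
have SpU : (Sp Q ls vs <= U)%MS.
  apply: Sp_le => p pz /eqP Qp; have [pl pV] := memfr p pz.
  rewrite sub_capmx -{1}Qp pV /=.
  have [Y pL] := frame_memE fr pz; apply: submx_trans (pL : (p.2 <= flagn L p.1.2.+1)%MS) _.
  apply: flagn_mono => //.
  by have := ls_lex _ pl; rewrite /lex_le Qp ltnn eqxx.
have ZE : (Z <= Sp Q ls vs + V l.1)%MS.
  rewrite addsmx_sub addsmxSr /=; apply: Sp_le => p pz _; have [pl pV] := memfr p pz.
  case: (ltngtP p.1.1 l.1) => [lt|gt|eq].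
  - apply: submx_trans (submx_trans pV _) (addsmxSr _ _).
    by apply: Vm lt (ltnW iN).
  - by have := rs.2 _ pl; rewrite leqNgt gt.
  - by apply: submx_trans (Sp_mem pz _) (addsmxSl _ _); rewrite /Q eq.
have UZ : (U :&: Z <= Sp Q ls vs + (V l.1 :&: U))%MS.
  by rewrite (matrix_modl (V l.1) SpU) capmxC capmxS.
have VU : (\rank (V l.1 :&: U)%MS <= corner C l.1 l.2.+1)%N.
  rewrite -rc ?(ltnW iN) //; apply: mxrankS; rewrite capmxS //.
  exact: capmxSr.
have rU : \rank U = corner C l.1.+1 l.2.+1 by apply: rc.
have SpQ : (\rank (Sp Q ls vs) <= count Q ls)%N.
  by rewrite (rank_Sp V0 Vm Q fr srt).
have cQ : (count Q ls < row_sum C l.1 l.2.+1)%N.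
  pose Q' : pred label := fun l' => (l'.1 == l.1) && (l'.2 <= l.2)%N.
  have -> : count Q ls = count Q' ls.
    apply: eq_in_count => l' /ls_lex; rewrite /lex_le /Q /Q' /=; clear; lia.
  have cl : (count Q' labs <= row_sum C l.1 l.2.+1)%N.
    rewrite count_labs big_mkord (bigD1 (Ordinal iN)) //= [X in (_ + X)%N]big1 => [|k ki].
      rewrite addn0 /Q' /= eqxx /= /row_sum [X in (_ <= X)%N](big_nat_widen _ _ n) //.
    by rewrite big_pred0 // => j; rewrite /Q' /= (negbTE (ki : (k != l.1 :> nat))).
  by apply: leq_trans cl; have := cnt Q'; rewrite /= {1}/Q' eqxx leqnn.
apply: leq_ltn_trans (mxrankS UZ) _.
apply: leq_ltn_trans (mxrank_adds_leqif _ _) _.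
rewrite rU cornerS; move: VU SpQ cQ.
by move: (\rank _) (\rank _) (corner _ _ _) (count _ _) (row_sum _ _ _); clear; lia.
Qed.

End Inside.

End Fiber.

Lemma flagnN (F : fieldType) n d (B : 'M[F]_(odim d)) (W : flag n B) :
  flagn W (odim n) = 1%:M.
Proof.
have /and5P[_ _ /eqP h _ _] := valP W; rewrite -h /flagn; congr (val W _).
by apply: val_inj; rewrite /= inordK.
Qed.

(** * Every isotropic sequence belongs to exactly one flag of the fibre *)

Section Partition.
Variables (F : finFieldType) (n d : nat) (B : 'M[F]_(odim d)).
Hypotheses (two_neq0 : (2%:R : F) != 0) (B_sym : B^T = B) (B_unit : B \in unitmx).
Variables (W : flag n B) (C : Xi n d) (E0 : 'M[F]_(odim d)).
Local Notation N := (odim n).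
Local Notation q := #|F|.
Hypothesis W_rows : forall i, (\rank (flag_hi W i) - \rank (flag_lo W i))%N
  = (\sum_k entry C i k)%N.

Local Notation V := (flagn W).
Local Notation labs := (labs (nentry C) N n).
Local Notation label := (nat * nat)%type.
Local Notation iso_frames := (iso_frames W C).
Local Notation in_frames := (in_frames W C).

Definition cols (b : nat) : pred label := fun l => (l.2 < b)%N.

Lemma count_cols a b : (a <= N)%N -> (b <= n)%N ->
  count (fun l => cols b l && (l.1 < a)%N) labs = corner C a b.
Proof.
move=> aN bn; have bN : (b <= N)%N by apply: leq_trans bn _; clear; lia.
rewrite count_labs_ord corner_ord //; apply: eq_bigr => i _; apply: eq_bigr => j _.
congr (_ * _)%N; rewrite /cols /=.
by move: bn; move: (nat_of_ord i) (nat_of_ord j) => i' j'; clear; lia.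
Qed.

Section FlagOfFrame.
Variable vs : seq 'rV[F]_(odim d).
Hypothesis fr : frame (gstep V (E_iso B)) labs vs.
Let srt : all_suffix (row_sorted n) labs := labels_sorted (labs_ok _ _ _).
Let X b := Sp (cols b) labs vs.

Lemma X_mono a b : (a <= b)%N -> (X a <= X b)%MS.
Proof. by move=> ab; apply: Sp_sub => l; rewrite /cols => /leq_trans; apply. Qed.

Lemma X_iso a b : (X a <= perp B (X b))%MS.
Proof.
have XT c : (X c <= Sp predT labs vs)%MS by apply: Sp_sub.
apply: submx_trans (XT a) (submx_trans _ (perpS B_sym (XT b))).
exact: Sp_isotropic fr.
Qed.

Lemma X_cap a b : (a <= N)%N -> (b <= n)%N -> \rank (V a :&: X b)%MS = corner C a b.
Proof.
move=> aN bn; rewrite -count_cols //.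
by rewrite (rank_cap_Sp (flagn0 W) (flagn_mono W) _ fr srt aN).
Qed.

Lemma X_rank b : (b <= n)%N -> \rank (X b) = corner C N b.
Proof.
move=> bn; rewrite -X_cap // flagnN.
by rewrite (capmx_idPr (submx1 _)).
Qed.

Definition frame_flag_fun : {ffun 'I_N.+1 -> 'M[F]_(odim d)} :=
  [ffun i : 'I_N.+1 => if (i <= n)%N then <<X i>>%MS else <<perp B (X (N - i)%N)>>%MS].

Lemma X0 : X 0 = 0.
Proof. by apply/eqP; rewrite -mxrank_eq0 X_rank // corner_0r. Qed.

Lemma frame_flagP : is_flag B frame_flag_fun.
Proof.
apply/and5P; split.
- by apply/forallP => i; rewrite ffunE; case: ifP => _; rewrite genmx_id.
- by rewrite ffunE leq0n X0 genmx0.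
- rewrite ffunE ifN /=; last by clear; lia.
  rewrite subnn X0; apply/eqP; apply: etrans (genmx1 _ _); apply/genmxP.
  by rewrite submx1 /= sub_perp trmx0 mulmx0.
- apply/forallP => i; apply/forallP => j; apply/implyP => ij; rewrite !ffunE.
  case: (leqP i n) => hi; case: (leqP j n) => hj; rewrite !genmxE.
  + exact: X_mono.
  + exact: X_iso.
  + by rewrite ltnNge (leq_trans ij hj) in hi.
  + by apply: perpS => //; apply: X_mono; rewrite leq_sub2l.
- apply/forallP => i; rewrite !ffunE /= subSS; apply/eqmxP; rewrite -/(perp B _).
  have iN : (i <= N)%N by rewrite -ltnS.
  case: (leqP i n) => hi.
    rewrite ifN; last by move: hi; clear; lia.
    rewrite subKn //; apply: eqmx_trans (genmxE _) _.
    apply: eqmx_sym; apply: eqmx_trans (eqmx_perp B_sym (genmxE _)) _.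
    exact: perpK.
  rewrite ifT; last by move: hi iN; clear; lia.
  apply: eqmx_trans (genmxE _) _; apply: eqmx_sym.
  by apply: (eqmx_perp B_sym); exact: genmxE.
Qed.

Definition frame_flag : flag n B := Sub frame_flag_fun frame_flagP.

Lemma frame_flag_lo b : (b <= n)%N -> (flagn frame_flag b :=: X b)%MS.
Proof.
move=> bn; rewrite /flagn /= ffunE inordK; last by move: bn; clear; lia.
by rewrite bn; apply: genmxE.
Qed.

(** For b <= n the dimensions are read off the adapted sequence. For b > n both spaces are
    orthogonals, and [corner_rev] converts the dimension found for N - a and N - b. *)
Lemma frame_flag_orbit : Defs.in_orbit C (W, frame_flag).
Proof.
apply/in_orbitP => a b aN bN; rewrite /rcap; case: (leqP b n) => bn.
  by rewrite (cap_eqmx (eqmx_refl _) (frame_flag_lo bn)) X_cap.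
have bn' : (N - b <= n)%N by move: bn; clear; lia.
have E : (flagn frame_flag b :=: perp B (X (N - b)%N))%MS.
  apply: eqmx_trans (flagn_perp frame_flag bN) _.
  exact: (eqmx_perp B_sym (frame_flag_lo bn')).
rewrite (cap_eqmx (flagn_perp W aN) E) -(perp_adds B_sym) rank_perp //.
have aN' : (N - a <= N)%N := leq_subr _ _.
have h1 := mxrank_sum_cap (V (N - a)%N) (X (N - b)%N).
rewrite X_cap // X_rank // (rankV W_rows) // in h1.
have h2 := rank_flagn_perp B_unit W aN; rewrite !(rankV W_rows) // in h2.
have h3 := corner_rev C aN (leq_subr b N); rewrite subKn // in h3.
have h4 := rank_leq_col (V (N - a)%N + X (N - b)%N)%MS.
by move: h1 h2 h3 h4; clear; lia.
Qed.

End FlagOfFrame.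

Lemma frame_imp (E E' : label -> 'M[F]_(odim d) -> 'rV[F]_(odim d) -> bool) ls vs :
  frame (gstep V E) ls vs ->
  (forall p X, p \in zip ls vs -> E' p.1 X p.2) -> frame (gstep V E') ls vs.
Proof.
elim: ls vs => [|l ls IH] [|v vs] //= /andP[fr /and3P[vV vZ _]] h.
rewrite IH // => [|p X pz]; last by apply: h; rewrite inE pz orbT.
by rewrite /gstep vV vZ /=; apply: (h (l, v)); rewrite inE eqxx.
Qed.

Lemma frame_flag_in (t : (size labs).-tuple 'rV[F]_(odim d))
    (fr : frame (gstep V (E_iso B)) labs t) :
  t \in in_frames (frame_flag fr).
Proof.
rewrite inE; apply: (frame_imp (E := E_iso B)) => [|p X pz]; first exact: fr.
have [pl _] := frame_mem fr pz; have [_ pn] := mem_labs pl.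
rewrite /E_in (frame_flag_lo fr pn); apply: Sp_mem => //.
by rewrite /cols.
Qed.

Lemma in_frame_Sp (L : flag n B) ls vs b : (b <= n)%N -> frame (gstep V (E_in L)) ls vs ->
  (Sp (cols b) ls vs <= flagn L b)%MS.
Proof.
move=> bn fr; apply: Sp_le => p pz pb; have [X pL] := frame_memE fr pz.
apply: submx_trans (pL : (p.2 <= flagn L p.1.2.+1)%MS) _; apply: flagn_mono => //.
by apply: leq_trans bn _; clear; lia.
Qed.

(** L_n is contained in its orthogonal L_(n+1), so vectors with columns below n are isotropic and
    mutually orthogonal. *)
Lemma in_frame_iso (L : flag n B) ls vs : (forall l, l \in ls -> (l.2 < n)%N) ->
  frame (gstep V (E_in L)) ls vs ->
  (Sp predT ls vs <= flagn L n)%MS /\ frame (gstep V (E_iso B)) ls vs.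
Proof.
have nN : (n <= N)%N by clear; lia.
have Liso : (flagn L n <= perp B (flagn L n))%MS.
  have h : (flagn L n.+1 :=: perp B (flagn L (N - n.+1)%N))%MS.
    by apply: flagn_perp; clear; lia.
  have E : (N - n.+1 = n)%N by clear; lia.
  by rewrite E in h; rewrite -h; apply: flagn_mono; rewrite // ltnS -addnn leq_addr.
elim: ls vs => [|l ls IH] [|v vs] //= ln; first by rewrite Sp_nil sub0mx.
move=> /andP[fr /and3P[vV vZ vL]]; have [|SL fr'] := IH vs _ fr.
  by move=> l' l'ls; apply: ln; rewrite inE l'ls orbT.
have vLn : (v <= flagn L n)%MS.
  apply: submx_trans (vL : (v <= flagn L l.2.+1)%MS) _; apply: flagn_mono => //.
  by apply: ln; rewrite inE eqxx.
split; first by rewrite Sp_cons /= addsmx_sub vLn SL.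
rewrite fr' /gstep vV vZ /E_iso /=; apply/andP; split.
  by apply: submx_trans vLn (submx_trans Liso (perpS B_sym SL)).
by apply/eqP/(bil_perp (U := flagn L n)) => //; apply: submx_trans vLn Liso.
Qed.

Lemma in_frames_iso (L : flag n B) : in_frames L \subset iso_frames.
Proof.
apply/subsetP => t; rewrite !inE => fr.
by have [] := in_frame_iso (fun l (h : l \in labs) => (mem_labs h).2) fr.
Qed.

(** For b <= n the space L_b contains the span of the vectors with columns below b, and the
    dimensions agree; the remaining members are orthogonals of these. *)
Lemma in_frames_uniq (t : (size labs).-tuple 'rV[F]_(odim d)) (L L' : flag n B) :
  Defs.in_orbit C (W, L) -> Defs.in_orbit C (W, L') ->
  t \in in_frames L -> t \in in_frames L' -> L = L'.
Proof.
have srt : all_suffix (row_sorted n) labs := labels_sorted (labs_ok _ _ _).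
have lo (M : flag n B) b : Defs.in_orbit C (W, M) -> t \in in_frames M -> (b <= n)%N ->
    (flagn M b :=: Sp (cols b) labs t)%MS.
  move=> /in_orbitP rc; rewrite inE => fr bn.
  have bN : (b <= N)%N by apply: leq_trans bn _; clear; lia.
  have le := in_frame_Sp bn fr; apply/eqmx_sym/eqmxP; rewrite le /=.
  rewrite -(geq_leqif (mxrank_leqif_sup le)).
  rewrite (rank_Sp (flagn0 W) (flagn_mono W) _ fr srt).
  have := rc N b (leqnn _) bN; rewrite /rcap flagnN (capmx_idPr (submx1 _)) => ->.
  rewrite -count_cols //; apply: sub_count => l; rewrite /= => /andP[-> _] //.
move=> oL oL' tL tL'; apply: flagn_ext => b bN.
case: (leqP b n) => bn.
  exact: eqmx_trans (lo L b oL tL bn) (eqmx_sym (lo L' b oL' tL' bn)).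
have bn' : (N - b <= n)%N by move: bn; clear; lia.
apply: eqmx_trans (flagn_perp L bN) _.
apply: eqmx_trans (eqmx_sym (flagn_perp L' bN)); apply: (eqmx_perp B_sym).
exact: eqmx_trans (lo L _ oL tL bn') (eqmx_sym (lo L' _ oL' tL' bn')).
Qed.

Lemma card_iso_frames_partition :
  #|iso_frames| = (\sum_(L : flag n B | Defs.in_orbit C (W, L)) #|in_frames L|)%N.
Proof.
rewrite -sum1_card.
transitivity (\sum_(t in iso_frames)
  \sum_(L : flag n B | Defs.in_orbit C (W, L) && (t \in in_frames L)) 1)%N.
  apply: eq_bigr => t; rewrite inE => fr; have oL := frame_flag_orbit fr.
  rewrite (bigD1 (frame_flag fr)) /=; last by rewrite oL frame_flag_in.
  rewrite big1 // => L /andP[/andP[oL' tL] /eqP nL]; case: nL.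
  exact: in_frames_uniq oL' oL tL (frame_flag_in fr).
rewrite (exchange_big_dep (fun L => Defs.in_orbit C (W, L))) /= => [|t L _ /andP[]] //.
apply: eq_bigr => L oL; rewrite sum1dep_card; apply: eq_card => t.
rewrite !inE oL /=; case h: (frame (gstep V (E_in L)) _ _); rewrite ?andbF // andbT.
by have /subsetP/(_ t) := in_frames_iso L; rewrite !inE h => ->.
Qed.

Hypotheses (E0_lo : (flagn W n <= E0)%MS) (E0_hi : (E0 <= flagn W n.+1)%MS).
Hypotheses (E0_iso : (E0 <= perp B E0)%MS) (E0_rank : \rank E0 = (odim d)./2).

(** All isotropic sequences are distributed over the k flags of the fibre, so a lower bound for one
    count is set against an upper bound for the other, and [frame_exponents] cancels the common
    power of q. The constants 2 stem from the isotropic steps, the constant 1 from the steps inside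
    a given flag. *)
Theorem fiber_bounds (k := #|[set L : flag n B | Defs.in_orbit C (W, L)]|) (m := size labs) :
  ((q - 2) ^ m * q ^ dXi C <= k * q ^ m /\
   (q - 1) ^ m * k <= (q + 2) ^ m * q ^ dXi C)%N.
Proof.
have q0 : (0 < q)%N by apply/card_gt0P; exists 0.
have Eexp : suffix_sum (e_iso C) labs = (suffix_sum (e_in C) labs + dXi C)%N.
  apply: frame_exponents; apply: all_suffix_imp (labs_ok _ _ _) => l ls.
  exact: label_ok_trunc.
have := card_iso_frames two_neq0 B_sym B_unit W_rows E0_lo E0_hi E0_iso E0_rank.
rewrite card_iso_frames_partition Eexp expnD -/m; set e := suffix_sum _ _.
have bnd L : Defs.in_orbit C (W, L) ->
    ((q - 1) ^ m * q ^ e <= q ^ m * #|in_frames L| <= q ^ m * q ^ e)%N.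
  by move=> oL; have := card_in_frames oL; rewrite addn0.
rewrite big_distrr /= => /andP[lo up].
have kE x : (\sum_(L : flag n B | Defs.in_orbit C (W, L)) x = k * x)%N.
  by rewrite sum_nat_cond_const; congr (_ * _)%N; apply: eq_card => L; rewrite inE.
have up' : (\sum_(L : flag n B | Defs.in_orbit C (W, L)) q ^ m * #|in_frames L| <= k * (q ^ m * q ^ e))%N.
  by rewrite -kE; apply: leq_sum => L /bnd /andP[].
have lo' : (k * ((q - 1) ^ m * q ^ e) <= \sum_(L : flag n B | Defs.in_orbit C (W, L)) q ^ m * #|in_frames L|)%N.
  by rewrite -kE; apply: leq_sum => L /bnd /andP[].
have qe : (0 < q ^ e)%N by rewrite expn_gt0 q0.
split; rewrite -(leq_pmul2r qe).
  have := leq_trans lo up'; move: (q ^ e)%N (q ^ m)%N (q ^ dXi C)%N ((q - 2) ^ m)%N => a b c x.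
  by clear; rewrite !mulnA => h; apply: leq_trans h; apply: eq_leq; ring.
have := leq_trans lo' up; move: (q ^ e)%N ((q - 1) ^ m)%N (q ^ dXi C)%N ((q + 2) ^ m)%N => a b c x.
clear => h; apply: leq_trans (eq_leq _) (leq_trans h (eq_leq _)); ring.
Qed.

End Partition.

(** * The antidiagonal form and its coordinate flags *)

Section CoordinateFlag.
Variables (F : fieldType) (D : nat).

Definition antidiag_mx : 'M[F]_D := \matrix_(i, j) (j == rev_ord i)%:R.
Local Notation J := antidiag_mx.
Local Notation T := (fun r : nat => pid_mx r : 'M[F]_D).

Lemma antidiag_sym : J^T = J.
Proof.
apply/matrixP => i j; rewrite !mxE; congr (_%:R).
by rewrite -(inj_eq rev_ord_inj) rev_ordK eq_sym.
Qed.

Lemma antidiag_unit : J \in unitmx.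
Proof.
suff /mulmx1_unit[] : J *m J = 1%:M by [].
apply/matrixP => i j; rewrite !mxE (bigD1 (rev_ord i)) //= !mxE eqxx mul1r.
rewrite rev_ordK [j == i]eq_sym big1 ?addr0 // => a /negbTE ai.
by rewrite !mxE ai mul0r.
Qed.

Lemma pid_mxS r s : (r <= s)%N -> (T r <= T s)%MS.
Proof.
by move=> rs; apply/submxP; exists (T r); rewrite mul_pid_mx (minn_idPl rs) pid_mx_minv.
Qed.

Lemma pid_mx_perp_sub r s : (r + s <= D)%N -> (T r <= perp J (T s))%MS.
Proof.
move=> rs; rewrite sub_perp; apply/eqP/matrixP => i j; rewrite tr_pid_mx.
rewrite !mxE big1 // => a _; rewrite !mxE.
case: eqP => [/val_inj aj|_]; last by rewrite mulr0.
case: ltnP => as_; rewrite ?mulr0 // mulr1 big1 // => b _; rewrite !mxE.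
case: eqP => [/val_inj ib|_]; last by rewrite mul0r.
case: ltnP => ir; rewrite ?mul0r //; case: eqP => [/(congr1 val) /= E|]; rewrite ?mulr0 //.
have := ltn_ord b; rewrite -ib; move: ir as_ rs E; rewrite ib /=.
by move: (nat_of_ord a) (nat_of_ord b); clear; lia.
Qed.

Lemma pid_mx_perp r s : (r + s = D)%N -> (T r :=: perp J (T s))%MS.
Proof.
move=> rs; apply/eqmxP; rewrite pid_mx_perp_sub ?rs //=.
rewrite -(geq_leqif (mxrank_leqif_sup (pid_mx_perp_sub _))) ?rs //.
rewrite (rank_perp antidiag_unit) !rank_pid_mx -?rs ?leq_addr ?leq_addl //.
by rewrite addnK.
Qed.

End CoordinateFlag.

Section BaseFlag.
Variables (F : fieldType) (n d : nat) (C : Xi n d).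
Local Notation N := (odim n).
Local Notation B := (antidiag_mx F (odim d)).
Local Notation T := (fun r : nat => pid_mx r : 'M[F]_(odim d)).

Lemma corner_dual a : (a <= N)%N -> (corner C a N + corner C (N - a) N = odim d)%N.
Proof. by move=> aN; rewrite -corner_rev // subnn corner_0r add0n corner_total. Qed.

Lemma corner_mono a b : (a <= b)%N -> (corner C a N <= corner C b N)%N.
Proof.
move=> ab; rewrite -(subnKC ab); elim: (b - a)%N => [|e IH]; first by rewrite addn0.
by rewrite addnS cornerS (leq_trans IH) // leq_addr.
Qed.

Lemma corner_le a : (a <= N)%N -> (corner C a N <= odim d)%N.
Proof. by move=> /corner_dual <-; apply: leq_addr. Qed.

Definition base_flag_fun : {ffun 'I_N.+1 -> 'M[F]_(odim d)} :=
  [ffun i : 'I_N.+1 => <<T (corner C i N)>>%MS].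

Lemma base_flagP : is_flag B base_flag_fun.
Proof.
apply/and5P; split.
- by apply/forallP => i; rewrite ffunE genmx_id.
- by rewrite ffunE corner0 pid_mx_0 genmx0.
- by rewrite ffunE corner_total pid_mx_1; apply/eqP; exact: genmx1.
- apply/forallP => i; apply/forallP => j; apply/implyP => ij; rewrite !ffunE.
  by rewrite !genmxE; apply/pid_mxS/corner_mono.
- apply/forallP => i; rewrite !ffunE /= subSS; apply/eqmxP; rewrite -/(perp B _).
  have iN : (i <= N)%N by rewrite -ltnS.
  apply: eqmx_trans (genmxE _) _; apply: eqmx_sym.
  apply: eqmx_trans (eqmx_perp (antidiag_sym _ _) (genmxE _)) _.
  by apply/eqmx_sym/pid_mx_perp/corner_dual.
Qed.

Definition base_flag : flag n B := Sub base_flag_fun base_flagP.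

Lemma base_flagn a : (a <= N)%N -> (flagn base_flag a :=: T (corner C a N))%MS.
Proof. by move=> aN; rewrite /flagn /= ffunE inordK //; exact: genmxE. Qed.

Lemma base_flag_rows i :
  (\rank (flag_hi base_flag i) - \rank (flag_lo base_flag i))%N = (\sum_k entry C i k)%N.
Proof.
have iN := ltn_ord i; rewrite flag_hiE flag_loE !base_flagn ?(ltnW iN) //.
rewrite !rank_pid_mx ?corner_le ?(ltnW iN) // cornerS addKn row_sum_ord //.
by apply: eq_bigr => k _; rewrite ltn_ord mul1n.
Qed.

Lemma base_mid : (corner C n N <= d < corner C n.+1 N)%N.
Proof.
have nN : (n <= N)%N by clear; lia.
have := corner_dual nN; have -> : (N - n = n.+1)%N by clear; lia.
have := corner_mono (leqnSn n); clear; lia.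
Qed.

(** dim V_n and dim V_(n+1) add up to 2d + 1, so d lies between them; for the antidiagonal form the
    first d coordinate vectors span an isotropic subspace. *)
Lemma base_lagrangian (E0 := T d) :
  [/\ (flagn base_flag n <= E0)%MS, (E0 <= flagn base_flag n.+1)%MS,
      (E0 <= perp B E0)%MS & \rank E0 = (odim d)./2].
Proof.
have [lo hi] := andP base_mid; have nN : (n < N)%N by clear; lia.
rewrite !base_flagn ?(ltnW nN) //; split; rewrite ?pid_mxS ?(ltnW hi) //.
  by rewrite pid_mx_perp_sub // addnn leqnSn.
have dD : (d <= odim d)%N by clear; lia.
by rewrite /E0 rank_pid_mx //= uphalf_double.
Qed.

End BaseFlag.

(** * Regular functions *)

Lemma polyfun_ext (k : fieldType) (J : Type) (P Q : (J -> k) -> k) :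
  P =1 Q -> polyfun P -> polyfun Q.
Proof. by move=> /funext ->. Qed.

Lemma polyfun_subst (k : fieldType) (J J' : Type) (tau : (J' -> k) -> J -> k)
    (P : (J -> k) -> k) :
  (forall j, polyfun (fun e => tau e j)) -> polyfun P ->
  polyfun (fun e => P (tau e)).
Proof.
move=> htau; elim=> [c|j|P1 P2 _ IH1 _ IH2|P1 P2 _ IH1 _ IH2].
- exact: Pf_const.
- exact: htau.
- exact: Pf_add IH1 IH2.
- exact: Pf_mul IH1 IH2.
Qed.

Lemma polyfun_opp (k : fieldType) (J : Type) (P : (J -> k) -> k) :
  polyfun P -> polyfun (fun e => - P e).
Proof.
move=> hP; apply: polyfun_ext (Pf_mul (Pf_const J (-1)) hP) => e.
by rewrite mulN1r.
Qed.

Lemma polyfun_sum (k : fieldType) (J I : Type) (r : seq I) (p : pred I)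
    (P : I -> (J -> k) -> k) :
  (forall i, polyfun (P i)) -> polyfun (fun e => \sum_(i <- r | p i) P i e).
Proof.
move=> hP; elim: r => [|i r IHr].
  by apply: polyfun_ext (Pf_const J 0) => e; rewrite big_nil.
case hi: (p i).
  by apply: polyfun_ext (Pf_add (hP i) IHr) => e; rewrite big_cons hi.
by apply: polyfun_ext IHr => e; rewrite big_cons hi.
Qed.

Lemma polyfun_prod (k : fieldType) (J I : Type) (r : seq I) (p : pred I)
    (P : I -> (J -> k) -> k) :
  (forall i, polyfun (P i)) -> polyfun (fun e => \prod_(i <- r | p i) P i e).
Proof.
move=> hP; elim: r => [|i r IHr].
  by apply: polyfun_ext (Pf_const J 1) => e; rewrite big_nil.
case hi: (p i).
  by apply: polyfun_ext (Pf_mul (hP i) IHr) => e; rewrite big_cons hi.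
by apply: polyfun_ext IHr => e; rewrite big_cons hi.
Qed.

Lemma polyfun_det (k : fieldType) (J : Type) (m : nat)
    (M : (J -> k) -> 'M[k]_m) :
  (forall i j, polyfun (fun e => M e i j)) -> polyfun (fun e => \det (M e)).
Proof.
move=> hM; apply: polyfun_sum => s; apply: Pf_mul; first exact: Pf_const.
exact: polyfun_prod.
Qed.

Lemma polyfun_mulmx (k : fieldType) (J : Type) (m n p : nat)
    (M : (J -> k) -> 'M[k]_(m, n)) (N : (J -> k) -> 'M[k]_(n, p)) :
  (forall i j, polyfun (fun e => M e i j)) ->
  (forall i j, polyfun (fun e => N e i j)) ->
  forall i j, polyfun (fun e => (M e *m N e) i j).
Proof.
move=> hM hN i j.
apply: (@polyfun_ext _ _ (fun e => \sum_s M e i s * N e s j)).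
  by move=> e; rewrite mxE.
by apply: polyfun_sum => s; apply: Pf_mul.
Qed.

Lemma polyfun_addmx (k : fieldType) (J : Type) (m n : nat)
    (M N : (J -> k) -> 'M[k]_(m, n)) :
  (forall i j, polyfun (fun e => M e i j)) ->
  (forall i j, polyfun (fun e => N e i j)) ->
  forall i j, polyfun (fun e => (M e + N e) i j).
Proof.
move=> hM hN i j.
apply: (@polyfun_ext _ _ (fun e => M e i j + N e i j)).
  by move=> e; rewrite mxE.
exact: Pf_add.
Qed.

Lemma polyfun_oppmx (k : fieldType) (J : Type) (m n : nat)
    (M : (J -> k) -> 'M[k]_(m, n)) :
  (forall i j, polyfun (fun e => M e i j)) ->
  forall i j, polyfun (fun e => (- M e) i j).
Proof.
move=> hM i j.
apply: (@polyfun_ext _ _ (fun e => - M e i j)) => [e|]; first by rewrite mxE.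
exact: polyfun_opp.
Qed.

Lemma polyfun_cstmx (k : fieldType) (J : Type) (m n : nat) (A : 'M[k]_(m, n)) :
  forall i j, polyfun (fun _ : J -> k => A i j).
Proof. by move=> i j; apply: Pf_const. Qed.

Lemma polyfun_adj (k : fieldType) (J : Type) (m : nat)
    (M : (J -> k) -> 'M[k]_m) :
  (forall i j, polyfun (fun e => M e i j)) ->
  forall i j, polyfun (fun e => (\adj (M e)) i j).
Proof.
move=> hM i j.
apply: (@polyfun_ext _ _ (fun e => cofactor (M e) j i)).
  by move=> e; rewrite mxE.
apply: Pf_mul; first exact: Pf_const.
apply: polyfun_det => s t.
by apply: polyfun_ext (hM (lift j s) (lift i t)) => e; rewrite !mxE.
Qed.

(* [lift] is equivariant under enough polynomial maps of the affine space to
   make a local property of one lift of x hold at every lift of x. *)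
Definition lift_homogeneous (k : fieldType) (J T : Type)
    (lift : (J -> k) -> T -> Prop) : Prop :=
  (forall x, exists e, lift e x) /\
  forall e e0 x, lift e x -> lift e0 x -> exists tau : (J -> k) -> J -> k,
    [/\ forall j, polyfun (fun e' => tau e' j),
        forall e' y, lift e' y -> lift (tau e') y & tau e = e0].

Section Regular.
Variables (k : fieldType) (J T : Type) (lift : (J -> k) -> T -> Prop).
Hypothesis lift_hom : lift_homogeneous lift.

Local Notation regular := (regular_on lift).

(** Regularity offers a fraction at some lift of x only. Transport along a polynomial map makes it
    available at any prescribed lift, so that two regular functions can be written as fractions near
    the same lift. *)
Lemma regular_onE (U : T -> Prop) (phi : T -> k) (x : T) (e : J -> k) :
  regular U phi -> U x -> lift e x -> exists P Q,
    [/\ polyfun P, polyfun Q, Q e != 0 &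
      forall y e', U y -> lift e' y -> Q e' != 0 -> phi y = P e' / Q e'].
Proof.
move=> reg Ux ex; have [e0 [P [Q [e0x hP hQ Qe0 hphi]]]] := reg x Ux.
have [tau [htau tau_lift tau_e]] := lift_hom.2 _ _ _ ex e0x.
exists (fun e => P (tau e)), (fun e => Q (tau e)); split.
- exact: polyfun_subst htau hP.
- exact: polyfun_subst htau hQ.
- by rewrite tau_e.
- by move=> y e' Uy e'y; apply: hphi => //; apply: tau_lift.
Qed.

Lemma regular_ext (U : T -> Prop) (phi psi : T -> k) :
  (forall x, U x -> phi x = psi x) -> regular U phi -> regular U psi.
Proof.
move=> h reg x Ux; have [e [P [Q [ex hP hQ Qe hphi]]]] := reg x Ux.
exists e, P, Q; split=> // y e' Uy e'y Qe'.
by rewrite -h //; apply: hphi.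
Qed.

Lemma regular_restrict (U V : T -> Prop) (phi : T -> k) :
  (forall x, V x -> U x) -> regular U phi -> regular V phi.
Proof.
move=> h reg x Vx; have [e [P [Q [ex hP hQ Qe hphi]]]] := reg x (h x Vx).
by exists e, P, Q; split=> // y e' Vy; apply: hphi; apply: h.
Qed.

Lemma regular_const (U : T -> Prop) (c : k) : regular U (fun=> c).
Proof.
move=> x Ux; have [e ex] := lift_hom.1 x.
exists e, (fun=> c), (fun=> 1); split=> //; try exact: Pf_const.
  exact: oner_neq0.
by move=> y e' _ _ _; rewrite divr1.
Qed.

Lemma regular_add (U : T -> Prop) (phi psi : T -> k) :
  regular U phi -> regular U psi -> regular U (fun x => phi x + psi x).
Proof.
move=> r1 r2 x Ux; have [e ex] := lift_hom.1 x.
have [P1 [Q1 [hP1 hQ1 Q1e h1]]] := regular_onE r1 Ux ex.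
have [P2 [Q2 [hP2 hQ2 Q2e h2]]] := regular_onE r2 Ux ex.
exists e, (fun e => P1 e * Q2 e + P2 e * Q1 e), (fun e => Q1 e * Q2 e).
split=> //.
- by apply: Pf_add; apply: Pf_mul.
- exact: Pf_mul.
- exact: mulf_neq0.
- move=> y e' Uy e'y; rewrite mulf_eq0 negb_or => /andP[n1 n2].
  by rewrite (h1 y e') // (h2 y e') // addf_div.
Qed.

Lemma regular_mul (U : T -> Prop) (phi psi : T -> k) :
  regular U phi -> regular U psi -> regular U (fun x => phi x * psi x).
Proof.
move=> r1 r2 x Ux; have [e ex] := lift_hom.1 x.
have [P1 [Q1 [hP1 hQ1 Q1e h1]]] := regular_onE r1 Ux ex.
have [P2 [Q2 [hP2 hQ2 Q2e h2]]] := regular_onE r2 Ux ex.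
exists e, (fun e => P1 e * P2 e), (fun e => Q1 e * Q2 e); split=> //.
- exact: Pf_mul.
- exact: Pf_mul.
- exact: mulf_neq0.
- move=> y e' Uy e'y; rewrite mulf_eq0 negb_or => /andP[n1 n2].
  by rewrite (h1 y e') // (h2 y e') // mulf_div.
Qed.

Lemma regular_inv (U : T -> Prop) (phi : T -> k) :
  (forall x, U x -> phi x != 0) ->
  regular U phi -> regular U (fun x => (phi x)^-1).
Proof.
move=> nz r x Ux; have [e ex] := lift_hom.1 x.
have [P [Q [hP hQ Qe h]]] := regular_onE r Ux ex.
exists e, (fun e => Q e * Q e), (fun e => P e * Q e); split=> //.
- exact: Pf_mul.
- exact: Pf_mul.
- apply: mulf_neq0 => //; have := nz x Ux; rewrite (h x e) //.
  by rewrite mulf_eq0 negb_or => /andP[].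
- move=> y e' Uy e'y; rewrite mulf_eq0 negb_or => /andP[n1 n2].
  by rewrite (h y e') // invf_div -mulf_div divff // mulr1.
Qed.

Lemma regular_opp (U : T -> Prop) (phi : T -> k) :
  regular U phi -> regular U (fun x => - phi x).
Proof.
move=> r; apply: regular_ext (regular_mul (@regular_const U (-1)) r) => x _.
by rewrite mulN1r.
Qed.

Lemma regular_sum (I : Type) (r : seq I) (p : pred I) (U : T -> Prop)
    (phi : I -> T -> k) :
  (forall i, regular U (phi i)) ->
  regular U (fun x => \sum_(i <- r | p i) phi i x).
Proof.
move=> h; elim: r => [|i r IHr].
  by apply: regular_ext (@regular_const U 0) => x _; rewrite big_nil.
case hi: (p i).
  by apply: regular_ext (regular_add (h i) IHr) => x _; rewrite big_cons hi.
by apply: regular_ext IHr => x _; rewrite big_cons hi.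
Qed.

Lemma regular_exp (U : T -> Prop) (phi : T -> k) (m : nat) :
  regular U phi -> regular U (fun x => phi x ^+ m).
Proof.
move=> r; elim: m => [|m IH].
  by apply: regular_ext (@regular_const U 1) => x _; rewrite expr0.
by apply: regular_ext (regular_mul r IH) => x _; rewrite exprS.
Qed.

Lemma zopenP (W : T -> Prop) :
  zopen lift W <->
  forall x e, W x -> lift e x -> exists R, [/\ polyfun R, R e != 0 &
    forall y e', lift e' y -> R e' != 0 -> W y].
Proof.
split=> [[E [hE hW]] x e Wx ex|h].
  have /existsNP[P /not_implyP[EP /eqP Pe]] : ~ forall P, E P -> P e = 0.
    by move/(hW e x ex); apply.
  exists P; split=> //; first exact: hE.
  by move=> y e' e'y Pe'; apply: contrapT => /(hW e' y e'y) /(_ _ EP); apply/eqP.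
(* The complement is cut out by the largest conceivable system: all polynomials whose nonvanishing
   at a lift forces the point into W. *)
exists (fun R => polyfun R /\ forall y e, lift e y -> R e != 0 -> W y).
split=> [P []//|e x ex]; split=> [nW P [_ hP]|hP Wx].
  by apply: contrapT => /eqP Pe; apply: nW; apply: hP Pe.
have [R [pR Re hR]] := h x e Wx ex.
by move/negP: Re; apply; apply/eqP; apply: hP.
Qed.

Lemma zopen_and (W W' : T -> Prop) :
  zopen lift W -> zopen lift W' -> zopen lift (fun x => W x /\ W' x).
Proof.
move=> /zopenP h1 /zopenP h2; apply/zopenP => x e [Wx W'x] ex.
have [R1 [p1 n1 {}h1]] := h1 x e Wx ex.
have [R2 [p2 n2 {}h2]] := h2 x e W'x ex.
exists (fun e => R1 e * R2 e); split; [exact: Pf_mul|exact: mulf_neq0|].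
move=> y e' e'y; rewrite mulf_eq0 negb_or => /andP[m1 m2].
by split; [apply: h1 m1|apply: h2 m2].
Qed.

Lemma zopen_nonzero (W : T -> Prop) (phi : T -> k) :
  zopen lift W -> regular W phi -> zopen lift (fun x => W x /\ phi x != 0).
Proof.
move=> /zopenP h reg; apply/zopenP => x e [Wx nz] ex.
have [R [pR nR {}h]] := h x e Wx ex.
have [P [Q [hP hQ Qe hphi]]] := regular_onE reg Wx ex.
exists (fun e => R e * (P e * Q e)); split; first by do 2?apply: Pf_mul.
  rewrite !mulf_neq0 //; move: nz; rewrite (hphi x e) //.
  by rewrite mulf_eq0 negb_or => /andP[].
move=> y e' e'y; rewrite !mulf_eq0 !negb_or => /and3P[Re' Pe' Qe'].
have Wy := h _ _ e'y Re'; split=> //.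
by rewrite (hphi y e') // mulf_neq0 // invr_neq0.
Qed.

End Regular.

Arguments regular_const {k J T lift} lift_hom U c.

(** * Projectors with a prescribed row space *)

Section Idempotents.
Variables (F : fieldType) (m : nat).
Implicit Types M N V : 'M[F]_m.

Lemma idem_submxP M N : N *m N = N -> (M <= N)%MS -> M *m N = M.
Proof. by move=> hN /submxP[A ->]; rewrite -mulmxA hN. Qed.

Lemma pinvmx_idem V :
  let M := pinvmx V *m V in M *m M = M /\ (M == V)%MS.
Proof.
have h : V *m (pinvmx V *m V) = V by rewrite mulmxA mulmxKpV.
split; first by rewrite -mulmxA h.
rewrite submxMl /=; rewrite -{1}h; exact: submxMl.
Qed.

(** Polynomial in M, this keeps the row space of an idempotent M and sends M to M0 as soon as the
    two row spaces agree; it is the map required by [lift_homogeneous]. *)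
Definition idem_move M0 M := M + (1%:M - M) *m M0 *m M.

Lemma idem_move_idem M0 M V : M *m M = M -> (M == V)%MS ->
  let M' := idem_move M0 M in M' *m M' = M' /\ (M' == V)%MS.
Proof.
move=> hM /andP[MV VM] M'.
have MM' : M *m M' = M.
  rewrite /M' /idem_move [LHS]mulmxDr hM !mulmxA mulmxBr mulmx1 hM subrr.
  by rewrite !mul0mx addr0.
have M'M : M' *m M = M'.
  by rewrite /M' /idem_move [LHS]mulmxDl -!mulmxA hM.
split; first by rewrite -{1}M'M -mulmxA MM'.
apply/andP; split; first by rewrite -M'M (submx_trans _ MV) // submxMl.
by rewrite (submx_trans VM) // -MM' submxMl.
Qed.

Lemma idem_move_to M0 M V : M0 *m M0 = M0 -> (M0 == V)%MS ->
  M *m M = M -> (M == V)%MS -> idem_move M0 M = M0.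
Proof.
move=> hM0 /andP[M0V VM0] hM /andP[MV VM].
have h1 : M0 *m M = M0 by apply: idem_submxP => //; apply: submx_trans M0V VM.
have h2 : M *m M0 = M by apply: idem_submxP => //; apply: submx_trans MV VM0.
by rewrite /idem_move mulmxBl mul1mx h2 mulmxBl h1 hM addrC subrK.
Qed.

(** For idempotents, both this matrix and [slice_conj] are the identity at M = M0. [slice_chg]
    carries the row space of M0 into that of M and fixes the row space of 1 - M0; [slice_conj]
    intertwines M and M0, so its invertibility forces equal ranks. *)
Definition slice_chg M0 M := M0 *m M + (1%:M - M0).
Definition slice_conj M0 M := M0 *m M + (1%:M - M0) *m (1%:M - M).
Definition slice_proj M0 M := invmx (slice_chg M0 M) *m M0 *m M.

(* [slice_proj M0 M] is the projector onto the row space of M along the kernel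
   of M0, so it depends only on the row space of M. *)
Lemma slice_projP M0 M V : M0 *m M0 = M0 -> M *m M = M -> (M == V)%MS ->
  slice_chg M0 M \in unitmx -> slice_conj M0 M \in unitmx ->
  let M' := slice_proj M0 M in
  [/\ M' *m M' = M', (M' == V)%MS, M' *m M0 = M0 & M0 *m M' = M'].
Proof.
move=> hM0 hM /andP[MV VM] uG uC M'.
set G := slice_chg M0 M in uG M' *.
have M0G : M0 *m G = M0 *m M.
  by rewrite /G /slice_chg mulmxDr mulmxBr mulmx1 mulmxA hM0 subrr addr0.
have GM' : G *m M' = M0 *m M by rewrite /M' /slice_proj -mulmxA mulKVmx.
have M'E : M' = invmx G *m (M0 *m G) by rewrite M0G /M' /slice_proj mulmxA.
have id' : M' *m M' = M'.
  rewrite {1 2}M'E -!mulmxA mulKVmx // (mulmxA M0 M0) hM0.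
  by rewrite M'E.
have sub : (M' <= M)%MS by rewrite /M' /slice_proj submxMl.
have rk : (\rank M' = \rank M0)%N.
  rewrite M'E mulmxA mxrankMfree ?row_free_unit //.
  by rewrite eqmxMfull // row_full_unit unitmx_inv.
have rk0 : (\rank M = \rank M0)%N.
  set C := slice_conj M0 M in uC.
  have CM : C *m M = M0 *m C.
    have h0 : (1%:M - M) *m M = 0 by rewrite mulmxBl mul1mx hM subrr.
    have h1 : M0 *m (1%:M - M0) = 0 by rewrite mulmxBr mulmx1 hM0 subrr.
    rewrite /C /slice_conj mulmxDl -!mulmxA h0 hM mulmx0 addr0.
    by rewrite mulmxDr !mulmxA hM0 h1 mul0mx addr0.
  have fC : row_full C by rewrite row_full_unit.
  by rewrite -[LHS](eqmxMfull M fC) CM mxrankMfree ?row_free_unit.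
have eqM : (M <= M')%MS by rewrite -(geq_leqif (mxrank_leqif_sup sub)) rk rk0.
have G1 : (1%:M - M0) *m G = 1%:M - M0.
  have h0 : (1%:M - M0) *m M0 = 0 by rewrite mulmxBl mul1mx hM0 subrr.
  by rewrite /G /slice_chg mulmxDr mulmxA h0 mul0mx add0r mulmxBr mulmx1 h0 subr0.
have G2 : (1%:M - M0) *m invmx G = 1%:M - M0.
  by rewrite -{1}G1 -mulmxA mulmxV // mulmx1.
split=> //.
- by rewrite (submx_trans sub MV) (submx_trans VM eqM).
- have GM0 : G *m M0 = M0 *m M *m M0.
    by rewrite /G /slice_chg mulmxDl mulmxBl mul1mx hM0 subrr addr0.
  by rewrite /M' /slice_proj -/G -!mulmxA (mulmxA M0) -GM0 mulKmx.
- apply/eqP; rewrite eq_sym -subr_eq0 -{1}[M']mul1mx -mulmxBl.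
  by rewrite /M' /slice_proj -/G !mulmxA G2 mulmxBl mul1mx hM0 subrr mul0mx.
Qed.

Lemma slice_proj_uniq M0 M1 M2 V : M1 *m M1 = M1 ->
  (M1 == V)%MS -> (M2 == V)%MS -> M2 *m M0 = M0 -> M0 *m M1 = M1 -> M1 = M2.
Proof.
move=> h1 /andP[_ VM1] /andP[M2V _] h2 h01.
have <- : M2 *m M1 = M2 by apply: idem_submxP => //; apply: submx_trans M2V VM1.
by rewrite -{2}h01 mulmxA h2 h01.
Qed.

Lemma slice_chg_id M : M *m M = M -> slice_chg M M = 1%:M.
Proof. by move=> h; rewrite /slice_chg h addrC subrK. Qed.

Lemma slice_conj_id M : M *m M = M -> slice_conj M M = 1%:M.
Proof.
move=> h; rewrite /slice_conj h mulmxBr mulmx1 mulmxBl mul1mx h subrr subr0.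
by rewrite addrC subrK.
Qed.

End Idempotents.

Section LocalSection.
Variables (k : closedFieldType) (n d : nat) (B : 'M[k]_(odim d)).

Local Notation pt := (flag n B * flag n B)%type.
Local Notation coord := (coordXX n d).
Local Notation lift := (@liftXX k n d B).
Local Notation lift1 := (@liftXX1 k n d B).

Definition cmx (e : coord -> k) (b : bool) i : 'M[k]_(odim d) :=
  \matrix_(s, t) e (b, i, s, t).

Definition uncmx (M : bool -> 'I_(odim n).+1 -> 'M[k]_(odim d)) : coord -> k :=
  fun j => M j.1.1.1 j.1.1.2 j.1.2 j.2.

Lemma uncmxK M b i : cmx (uncmx M) b i = M b i.
Proof. by apply/matrixP => s t; rewrite mxE. Qed.

Lemma cmxK e : uncmx (cmx e) = e.
Proof. by apply: funext => -[[[b i] s] t]; rewrite /uncmx mxE. Qed.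

Lemma liftXX_uncmx M (x : pt) : lift (uncmx M) x <-> forall b i,
  M b i *m M b i = M b i /\ (M b i == val (if b then x.2 else x.1) i)%MS.
Proof.
split=> h b i; have := h b i; first by rewrite /= -/(cmx _ b i) uncmxK.
by rewrite /= -/(cmx _ b i) uncmxK.
Qed.

Lemma polyfun_cmx b i s t : polyfun (fun e => cmx e b i s t).
Proof. by apply: polyfun_ext (Pf_coord k (b, i, s, t)) => e; rewrite mxE. Qed.

Lemma polyfun_slice_chg M0 b i s t :
  polyfun (fun e => slice_chg M0 (cmx e b i) s t).
Proof.
apply: polyfun_addmx; last exact: polyfun_cstmx.
by apply: polyfun_mulmx; [exact: polyfun_cstmx|exact: polyfun_cmx].
Qed.

Lemma polyfun_slice_conj M0 b i s t :
  polyfun (fun e => slice_conj M0 (cmx e b i) s t).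
Proof.
apply: polyfun_addmx.
  by apply: polyfun_mulmx; [exact: polyfun_cstmx|exact: polyfun_cmx].
apply: polyfun_mulmx; first exact: polyfun_cstmx.
apply: polyfun_addmx; first exact: polyfun_cstmx.
by apply: polyfun_oppmx; exact: polyfun_cmx.
Qed.

Lemma liftXX_homogeneous : lift_homogeneous lift.
Proof.
split=> [x|e e0 x ex e0x].
  exists (uncmx (fun b i => pinvmx (val (if b then x.2 else x.1) i)
                              *m val (if b then x.2 else x.1) i)).
  by apply/liftXX_uncmx => b i; apply: pinvmx_idem.
exists (fun e' => uncmx (fun b i => idem_move (cmx e0 b i) (cmx e' b i))).
split.
- move=> [[[b i] s] t]; rewrite /uncmx /=.
  apply: polyfun_addmx; first exact: polyfun_cmx.
  apply: polyfun_mulmx; last exact: polyfun_cmx.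
  apply: polyfun_mulmx; last exact: polyfun_cstmx.
  apply: polyfun_addmx; first exact: polyfun_cstmx.
  by apply: polyfun_oppmx; exact: polyfun_cmx.
- move=> e' y e'y; apply/liftXX_uncmx => b i.
  by have [h1 h2] := e'y b i; apply: idem_move_idem.
- rewrite -[RHS]cmxK; congr uncmx; apply: funext => b; apply: funext => i.
  have [h1 h2] := ex b i; have [h3 h4] := e0x b i.
  exact: idem_move_to h4 h1 h2.
Qed.

Lemma liftXX1_homogeneous : lift_homogeneous lift1.
Proof.
split=> [[x t]|e e0 [x t] [ex et] [e0x e0t]].
  have [e ex] := liftXX_homogeneous.1 x.
  by exists (fun j => if j is Some j' then e j' else t).
have [tau [h1 h2 h3]] := liftXX_homogeneous.2 _ _ _ ex e0x.
exists (fun e' j => if j is Some j' then tau (fun i => e' (Some i)) j'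
                    else e' None); split.
- move=> [j|]; last exact: Pf_coord.
  apply: polyfun_subst (h1 j) => i; exact: Pf_coord.
- by move=> e' [y s] [e'y e's]; split=> //; apply: h2.
- by apply: funext => -[j|]; [rewrite h3|rewrite et e0t].
Qed.

(** A lift of x0 fixes a complement to each member of the flags. The projectors along these
    complements depend only on the point, not on its lift, and are defined where the determinants in
    [delta] do not vanish. *)
Lemma local_section (x0 : pt) :
  exists (W : pt -> Prop) (sec : pt -> coord -> k),
    [/\ zopen lift W, W x0, forall x, W x -> lift (sec x) x &
        forall j, regular_on lift W (fun x => sec x j)].
Proof.
have [e0 e0x] := liftXX_homogeneous.1 x0.
pose delta (e : coord -> k) := \prod_(p : bool * 'I_(odim n).+1)
  (\det (slice_chg (cmx e0 p.1 p.2) (cmx e p.1 p.2)) *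
   \det (slice_conj (cmx e0 p.1 p.2) (cmx e p.1 p.2))).
have pdelta : polyfun delta.
  apply: polyfun_prod => p; apply: Pf_mul; apply: polyfun_det => i j.
    exact: polyfun_slice_chg.
  exact: polyfun_slice_conj.
have deltaP e b i : delta e != 0 ->
    slice_chg (cmx e0 b i) (cmx e b i) \in unitmx /\
    slice_conj (cmx e0 b i) (cmx e b i) \in unitmx.
  move=> /prodf_neq0/(_ (b, i) isT); rewrite mulf_eq0 negb_or /=.
  by rewrite !unitmxE !unitfE => /andP[].
pose proj e := uncmx (fun b i => slice_proj (cmx e0 b i) (cmx e b i)).
pose W x := exists2 e, lift e x & delta e != 0.
have ex1 x : exists e, W x -> lift e x /\ delta e != 0.
  have [[e h1 h2]|nW] := pselect (W x); first by exists e.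
  by exists e0.
pose sec x := proj (projT1 (cid (ex1 x))).
have secP x : W x -> exists e, [/\ lift e x, delta e != 0 & sec x = proj e].
  move=> Wx; rewrite /sec; case: cid => e /= h; have [h1 h2] := h Wx.
  by exists e.
have secE x e : lift e x -> delta e != 0 -> sec x = proj e.
  move=> ex de; have [e1 [e1x de1 ->]] : exists e, [/\ lift e x, delta e != 0
    & sec x = proj e] by apply: secP; exists e.
  congr uncmx; apply: funext => b; apply: funext => i.
  have [h1 h2] := ex b i; have [h3 h4] := e1x b i; have [h5 _] := e0x b i.
  have [u1 u2] := deltaP e b i de; have [u3 u4] := deltaP e1 b i de1.
  have [a1 a2 a3 a4] := slice_projP h5 h1 h2 u1 u2.
  have [b1 b2 b3 b4] := slice_projP h5 h3 h4 u3 u4.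
  exact: slice_proj_uniq b1 b2 a2 a3 b4.
exists W, sec; split.
- apply/zopenP => x e Wx ex; have [e1 e1x de1] := Wx.
  have [tau [h1 h2 h3]] := liftXX_homogeneous.2 _ _ _ ex e1x.
  exists (fun e => delta (tau e)); split.
  + exact: polyfun_subst h1 pdelta.
  + by rewrite h3.
  + by move=> y e' e'y nz; exists (tau e') => //; apply: h2.
- exists e0 => //; apply/prodf_neq0 => -[b i] _ /=.
  have [h _] := e0x b i; rewrite slice_chg_id // slice_conj_id //.
  by rewrite det1 mulr1 oner_neq0.
- move=> x /secP[e [ex de ->]]; apply/liftXX_uncmx => b i.
  have [h1 h2] := ex b i; have [h5 _] := e0x b i.
  have [u1 u2] := deltaP e b i de.
  by have [] := slice_projP h5 h1 h2 u1 u2.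
- move=> [[[b i] s] t] x Wx; have [e ex de] := Wx.
  pose D e := \det (slice_chg (cmx e0 b i) (cmx e b i)).
  pose N e := (\adj (slice_chg (cmx e0 b i) (cmx e b i)) *m cmx e0 b i
                 *m cmx e b i) s t.
  have D0 e' : delta e' != 0 -> D e' != 0.
    by move=> /(deltaP e' b i)[]; rewrite unitmxE unitfE.
  (* Cramer's rule gives the entry as N / D. The common factor [delta] confines the formula to lifts
     at which the section is computed by [proj]. *)
  exists e, (fun e => N e * delta e), (fun e => D e * delta e); split=> //.
  + apply: Pf_mul => //; apply: polyfun_mulmx; last exact: polyfun_cmx.
    apply: polyfun_mulmx; last exact: polyfun_cstmx.
    by apply: polyfun_adj => *; apply: polyfun_slice_chg.
  + apply: Pf_mul => //; apply: polyfun_det => *; exact: polyfun_slice_chg.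
  + by rewrite mulf_neq0 // D0.
  + move=> y e' Wy e'y; rewrite mulf_eq0 negb_or => /andP[De' de'].
    rewrite (secE y e') // -mulf_div divff // mulr1.
    have [u1 _] := deltaP e' b i de'.
    rewrite /proj /uncmx /= /slice_proj /invmx u1 -!scalemxAl mxE mulrC.
    by rewrite /N.
Qed.

End LocalSection.

(** * Polynomials with regular coefficients over an open subset of X x X *)

Section Families.
Variables (k : closedFieldType) (n d : nat) (B : 'M[k]_(odim d)).

Local Notation pt := (flag n B * flag n B)%type.
Local Notation lift := (@liftXX k n d B).
Local Notation lift1 := (@liftXX1 k n d B).
Local Notation lh := (@liftXX_homogeneous k n d B).
Local Notation lh1 := (@liftXX1_homogeneous k n d B).
Local Notation family := (@poly_family k n d B).
Implicit Types (W : pt -> Prop) (V : pt * k -> Prop).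

Lemma regular_pullback W V (phi : pt -> k) :
  (forall x t, V (x, t) -> W x) ->
  regular_on lift W phi -> regular_on lift1 V (fun z => phi z.1).
Proof.
move=> VW reg [x t] /VW Wx; have [e [ex et]] := lh1.1 (x, t).
have [P [Q [hP hQ Qe hphi]]] := regular_onE lh reg Wx ex.
exists e, (fun e => P (fun j => e (Some j))), (fun e => Q (fun j => e (Some j))).
split=> //.
- by apply: polyfun_subst hP => j; apply: Pf_coord.
- by apply: polyfun_subst hQ => j; apply: Pf_coord.
- by move=> [y s] e' /VW Wy [e'y e's]; apply: hphi.
Qed.

Lemma regular_snd V : regular_on lift1 V (fun z => z.2).
Proof.
move=> z Vz; have [e ez] := lh1.1 z.
exists e, (fun e => e None), (fun=> 1); split=> //.
- exact: Pf_coord.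
- exact: Pf_const.
- exact: oner_neq0.
- by move=> y e' _ [_ ->] _; rewrite divr1.
Qed.

Lemma family_ext W f g : (forall x, W x -> f x = g x) -> family W f -> family W g.
Proof.
move=> h [[m hm] hf]; split; first by exists m => x Wx; rewrite -h //; apply: hm.
by move=> j; apply: regular_ext (hf j) => x Wx; rewrite h.
Qed.

Lemma family_restrict W W' f : (forall x, W' x -> W x) -> family W f -> family W' f.
Proof.
move=> h [[m hm] hf]; split; first by exists m => x /h; apply: hm.
by move=> j; apply: regular_restrict (hf j).
Qed.

Lemma family_poly W m (c : nat -> pt -> k) :
  (forall i, regular_on lift W (c i)) ->
  family W (fun x => \poly_(i < m) c i x).
Proof.
move=> hc; split; first by exists m => x _; apply: size_poly.
move=> j; case: (ltnP j m) => hj.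
  by apply: regular_ext (hc j) => x _; rewrite coef_poly hj.
by apply: regular_ext (regular_const lh W 0) => x _; rewrite coef_poly ltnNge hj.
Qed.

Lemma family_scalar W (phi : pt -> k) :
  regular_on lift W phi -> family W (fun x => (phi x)%:P).
Proof.
move=> h; split; first by exists 1%N => x _; apply: size_polyC_leq1.
case=> [|j].
  by apply: regular_ext h => x _; rewrite coefC.
by apply: regular_ext (regular_const lh W 0) => x _; rewrite coefC.
Qed.

Lemma family_const W p : family W (fun=> p).
Proof.
by split=> [|j]; [exists (size p)|apply: regular_const; apply: lh].
Qed.

Lemma family_add W f g :
  family W f -> family W g -> family W (fun x => f x + g x).
Proof.
move=> [[m hm] hf] [[m' hm'] hg]; split.
  exists (maxn m m') => x Wx; apply: leq_trans (size_polyD _ _) _.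
  by rewrite geq_max !leq_max hm // hm' // orbT.
by move=> j; apply: regular_ext (regular_add lh (hf j) (hg j)) => x _; rewrite coefD.
Qed.

Lemma family_mul W f g :
  family W f -> family W g -> family W (fun x => f x * g x).
Proof.
move=> [[m hm] hf] [[m' hm'] hg]; split.
  exists (m + m')%N => x Wx; apply: leq_trans (size_polyMleq _ _) _.
  by apply: leq_trans (leq_pred _) _; rewrite leq_add ?hm ?hm'.
move=> j; apply: (@regular_ext _ _ _ _ _
    (fun x => \sum_(i < j.+1) (f x)`_i * (g x)`_(j - i))).
  by move=> x _; rewrite coefM.
by apply: regular_sum => [|i]; [apply: lh|apply: regular_mul; [apply: lh|..]].
Qed.

Lemma family_sum (I : Type) (r : seq I) (p : pred I) W (f : I -> pt -> {poly k}) :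
  (forall i, family W (f i)) -> family W (fun x => \sum_(i <- r | p i) f i x).
Proof.
move=> h; elim: r => [|i r IHr].
  by apply: family_ext (family_const W 0) => x _; rewrite big_nil.
case hi: (p i).
  by apply: family_ext (family_add (h i) IHr) => x _; rewrite big_cons hi.
by apply: family_ext IHr => x _; rewrite big_cons hi.
Qed.

Lemma family_prod (I : Type) (r : seq I) (p : pred I) W (f : I -> pt -> {poly k}) :
  (forall i, family W (f i)) -> family W (fun x => \prod_(i <- r | p i) f i x).
Proof.
move=> h; elim: r => [|i r IHr].
  by apply: family_ext (family_const W 1) => x _; rewrite big_nil.
case hi: (p i).
  by apply: family_ext (family_mul (h i) IHr) => x _; rewrite big_cons hi.
by apply: family_ext IHr => x _; rewrite big_cons hi.
Qed.

Lemma family_exp W f m : family W f -> family W (fun x => f x ^+ m).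
Proof.
move=> h; elim: m => [|m IH].
  by apply: family_ext (family_const W 1) => x _; rewrite expr0.
by apply: family_ext (family_mul h IH) => x _; rewrite exprS.
Qed.

Lemma family_deriv W f : family W f -> family W (fun x => (f x)^`()).
Proof.
move=> [[m hm] hf]; split.
  exists m => x Wx; apply: leq_trans (size_poly _ _) _.
  by apply: leq_trans (leq_pred _) _; apply: hm.
move=> j; apply: (@regular_ext _ _ _ _ _ (fun x => j.+1%:R * (f x)`_j.+1)).
  by move=> x _; rewrite coef_deriv mulr_natl.
by apply: regular_mul; [apply: lh|apply: regular_const; apply: lh|].
Qed.

Lemma family_comp W f g :
  family W f -> family W g -> family W (fun x => f x \Po g x).
Proof.
move=> [[m hm] hf] hg.
apply: (@family_ext _ (fun x => \sum_(i < m) ((f x)`_i)%:P * g x ^+ i)).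
  move=> x Wx; rewrite /comp_poly (@horner_coef_wide _ m).
    by apply: eq_bigr => i _; rewrite coef_map.
  by rewrite size_map_polyC hm.
apply: family_sum => i; apply: family_mul; last exact: family_exp.
exact: family_scalar.
Qed.

Lemma family_det W m (M : pt -> 'M[{poly k}]_m) :
  (forall i j, family W (fun x => M x i j)) -> family W (fun x => \det (M x)).
Proof.
move=> h; apply: family_sum => s; apply: family_mul; first exact: family_const.
exact: family_prod.
Qed.

Lemma family_adj W m (M : pt -> 'M[{poly k}]_m) :
  (forall i j, family W (fun x => M x i j)) ->
  forall i j, family W (fun x => (\adj (M x)) i j).
Proof.
move=> h i j; apply: (@family_ext _ (fun x => cofactor (M x) j i)).
  by move=> x _; rewrite mxE.
apply: family_mul; first exact: family_const.
apply: family_det => s t.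
by apply: family_ext (h (fintype.lift j s) (fintype.lift i t)) => x _; rewrite !mxE.
Qed.

Lemma family_mulmx W m p q (M : pt -> 'M[{poly k}]_(m, p))
    (N : pt -> 'M[{poly k}]_(p, q)) :
  (forall i j, family W (fun x => M x i j)) ->
  (forall i j, family W (fun x => N x i j)) ->
  forall i j, family W (fun x => (M x *m N x) i j).
Proof.
move=> hM hN i j; apply: (@family_ext _ (fun x => \sum_s M x i s * N x s j)).
  by move=> x _; rewrite mxE.
by apply: family_sum => s; apply: family_mul.
Qed.

Lemma regular_horner W V f (phi : pt * k -> k) :
  (forall x t, V (x, t) -> W x) -> family W f -> regular_on lift1 V phi ->
  regular_on lift1 V (fun z => (f z.1).[phi z]).
Proof.
move=> VW [[m hm] hf] hphi.
apply: (@regular_ext _ _ _ _ _ (fun z => \sum_(i < m) (f z.1)`_i * phi z ^+ i)).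
  by move=> [x t] Vz; rewrite (@horner_coef_wide _ m) //; apply/hm/(VW x t).
apply: regular_sum; first exact: lh1.
move=> i; apply: regular_mul; [exact: lh1| |by apply: regular_exp; first exact: lh1].
exact: regular_pullback VW (hf i).
Qed.

(* Composition with a local section of Jouanolou's affine bundle turns a
   polynomial function on the bundle into a polynomial family. *)
Lemma regular_explicit V (phi : pt * k -> k) x0 u :
  regular_on lift1 V phi -> V (x0, u) ->
  exists W p q, [/\ zopen lift W /\ W x0, family W p, family W q,
    (q x0).[u] != 0 & forall x t, V (x, t) -> W x -> (q x).[t] != 0 ->
                        phi (x, t) = (p x).[t] / (q x).[t]].
Proof.
move=> reg V0; have [W [sec [oW Wx0 secP rsec]]] := local_section x0.
pose sec1 x t (j : option (coordXX n d)) := if j is Some j' then sec x j' else t.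
have sec1P x t : W x -> lift1 (sec1 x t) (x, t) by move=> Wx; split=> //; apply: secP.
have [P [Q [hP hQ Q0 hphi]]] := regular_onE lh1 reg V0 (sec1P x0 u Wx0).
have fam R : polyfun R ->
    exists2 p, family W p & forall x t, R (sec1 x t) = (p x).[t].
  elim=> [c|[j|]|P1 P2 _ [p1 f1 h1] _ [p2 f2 h2]|P1 P2 _ [p1 f1 h1] _ [p2 f2 h2]].
  - by exists (fun=> c%:P) => [|x t]; [exact: family_const|rewrite hornerC].
  - exists (fun x => (sec x j)%:P) => [|x t]; first exact: family_scalar.
    by rewrite hornerC.
  - by exists (fun=> 'X) => [|x t]; [exact: family_const|rewrite hornerX].
  - exists (fun x => p1 x + p2 x) => [|x t]; first exact: family_add.
    by rewrite h1 h2 hornerD.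
  - exists (fun x => p1 x * p2 x) => [|x t]; first exact: family_mul.
    by rewrite h1 h2 hornerM.
have [p fp hp] := fam P hP; have [q fq hq] := fam Q hQ.
exists W, p, q; split=> //; first by rewrite -hq.
move=> x t Vz Wx qt; rewrite -hp -hq; apply: hphi => //; first exact: sec1P.
by rewrite hq.
Qed.

End Families.

(** * Etale neighbourhoods *)

Section Etale.
Variables (k : closedFieldType) (n d : nat) (B : 'M[k]_(odim d)).

Local Notation pt := (flag n B * flag n B)%type.
Local Notation lift := (@liftXX k n d B).
Local Notation lift1 := (@liftXX1 k n d B).
Local Notation lh := (@liftXX_homogeneous k n d B).
Local Notation lh1 := (@liftXX1_homogeneous k n d B).
Local Notation family := (@poly_family k n d B).
Local Notation etale := (@etale k n d B).
Implicit Types (W : pt -> Prop) (U V : etale).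

Lemma polyfun_subst_frac (J : Type) (R : (option J -> k) -> k)
    (P Q : (option J -> k) -> k) :
  polyfun R -> polyfun P -> polyfun Q ->
  exists R' m, polyfun R' /\ forall e, Q e != 0 ->
    R (fun j => if j is Some _ then e j else P e / Q e) = R' e / Q e ^+ m.
Proof.
move=> hR hP hQ; elim: hR => [c|[j|]|R1 R2 _ [R1' [m1 [h1 e1]]] _ [R2' [m2 [h2 e2]]]
    |R1 R2 _ [R1' [m1 [h1 e1]]] _ [R2' [m2 [h2 e2]]]].
- exists (fun=> c), 0%N; split=> [|e _]; first exact: Pf_const.
  by rewrite expr0 divr1.
- exists (fun e => e (Some j)), 0%N; split=> [|e _]; first exact: Pf_coord.
  by rewrite expr0 divr1.
- by exists P, 1%N; split=> // e _; rewrite expr1.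
- have pQ m : polyfun (fun e => Q e ^+ m).
    elim: m => [|m IH]; first by apply: polyfun_ext (Pf_const _ 1).
    by apply: polyfun_ext (Pf_mul hQ IH) => e; rewrite exprS.
  exists (fun e => R1' e * Q e ^+ m2 + R2' e * Q e ^+ m1), (m1 + m2)%N; split.
    by apply: Pf_add; apply: Pf_mul.
  by move=> e Qe; rewrite e1 // e2 // exprD addf_div // expf_neq0.
- exists (fun e => R1' e * R2' e), (m1 + m2)%N; split; first exact: Pf_mul.
  by move=> e Qe; rewrite e1 // e2 // exprD mulf_div.
Qed.

Lemma regular_comp (V U : pt * k -> Prop) (phi psi : pt * k -> k) :
  regular_on lift1 V phi -> regular_on lift1 U psi ->
  (forall x t, V (x, t) -> U (x, phi (x, t))) ->
  regular_on lift1 V (fun z => psi (z.1, phi z)).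
Proof.
move=> rphi rpsi VU [x t] Vz; have [e [ex et]] := lh1.1 (x, t).
have [P [Q [hP hQ Qe hphi]]] := regular_onE lh1 rphi Vz (conj ex et).
pose sub e' (j : option (coordXX n d)) := if j is Some _ then e' j else P e' / Q e'.
have subP y s e' : V (y, s) -> lift1 e' (y, s) -> Q e' != 0 ->
    lift1 (sub e') (y, phi (y, s)).
  by move=> Vy e'y Qe'; split; [case: e'y|rewrite /= -(hphi (y, s))].
have [P2 [Q2 [hP2 hQ2 Q2e hpsi]]] :=
  regular_onE lh1 rpsi (VU _ _ Vz) (subP _ _ _ Vz (conj ex et) Qe).
have [P3 [m [hP3 P3E]]] := polyfun_subst_frac hP2 hP hQ.
have [Q3 [l [hQ3 Q3E]]] := polyfun_subst_frac hQ2 hP hQ.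
have pQ i : polyfun (fun e => Q e ^+ i).
  elim: i => [|i IH]; first by apply: polyfun_ext (Pf_const _ 1).
  by apply: polyfun_ext (Pf_mul hQ IH) => e'; rewrite exprS.
exists e, (fun e => P3 e * Q e ^+ l.+1), (fun e => Q3 e * Q e ^+ m.+1).
split=> //; try exact: Pf_mul.
  rewrite mulf_neq0 ?expf_neq0 //; apply: contraNneq Q2e => Q3e.
  by rewrite /sub Q3E // Q3e mul0r.
move=> [y s] e' Vy e'y; rewrite mulf_eq0 negb_or => /andP[Q3e'].
rewrite expf_eq0 /= => Qe' /=.
have Q2e' : Q2 (sub e') != 0 by rewrite /sub Q3E // mulf_neq0 // invr_neq0 // expf_neq0.
rewrite (hpsi (y, phi (y, s)) (sub e')) //; [|exact: VU|exact: subP].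
rewrite /sub P3E // Q3E // invf_div mulf_div !exprSr !mulrA.
by rewrite -[RHS]mulf_div divff // mulr1 [Q e' ^+ m * _]mulrC.
Qed.

Lemma et_hom_comp (U V V' : etale) (f : et_hom U V) (g : et_hom V V') :
  exists h : et_hom U V', forall x t, h (x, t) = g (x, f (x, t)).
Proof.
have reg := regular_comp (et_reg f) (et_reg g) (et_maps f).
have maps x t : U (x, t) -> V' (x, g (x, f (x, t))).
  by move=> /(et_maps f) /(et_maps g).
by exists (EtHom reg maps).
Qed.

Lemma etale_incl (U V : etale) : (forall z, V z -> U z) ->
  exists h : et_hom V U, forall x t, h (x, t) = t.
Proof.
move=> VU; have maps x t : V (x, t) -> U (x, (x, t).2) by move/VU.
by exists (EtHom (regular_snd (V := V)) maps).
Qed.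

(** The inequation h <> 0 is absorbed into g, so the result is again standard etale. *)
Lemma etale_restrict (U : etale) W h : zopen lift W -> family W h ->
  exists V : etale, forall x t, V (x, t) <-> [/\ U (x, t), W x & (h x).[t] != 0].
Proof.
case: U => U [W1 [f [g [o1 f1 g1 UE Uf]]]] oW fh /=.
have s : std_etale (fun z : pt * k => [/\ U z, W z.1 & (h z.1).[z.2] != 0]).
  exists (fun x => W1 x /\ W x), f, (fun x => g x * h x); split.
  - exact: zopen_and.
  - by apply: family_restrict f1 => x [].
  - by apply: family_mul; [apply: family_restrict g1|apply: family_restrict fh] => x [].
  - move=> x t /=; split=> [[/UE[W1x fx gx] Wx hx]|].
      by split=> //; rewrite rootM negb_or gx.
    move=> [[W1x Wx] fx]; rewrite rootM negb_or => /andP[gx hx].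
    by split=> //; apply/UE.
  - by move=> x t [/Uf].
by exists (Etale s).
Qed.

Lemma etale_nonzero (U : etale) (phi : pt * k -> k) x0 t0 :
  regular_on lift1 U phi -> U (x0, t0) -> phi (x0, t0) != 0 ->
  exists V : etale, V (x0, t0) /\ forall z, V z -> U z /\ phi z != 0.
Proof.
move=> reg U0 nz.
have [W [p [q [[oW Wx0] fp fq q0 E]]]] := regular_explicit reg U0.
have [V VE] := etale_restrict U oW (family_mul fp fq).
exists V; split.
  apply/VE; split=> //; rewrite hornerM mulf_neq0 //.
  by move: nz; rewrite E // mulf_eq0 negb_or => /andP[].
move=> [x t] /VE[Ux Wx]; rewrite hornerM mulf_eq0 negb_or => /andP[px qx].
by split=> //; rewrite E // mulf_neq0 // invr_neq0.
Qed.

(** Etale maps are unramified: f(a) - f(b) = (a - b) D, and D becomes f'(a) <> 0 at the given point.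
    Where D <> 0, two roots a and b of f must coincide. *)
Lemma et_equalizer (V U : etale) (a b : et_hom V U) x0 u :
  V (x0, u) -> a (x0, u) = b (x0, u) ->
  exists V' : etale, V' (x0, u) /\
    forall z, V' z -> V z /\ a z = b z.
Proof.
case: U a b => U sU a b V0 ab; have [W [f [g [oW ff fg UE Uf]]]] := sU.
have VW x t : V (x, t) -> W x by move=> /(et_maps a) /UE[].
have [m hm] := ff.1.
pose D z := \sum_(i < m) (f z.1)`_i * \sum_(j < i) a z ^+ (i.-1 - j) * b z ^+ j.
have rD : regular_on lift1 V D.
  apply: regular_sum => [|i]; first exact: lh1.
  apply: (regular_mul lh1); first exact: regular_pullback VW (ff.2 i).
  apply: regular_sum => [|j]; first exact: lh1.
  by apply: (regular_mul lh1); apply: (regular_exp lh1); apply: et_reg.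
have DE z : V z -> (f z.1).[a z] - (f z.1).[b z] = (a z - b z) * D z.
  case: z => x t Vz; rewrite !(@horner_coef_wide _ m) ?hm //; try exact: VW Vz.
  rewrite -sumrB mulr_sumr; apply: eq_bigr => i _.
  by rewrite -mulrBr subrXX mulrCA.
have D0 : D (x0, u) != 0.
  have := Uf _ _ (et_maps a V0); rewrite /root.
  congr (~~ (_ == _)); rewrite /D /= -ab.
  rewrite (@horner_coef_wide _ m); last first.
    apply: leq_trans (size_poly _ _) _; apply: leq_trans (leq_pred _) _.
    exact/hm/(VW _ _ V0).
  transitivity (\sum_(i < m) (f x0)`_i * (a (x0, u) ^+ i.-1 *+ i)); last first.
    apply: eq_bigr => i _; congr (_ * _).
    rewrite (eq_bigr (fun=> a (x0, u) ^+ i.-1)).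
      by rewrite sumr_const card_ord.
    by move=> j _; rewrite -exprD subnK // -ltnS (ltn_predK (ltn_ord j)).
  have sf : (size (f x0) <= m)%N by exact/hm/(VW _ _ V0).
  case: m sf {hm D rD DE} => [|m] sf; first by rewrite !big_ord0.
  rewrite big_ord_recr [RHS]big_ord_recl /= mulr0n mulr0 add0r coef_deriv.
  rewrite nth_default // mul0rn mul0r addr0.
  by apply: eq_bigr => i _; rewrite coef_deriv mulrnAl mulrnAr.
have [V' [V'0 V'P]] := etale_nonzero rD V0 D0.
exists V'; split=> // -[x t] /V'P[Vz Dz]; split=> //.
have /UE[_ /rootP fa _] := et_maps a Vz; have /UE[_ /rootP fb _] := et_maps b Vz.
have := DE _ Vz; rewrite /= fa fb subrr => /esym/eqP.
by rewrite mulf_eq0 (negbTE Dz) orbF subr_eq0 => /eqP.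
Qed.

End Etale.

(** * Derivative of a determinant, and eigenvalues read off an adjugate *)

Lemma deriv_prod (R : comNzRingType) (I : finType) (p : pred I) (F : I -> {poly R}) :
  (\prod_(i | p i) F i)^`() =
    \sum_(i | p i) (F i)^`() * \prod_(j | p j && (j != i)) F j.
Proof.
have [m] := ubnP #|p|; elim: m p => // m IH p pm.
case: (pickP p) => [i0 pi0|p0]; last by rewrite !big_pred0 // derivC.
rewrite (bigD1 i0) //= derivM [RHS](bigD1 i0) //=; congr (_ + _).
rewrite IH; last first.
  rewrite ltnS in pm; apply: leq_trans pm.
  rewrite [X in (_ < X)%N](cardD1 i0) -[i0 \in p]/(p i0) pi0 add1n ltnS.
  by apply/subset_leq_card/subsetP => j; rewrite !inE andbC.
rewrite mulr_sumr; apply: eq_bigr => i /andP[pi ni].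
rewrite mulrCA; congr (_ * _).
rewrite [RHS](bigD1 i0) ?pi0 1?eq_sym //=; congr (_ * _).
by apply: eq_bigl => j; rewrite -!andbA; congr (_ && _); rewrite andbC.
Qed.

(** Jacobi's formula: the derivative falls on one row at a time, and each resulting determinant is
    expanded along that row. *)
Lemma deriv_det (R : comNzRingType) (m : nat) (A : 'M[{poly R}]_m) :
  (\det A)^`() = \tr (\adj A *m map_mx (fun p => p^`()) A).
Proof.
pose Bm i : 'M[{poly R}]_m := \matrix_(r, j) if r == i then (A r j)^`() else A r j.
transitivity (\sum_i \det (Bm i)).
  rewrite /(\det A) raddf_sum exchange_big /=; apply: eq_bigr => s _.
  transitivity ((-1) ^+ s * (\prod_i A i (s i))^`()).
    by case: (s : bool); rewrite ?expr1 ?expr0 ?mulN1r ?mul1r ?derivN.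
  rewrite deriv_prod mulr_sumr; apply: eq_bigr => i _; congr (_ * _).
  rewrite [RHS](bigD1 i) //= mxE eqxx; congr (_ * _).
  by apply: eq_bigr => j /negbTE nj; rewrite mxE nj.
rewrite /mxtrace.
transitivity (\sum_i \sum_j (A i j)^`() * cofactor A i j).
  apply: eq_bigr => i _; rewrite (expand_det_row _ i); apply: eq_bigr => j _.
  rewrite mxE eqxx; congr (_ * (_ * \det _)).
  by apply/matrixP => r c; rewrite !mxE eq_sym (negbTE (neq_lift _ _)).
rewrite exchange_big /=; apply: eq_bigr => j _; rewrite mxE; apply: eq_bigr => i _.
by rewrite !mxE mulrC.
Qed.

Lemma companion_char_poly (R : comNzRingType) (N : nat) (p : {poly R}) :
  size p = N.+2 -> p \is monic ->
  char_poly (\matrix_(i < N.+1, j < N.+1)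
    (if i == N :> nat then - p`_j else (i.+1 == j :> nat)%:R)) = p.
Proof.
by move=> sz /companionmxK; rewrite /companionmx sz.
Qed.

(** A nonzero adjugate of a singular matrix means corank one. The kernel line is stable under C by
    commutation and contains all rows of the adjugate, so C multiplies the adjugate by the
    eigenvalue a. Traces against D express a as a quotient, rational in the entries. *)
Lemma adj_eigenvector (F : fieldType) (N : nat) (Psi C D : 'M[F]_N.+1) :
  \det Psi = 0 -> Psi *m C = C *m Psi -> \tr (\adj Psi *m D) != 0 ->
  let a := \tr (\adj Psi *m C *m D) / \tr (\adj Psi *m D) in
  exists r : 'rV_N.+1, [/\ r != 0, r *m Psi = 0 & r *m C = a *: r].
Proof.
move=> det0 comm q0 a.
have adj0 : \adj Psi != 0 by apply: contraNneq q0 => ->; rewrite mul0mx mxtrace0.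
have /existsP[i /existsP[j cij]] : [exists i, exists j, cofactor Psi i j != 0].
  apply: contraNT adj0 => /existsPn h; apply/eqP/matrixP => i j; rewrite mxE [RHS]mxE.
  by apply/eqP; have /existsPn/(_ i) := h j; rewrite negbK.
have rk : (N <= \rank Psi)%N.
  have u : row' i (col' j Psi) \in unitmx.
    by rewrite unitmxE unitfE; apply: contraNneq cij; rewrite /cofactor => ->; rewrite mulr0.
  rewrite -[X in (X <= _)%N](mxrank_unit u).
  rewrite row'Esub; apply: leq_trans (mxrankS (rowsub_sub _ _)) _.
  rewrite -mxrank_tr -[X in (_ <= X)%N]mxrank_tr tr_col' row'Esub.
  exact: mxrankS (rowsub_sub _ _).
have adjK : (\adj Psi <= kermx Psi)%MS.
  by apply/sub_kermxP; rewrite mul_adj_mx det0 raddf0.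
have [l rl] : exists l, row l (\adj Psi) != 0.
  by apply/existsP; apply: contraNT adj0 => /existsPn h; apply/eqP/row_matrixP => l;
     rewrite row0; apply/eqP; have := h l; rewrite negbK.
set r := row l (\adj Psi) in rl.
have rK : (r <= kermx Psi)%MS := submx_trans (row_sub _ _) adjK.
have Kr : (kermx Psi <= r)%MS.
  rewrite -(geq_leqif (mxrank_leqif_sup rK)) mxrank_ker rank_rV rl.
  by rewrite leq_subLR addn1 ltnS.
have rPsi : r *m Psi = 0 by apply/sub_kermxP.
have /sub_rVP[b rC] : (r *m C <= r)%MS.
  apply: submx_trans Kr; apply/sub_kermxP.
  by rewrite -mulmxA -comm mulmxA rPsi mul0mx.
have /submxP[c adjE] := submx_trans adjK Kr.
exists r; split=> //; rewrite rC; congr (_ *: _); rewrite /a adjE.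
rewrite -(mulmxA c r C) rC -scalemxAr -scalemxAl mxtraceZ -adjE mulfK //.
Qed.

(** * Common refinements of two etale neighbourhoods *)

Section Merge.
Variables (k : closedFieldType) (n d : nat) (B : 'M[k]_(odim d)).

Local Notation pt := (flag n B * flag n B)%type.
Local Notation lift := (@liftXX k n d B).
Local Notation lift1 := (@liftXX1 k n d B).
Local Notation lh := (@liftXX_homogeneous k n d B).
Local Notation lh1 := (@liftXX1_homogeneous k n d B).
Local Notation family := (@poly_family k n d B).
Local Notation etale := (@etale k n d B).
Implicit Types (W : pt -> Prop) (U V : etale).

(* Near x0 the sheet through (x0, t0) is t = t0 + s x * Y, Y a root of a
   polynomial that specializes to 1 - Y at x0. *)
Lemma etale_normal_form U x0 t0 : U (x0, t0) ->
  exists W (s : pt -> k) (h g : pt -> {poly k}),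
    [/\ [/\ zopen lift W, W x0, regular_on lift W s & s x0 = 0],
        [/\ family W h, h x0 = 1 - 'X & forall x, W x -> (h x)`_0 = 1],
        family W g /\ ~~ root (g x0) 1 &
        forall x Y, W x -> root (h x) Y -> ~~ root (g x) Y ->
          U (x, t0 + s x * Y)].
Proof.
case: U => U [W [f [g [oW ff fg UE Uf]]]] /= U0.
have /UE[W0 f0 g0] := U0.
pose F x := f x \Po ('X + t0%:P).
have fF : family W F by apply: family_comp => //; exact: family_const.
have [m hm] := fF.1.
have a0 : (F x0)`_0 = 0.
  by rewrite -horner_coef0 horner_comp !hornerE; apply/rootP.
have a1 : (F x0)`_1 != 0.
  have -> : (F x0)`_1 = (F x0)^`()`_0 by rewrite coef_deriv.
  rewrite -horner_coef0 deriv_comp derivD derivX derivC addr0 mulr1 horner_comp.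
  by rewrite !hornerE; exact: Uf U0.
pose W' x := W x /\ (F x)`_1 != 0.
have W'W x : W' x -> W x by case.
have rF i : regular_on lift W' (fun x => (F x)`_i).
  exact: regular_restrict W'W (fF.2 i).
have rV : regular_on lift W' (fun x => ((F x)`_1)^-1).
  by apply: (regular_inv lh) => // x [].
pose s x := - ((F x)`_0 * ((F x)`_1)^-1).
have rs : regular_on lift W' s.
  by apply: (regular_opp lh); apply: (regular_mul lh).
pose c i x := if i is i'.+2 then - ((F x)`_i'.+2 * ((F x)`_1)^-1 * s x ^+ i'.+1)
              else (-1) ^+ i.
have rc i : regular_on lift W' (c i).
  case: i => [|[|i]]; try exact: (regular_const lh).
  apply: (regular_opp lh); apply: (regular_mul lh); last exact: (regular_exp lh).
  exact: (regular_mul lh).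
have s0 : s x0 = 0 by rewrite /s a0 mul0r oppr0.
pose h x := \poly_(i < m.+2) c i x.
have fh : family W' h by apply: family_poly.
have oW' : zopen lift W' by apply: (zopen_nonzero lh) => //; exact: fF.2.
exists W', s, h, (fun x => g x \Po ('X * (s x)%:P + t0%:P)); split.
- by split.
- split=> //; last by move=> x _; rewrite coef_poly /c expr0.
  apply/polyP => -[|[|i]]; rewrite coef_poly coefB coef1 coefX /= ?mulr0n ?mulr1n.
  + by rewrite expr0 subr0.
  + by rewrite expr1 sub0r.
  + by rewrite s0 expr0n /= mulr0 oppr0 if_same ?subr0 ?addr0.
- split.
    apply: family_comp; first exact: family_restrict W'W fg.
    apply: family_add; last exact: family_const.
    by apply: family_mul; [exact: family_const|exact: family_scalar].
  by rewrite /root horner_comp !hornerE s0 ?mulr0 ?mul1r add0r.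
- move=> x Y W'x /rootP hY; rewrite /root horner_comp !hornerE => gY.
  have Wx := W'W x W'x; apply/UE; split=> //; last first.
    by rewrite /root addrC [s x * Y]mulrC.
  have -> : root (f x) (t0 + s x * Y) = root (F x) (s x * Y).
    by rewrite /root horner_comp !hornerE addrC.
  have nz := W'x.2.
  have a0E : (F x)`_0 = - ((F x)`_1 * s x).
    by rewrite /s mulrN opprK mulrCA divff // mulr1.
  apply/rootP; transitivity (- ((F x)`_1 * s x * (h x).[Y])); last first.
    by rewrite hY mulr0 oppr0.
  rewrite (@horner_coef_wide _ m.+2); last by rewrite !leqW // hm.
  rewrite horner_poly !big_ord_recl !mulrDr !opprD; congr (_ + (_ + _)).
  + by rewrite a0E /= !expr0 !mulr1.
  + by rewrite !lift0 /= !expr1 mulN1r [_ * - Y]mulrN opprK mulrA.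
  + rewrite mulr_sumr -sumrN; apply: eq_bigr => i _.
    rewrite !lift0 /= -mulrN -mulNr opprK exprMn [LHS]mulrA [RHS]mulrA; congr (_ * _).
    rewrite [s x ^+ i.+2]exprS; move: (s x) (_ ^+ i.+1) (_`_i.+2) (_`_1) nz.
    by move=> a b c' e e0; field.
Qed.

Lemma regular_exp_mx W N (M : pt -> 'M[k]_N.+1) l :
  (forall i j, regular_on lift W (fun x => M x i j)) ->
  forall i j, regular_on lift W (fun x => (M x ^+ l) i j).
Proof.
move=> hM; elim: l => [|l IH] i j.
  by apply: regular_ext (regular_const lh W ((1 : 'M[k]_N.+1) i j)) => x _.
apply: (@regular_ext _ _ _ _ _ (fun x => \sum_s M x i s * (M x ^+ l) s j)).
  by move=> x _; rewrite exprS mxE.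
by apply: (regular_sum lh) => s; apply: (regular_mul lh).
Qed.

(** The normal forms have coordinates Y1, a root of h1, and Y2, a root of h2, both equal to 1 over
    x0. The degree of h1 may drop at x0, so its reversal r is used, which is monic of constant
    degree because h1 has constant term 1; alpha = 1 / Y1 is a root of r. The refinement has the
    coordinate T = alpha / Y2, a root of H. There alpha is p / H' by [adj_eigenvector], and Y1 = 1 /
    alpha, Y2 = alpha / T. *)
Lemma etale_merge U1 U2 x0 t1 t2 : U1 (x0, t1) -> U2 (x0, t2) ->
  exists V u (a : et_hom V U1) (b : et_hom V U2),
    [/\ V (x0, u), a (x0, u) = t1 & b (x0, u) = t2].
Proof.
move=> /etale_normal_form[W1 [s1 [h1 [g1 [[o1 W10 r1 s10] [f1 h10 h1c] [fg1 g10] U1P]]]]].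
move=> /etale_normal_form[W2 [s2 [h2 [g2 [[o2 W20 r2 s20] [f2 h20 h2c] [fg2 g20] U2P]]]]].
pose W x := W1 x /\ W2 x.
have oW : zopen lift W by apply: zopen_and.
have W0 : W x0 by [].
have WW1 x : W x -> W1 x by case.
have WW2 x : W x -> W2 x by case.
have {}f1 : family W h1 := family_restrict WW1 f1.
have {}f2 : family W h2 := family_restrict WW2 f2.
have [N hN] := f1.1; have [m' hm'] := f2.1.
pose m := m'.+2.
have hm x : W x -> (size (h2 x) <= m)%N by move/hm' => h; rewrite !leqW.
(* C x has the inverses of the roots of h1 x as eigenvalues *)
pose r x : {poly k} := \poly_(i < N.+2) (h1 x)`_(N.+1 - i).
pose C x : 'M[k]_N.+1 := \matrix_(i, j)
  (if i == N :> nat then - (r x)`_j else (i.+1 == j :> nat)%:R).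
have rlead x : W x -> (r x)`_N.+1 = 1.
  by move=> Wx; rewrite coef_poly ltnSn subnn h1c //; apply: WW1.
have rsize x : W x -> size (r x) = N.+2.
  by move=> Wx; rewrite size_poly_eq // subnn h1c ?oner_neq0 //; apply: WW1.
have rmonic x : W x -> r x \is monic.
  by move=> Wx; rewrite monicE lead_coefE rsize //= rlead.
have Cchar x : W x -> char_poly (C x) = r x.
  by move=> Wx; rewrite /C companion_char_poly ?rsize ?rmonic.
have rh x a : W x -> root (r x) a -> a != 0 -> root (h1 x) a^-1.
  move=> Wx /rootP ra a0; apply/rootP.
  suff: a ^+ N.+1 * (h1 x).[a^-1] = 0.
    by move/eqP; rewrite mulf_eq0 expf_eq0 (negbTE a0) andbF => /eqP.
  rewrite -ra horner_poly (@horner_coef_wide _ N.+2); last by rewrite !leqW // hN.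
  rewrite mulr_sumr (reindex_inj rev_ord_inj) /=; apply: eq_bigr => i _.
  rewrite subSS mulrCA; congr (_ * _).
  have iN : (i <= N.+1)%N by rewrite -ltnS.
  by rewrite exprVn -{1}(subnK iN) addnC exprD mulrK // unitfE expf_neq0.
have rC i j : regular_on lift W (fun x => C x i j).
  case: (altP (i =P N :> nat)) => iN.
    apply: (@regular_ext _ _ _ _ _ (fun x => - (r x)`_j)).
      by move=> x _; rewrite mxE iN eqxx.
    apply: (regular_opp lh); case: (ltnP j N.+2) => jN; last first.
      apply: regular_ext (regular_const lh W 0) => x _.
      by rewrite coef_poly ltnNge jN.
    by apply: regular_ext (f1.2 (N.+1 - j)%N) => x _; rewrite coef_poly jN.
  apply: regular_ext (regular_const lh W (i.+1 == j :> nat)%:R) => x _.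
  by rewrite mxE (negbTE iN).
(* This is T^m h2(C / T) with denominators cleared. For T <> 0 it is singular exactly when alpha / T
   is a root of h2 for some eigenvalue alpha of C. *)
pose Phi x : 'M[{poly k}]_N.+1 :=
  \sum_(i < m) ((h2 x)`_i *: 'X^(m - i)) *: map_mx polyC (C x ^+ i).
have fPhi i j : family W (fun x => Phi x i j).
  apply: (@family_ext _ _ _ _ _ (fun x =>
    \sum_(l < m) ((h2 x)`_l)%:P * 'X^(m - l) * ((C x ^+ l) i j)%:P)).
    move=> x _; rewrite summxE; apply: eq_bigr => l _.
    by rewrite [RHS]mxE [(map_mx _ _) _ _]mxE mul_polyC.
  apply: family_sum => l; apply: family_mul.
    by apply: family_mul; [apply: family_scalar; exact: f2.2|exact: family_const].
  by apply: family_scalar; apply: regular_exp_mx.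
have fPhi' i j : family W (fun x => (map_mx (fun p => p^`()) (Phi x)) i j).
  by apply: family_ext (family_deriv (fPhi i j)) => x _; rewrite mxE.
have fadj := family_adj fPhi.
have fCp i j : family W (fun x => (map_mx polyC (C x)) i j).
  by apply: family_ext (family_scalar (rC i j)) => x _; rewrite [RHS]mxE.
pose H x := \det (Phi x).
have fH : family W H := family_det fPhi.
pose p x := \tr (\adj (Phi x) *m map_mx polyC (C x) *m map_mx (fun p => p^`()) (Phi x)).
have fp : family W p.
  apply: family_sum => i; apply: family_mulmx => // {}i j.
  exact: family_mulmx.
(* on H = 0 <> H', Phi has a one-dimensional kernel, on which C acts by p / H' *)
have eig x T : W x -> (H x).[T] = 0 -> ((H x)^`()).[T] != 0 ->
    let a := (p x).[T] / ((H x)^`()).[T] in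
    root (r x) a /\ (T != 0 -> root (h2 x) (a / T)) /\ (x = x0 -> T = 1 -> a = 1).
  move=> Wx HT H'T a.
  pose Psi := map_mx (horner_eval T) (Phi x).
  pose D := map_mx (horner_eval T) (map_mx (fun p => p^`()) (Phi x)).
  have PsiE : Psi = \sum_(i < m) ((h2 x)`_i * T ^+ (m - i)) *: C x ^+ i.
    apply/matrixP => i j; rewrite mxE !summxE /horner_eval horner_sum.
    apply: eq_bigr => l _; rewrite mxE [RHS]mxE mxE.
    by rewrite hornerM hornerZ hornerXn hornerC.
  have comm : Psi *m C x = C x *m Psi.
    rewrite PsiE mulmx_suml mulmx_sumr; apply: eq_bigr => i _.
    by rewrite -scalemxAl -scalemxAr; congr (_ *: _); rewrite -[LHS]exprSr -[RHS]exprS.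
  have det0 : \det Psi = 0 by rewrite det_map_mx.
  have trq : \tr (\adj Psi *m D) = ((H x)^`()).[T].
    by rewrite /Psi /D -map_mx_adj -map_mxM trace_map_mx -deriv_det.
  have trp : \tr (\adj Psi *m C x *m D) = (p x).[T].
    have -> : C x = map_mx (horner_eval T) (map_mx polyC (C x)).
      by apply/matrixP => i j; rewrite !mxE /horner_eval hornerC.
    by rewrite /Psi /D -map_mx_adj -!map_mxM trace_map_mx.
  have [|v [v0 vPsi vC]] := adj_eigenvector (D := D) det0 comm; first by rewrite trq.
  rewrite trq trp -/a in vC.
  have vCi i : v *m (C x ^+ i) = a ^+ i *: v.
    elim: i => [|i IH]; first by rewrite !expr0 mulmx1 scale1r.
    by rewrite exprS mulmxA vC -scalemxAl IH scalerA -exprS.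
  have vS : (\sum_(i < m) (h2 x)`_i * T ^+ (m - i) * a ^+ i) *: v = 0.
    rewrite -vPsi PsiE mulmx_sumr scaler_suml; apply: eq_bigr => i _.
    by rewrite -scalemxAr vCi scalerA.
  have S0 : \sum_(i < m) (h2 x)`_i * T ^+ (m - i) * a ^+ i = 0.
    by move/eqP: vS; rewrite scaler_eq0 (negbTE v0) orbF => /eqP.
  split; first by rewrite -Cchar // -eigenvalue_root_char; apply/eigenvalueP; exists v.
  split=> [T0|xx0 T1].
    apply/rootP; suff: T ^+ m * (h2 x).[a / T] = 0.
      by move/eqP; rewrite mulf_eq0 expf_eq0 (negbTE T0) andbF => /eqP.
    rewrite -[RHS]S0 (@horner_coef_wide _ m) ?hm // mulr_sumr.
    apply: eq_bigr => i _; rewrite mulrCA -mulrA; congr (_ * _).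
    rewrite -{1}(subnK (ltnW (ltn_ord i))) exprD expr_div_n -mulrA.
    by rewrite [T ^+ i * _]mulrCA divff ?expf_neq0 // mulr1.
  move: S0; rewrite xx0 h20 T1 /m !big_ord_recl big1 ?addr0 => [|i _].
    rewrite !coefB !coef1 !coefX /= !expr1n expr0 expr1 ?mulr0n ?mulr1n.
    by rewrite subr0 sub0r !mulr1 mulN1r => /eqP; rewrite subr_eq0 => /eqP/esym.
  by rewrite !lift0 coefB coef1 coefX subrr !mul0r.
(* Over x0 the eigenvalues of C are 1, once, and 0. Hence H has T = 1 as a simple root there, which
   makes it a point of the etale locus H' <> 0. *)
have r0 : r x0 = 'X^N * ('X - 1).
  apply/polyP => i; rewrite coef_poly coefXnM h10 !coefB !coef1 !coefX.
  case: (ltngtP i N) => [iN|Ni|->].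
  - have [l ->] : exists l, (N.+1 - i = l.+2)%N by exists (N - i.+1)%N; lia.
    by rewrite subrr if_same.
  - have [l ->] : exists l, (i = l + N.+1)%N by exists (i - N.+1)%N; lia.
    have -> : (l + N.+1 - N = l.+1)%N by lia.
    have -> : (N.+1 - (l + N.+1) = 0)%N by lia.
    by case: l => [|l]; [rewrite ltnSn|rewrite ltnNge addSnnS leq_addl /= subrr].
  - by rewrite ltnW // subnn subSnn.
have H0E : H x0 = 'X^(m.-1) ^+ N.+1 * r x0.
  rewrite -Cchar // /char_poly -detZ; congr (\det _).
  rewrite /Phi !big_ord_recl big1 ?addr0 => [|i _].
    rewrite h20 !coefB !coef1 !coefX /= subr0 sub0r expr0 expr1 subn0.
    rewrite map_mx1 scale1r scaleN1r scaleNr /char_poly_mx scalerBr.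
    by rewrite -(scalemx1 _ 'X) scalerA -exprSr.
  by rewrite !lift0 h20 coefB coef1 coefX subrr !scale0r.
have H01 : (H x0).[1] = 0.
  by rewrite H0E r0 !hornerE /= ?subrr ?mulr0.
have H'01 : ((H x0)^`()).[1] = 1.
  rewrite H0E r0 !derivM derivB derivX derivC subr0 mulr1.
  by rewrite !hornerE /= subrr !mulr0 !add0r !expr1n mulr1.
have sV0 : std_etale (fun z : pt * k => [/\ W z.1, root (H z.1) z.2 &
    ~~ root (H z.1)^`() z.2]).
  exists W, H, (fun x => (H x)^`()); split=> //; first exact: family_deriv.
  by move=> x t [].
pose V0 := Etale sV0.
pose al z := (p z.1).[z.2] / (H z.1)^`().[z.2].
have V0W x t : V0 (x, t) -> W x by case.
have ral : regular_on lift1 V0 al.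
  apply: (regular_mul lh1).
    by apply: regular_horner V0W fp _; apply: regular_snd.
  apply: (regular_inv lh1) => [[x t] [] //|].
  by apply: regular_horner V0W (family_deriv fH) _; apply: regular_snd.
have al0 : al (x0, 1) = 1.
  have nz : (H x0)^`().[1] != 0 by rewrite H'01 oner_neq0.
  by have [_ [_]] := eig x0 1 W0 H01 nz; apply.
have V01 : V0 (x0, 1).
  by split=> //; [exact/rootP|rewrite /root H'01 oner_neq0].
have [||V1 [V11 V1P]] := @etale_nonzero _ _ _ _ V0 (fun z => al z * z.2) x0 1 _ V01.
- by apply: (regular_mul lh1) => //; exact: regular_snd.
- by rewrite al0 /= mulr1 oner_neq0.
have V1W x t : V1 (x, t) -> W x by case/V1P => /V0W.
have V1al z : V1 z -> al z != 0 by case/V1P => _; rewrite mulf_eq0 negb_or => /andP[].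
have V1T z : V1 z -> z.2 != 0 by case/V1P => _; rewrite mulf_eq0 negb_or => /andP[].
have ral1 : regular_on lift1 V1 al by apply: regular_restrict ral => z /V1P[].
have ra : regular_on lift1 V1 (fun z => (al z)^-1) by apply: (regular_inv lh1).
have rb : regular_on lift1 V1 (fun z => al z / z.2).
  apply: (regular_mul lh1) => //; apply: (regular_inv lh1) => //; exact: regular_snd.
have [||V [V00 VP]] := @etale_nonzero _ _ _ _ V1
  (fun z => (g1 z.1).[(al z)^-1] * (g2 z.1).[al z / z.2]) x0 1 _ V11.
- apply: (regular_mul lh1).
    by apply: (@regular_horner _ _ _ _ W) => //; apply: family_restrict fg1.
  by apply: (@regular_horner _ _ _ _ W) => //; apply: family_restrict fg2.
- by rewrite al0 /= divr1 invr1 mulf_neq0.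
have VV1 z : V z -> V1 z by case/VP.
have VW x t : V (x, t) -> W x by move=> /VV1/V1W.
have Vg z : V z -> ~~ root (g1 z.1) (al z)^-1 /\ ~~ root (g2 z.1) (al z / z.2).
  by case/VP => _; rewrite mulf_eq0 negb_or => /andP[].
have Veig x t : V (x, t) ->
    root (r x) (al (x, t)) /\ (t != 0 -> root (h2 x) (al (x, t) / t)).
  move=> /VV1/V1P[[/= Wx /rootP Hx H'x] _].
  by have [e1 [e2 _]] := eig x t Wx Hx H'x.
have amaps x t : V (x, t) -> U1 (x, (fun z => t1 + s1 z.1 * (al z)^-1) (x, t)).
  move=> Vz; have Wx := VW _ _ Vz; apply: U1P; first exact: WW1.
    by apply: rh => //; [have [] := Veig _ _ Vz|apply/V1al/VV1].
  by have [] := Vg _ Vz.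
have bmaps x t : V (x, t) -> U2 (x, (fun z => t2 + s2 z.1 * (al z / z.2)) (x, t)).
  move=> Vz; have Wx := VW _ _ Vz; apply: U2P; first exact: WW2.
    by have [_] := Veig _ _ Vz; apply; apply: (V1T (x, t)); apply: VV1.
  by have [] := Vg _ Vz.
have areg : regular_on lift1 V (fun z => t1 + s1 z.1 * (al z)^-1).
  apply: (regular_add lh1); first exact: (regular_const lh1).
  apply: (regular_mul lh1); last exact: regular_restrict ra.
  by apply: (regular_pullback (W := W)) => //; apply: regular_restrict r1.
have breg : regular_on lift1 V (fun z => t2 + s2 z.1 * (al z / z.2)).
  apply: (regular_add lh1); first exact: (regular_const lh1).
  apply: (regular_mul lh1); last exact: regular_restrict rb.
  by apply: (regular_pullback (W := W)) => //; apply: regular_restrict r2.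
exists V, 1, (EtHom areg amaps), (EtHom breg bmaps); split=> //=.
- by rewrite s10 mul0r addr0.
- by rewrite s20 mul0r addr0.
Qed.

(** A common refinement matches only the points over x0; passing to the equalizer of the two
    composites into U makes them agree everywhere. *)
Lemma etale_filtered U V1 V2 (f1 : et_hom V1 U) (f2 : et_hom V2 U) x0 u1 u2 :
  V1 (x0, u1) -> V2 (x0, u2) -> f1 (x0, u1) = f2 (x0, u2) ->
  exists V u (a : et_hom V V1) (b : et_hom V V2),
    [/\ V (x0, u), a (x0, u) = u1, b (x0, u) = u2 &
        forall x t, V (x, t) -> f1 (x, a (x, t)) = f2 (x, b (x, t))].
Proof.
move=> V10 V20 f12; have [V [u [a [b [Vu au bu]]]]] := etale_merge V10 V20.
have [fa faE] := et_hom_comp a f1; have [fb fbE] := et_hom_comp b f2.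
have [|V' [V'u V'P]] := @et_equalizer _ _ _ _ _ _ fa fb x0 u Vu.
  by rewrite faE fbE au bu.
have [i iE] : exists i : et_hom V' V, forall x t, i (x, t) = t.
  by apply: etale_incl => z /V'P[].
have [a' a'E] := et_hom_comp i a; have [b' b'E] := et_hom_comp i b.
exists V', u, a', b'; split=> //; rewrite ?a'E ?b'E ?iE //.
by move=> x t /V'P[_]; rewrite faE fbE a'E b'E iE.
Qed.

End Merge.

(** * Stalks *)

Section Germs.
Variables (k : closedFieldType) (n d : nat) (B : 'M[k]_(odim d)).

Local Notation pt := (flag n B * flag n B)%type.
Local Notation etale := (@etale k n d B).
Local Notation presheaf := (@presheaf k n d B).
Implicit Types (F G : presheaf) (x : pt).

Definition germ_eq F x (U : etale) (t : k) (s : F U) (U' : etale) (t' : k)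
    (s' : F U') : Prop :=
  exists (V : etale) (f : et_hom V U) (f' : et_hom V U') (u : k),
    [/\ V (x, u), f (x, u) = t, f' (x, u) = t' & res F f s = res F f' s'].

Lemma same_class0 (K : complex n B) x U t (s : K 0%N U) U' t' (s' : K 0%N U') :
  same_class x t s t' s' <-> germ_eq x t s t' s'.
Proof.
split=> -[V [f [f' [u [Vu fu f'u /= E]]]]]; exists V, f, f', u; split=> //.
  by move/eqP: E; rewrite subr_eq0 => /eqP.
by rewrite /= E subrr.
Qed.

Lemma germ_sym F x U t (s : F U) U' t' (s' : F U') :
  germ_eq x t s t' s' -> germ_eq x t' s' t s.
Proof. by case=> V [f [f' [u [? ? ? ?]]]]; exists V, f', f, u. Qed.

Lemma germ_refl F x (U : etale) t (s : F U) : U (x, t) -> germ_eq x t s t s.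
Proof.
move=> Ut; have [i iE] : exists i : et_hom U U, forall x t, i (x, t) = t.
  exact: etale_incl.
by exists U, i, i, t; split.
Qed.

(** The two refinements are both neighbourhoods over the middle one, and [etale_filtered] supplies a
    further refinement on which they agree there. *)
Lemma germ_trans F x U t (s : F U) U' t' (s' : F U') U'' t'' (s'' : F U'') :
  germ_eq x t s t' s' -> germ_eq x t' s' t'' s'' -> germ_eq x t s t'' s''.
Proof.
case=> V1 [f1 [f1' [u1 [V1u e1 e1' E1]]]] [V2 [f2 [f2' [u2 [V2u e2 e2' E2]]]]].
have [|V [u [a [b [Vu au bu ab]]]]] := etale_filtered (f1 := f1') (f2 := f2) V1u V2u.
  by rewrite e1' e2.
have [c cE] := et_hom_comp a f1; have [c' c'E] := et_hom_comp b f2'.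
have [e eE] := et_hom_comp a f1'.
exists V, c, c', u; split=> //; first by rewrite cE au.
  by rewrite c'E bu.
rewrite (res_comp (f := a) (g := f1)) => [|*]; last exact: cE.
rewrite E1 (res_comp (f := b) (g := f2')) => [|*]; last exact: c'E.
rewrite -E2 -(res_comp (h := e)) => [|*]; last exact: eE.
by rewrite -(res_comp (h := e)) // => y s3 Vy; rewrite eE ab.
Qed.

(** The refinements belonging to the two summands are matched over U by filteredness and over U' by
    an additional equalizer. *)
Lemma germ_add F x (U U' : etale) t t' (s1 s2 : F U) (s1' s2' : F U') :
  germ_eq x t s1 t' s1' -> germ_eq x t s2 t' s2' ->
  germ_eq x t (s1 + s2) t' (s1' + s2').
Proof.
case=> V1 [f1 [f1' [u1 [V1u e1 e1' E1]]]] [V2 [f2 [f2' [u2 [V2u e2 e2' E2]]]]].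
have [|V [u [a [b [Vu au bu ab]]]]] := etale_filtered (f1 := f1) (f2 := f2) V1u V2u.
  by rewrite e1 e2.
have [c cE] := et_hom_comp a f1.
have [c1 c1E] := et_hom_comp a f1'; have [c2 c2E] := et_hom_comp b f2'.
have [|V' [V'u V'P]] := @et_equalizer _ _ _ _ _ _ c1 c2 x u Vu.
  by rewrite c1E c2E au bu e1'.
have [i iE] : exists i : et_hom V' V, forall x t, i (x, t) = t.
  by apply: etale_incl => z /V'P[].
have [g gE] := et_hom_comp i c; have [g' g'E] := et_hom_comp i c1.
have [ia iaE] := et_hom_comp i a; have [ib ibE] := et_hom_comp i b.
exists V', g, g', u; split=> //; first by rewrite gE iE cE au.
  by rewrite g'E iE c1E au.
rewrite !raddfD; congr (_ + _).
  rewrite (res_comp (f := ia) (g := f1)) => [|*]; last by rewrite gE cE iaE.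
  rewrite E1 (res_comp (f := ia) (g := f1')) // => *.
  by rewrite g'E c1E iaE.
rewrite (res_comp (f := ib) (g := f2)) => [|y s3 /V'P[Vy _]]; last first.
  by rewrite gE cE ibE iE ab.
rewrite E2 (res_comp (f := ib) (g := f2')) // => y s3 /V'P[Vy].
by rewrite c1E c2E g'E c1E ibE iE.
Qed.

Lemma germ_mulz F x (U U' : etale) t t' (s : F U) (s' : F U') (m : int) :
  germ_eq x t s t' s' -> germ_eq x t (s *~ m) t' (s' *~ m).
Proof.
case=> V [f [f' [u [? ? ? E]]]]; exists V, f, f', u; split=> //.
by rewrite !raddfMz E.
Qed.

Lemma germ_sub F x (U U' : etale) t t' (s1 s2 : F U) (s1' s2' : F U') :
  germ_eq x t s1 t' s1' -> germ_eq x t s2 t' s2' ->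
  germ_eq x t (s1 - s2) t' (s1' - s2').
Proof.
move=> h1 /(germ_mulz (-1)); rewrite !mulrN1z; exact: germ_add.
Qed.

Lemma germ0 F x (U U' : etale) t t' : U (x, t) -> U' (x, t') ->
  germ_eq x t (0 : F U) t' (0 : F U').
Proof.
move=> Ut U't; have [V [u [a [b [? ? ?]]]]] := etale_merge Ut U't.
by exists V, a, b, u; split=> //; rewrite !raddf0.
Qed.

Lemma germ_mor F G (phi : sh_mor F G) x (U U' : etale) t t' (s : F U) (s' : F U') :
  germ_eq x t s t' s' -> germ_eq x t (phi U s) t' (phi U' s').
Proof.
case=> V [f [f' [u [? ? ? E]]]]; exists V, f, f', u; split=> //.
by rewrite -!sh_nat E.
Qed.

End Germs.

(** * The rank of a stalk *)

Section StalkRank.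
Variables (k : closedFieldType) (n d : nat) (B : 'M[k]_(odim d)).
Local Notation pt := (flag n B * flag n B)%type.
Local Notation etale := (@etale k n d B).

(** Every cocycle has class zero, so a basis element would satisfy a relation with coefficient 1,
    and independence would make l divide 1. *)
Lemma stalk_dim_vanish (l : nat) (K : adic_complex n B) (x : pt) (i m : nat) :
  prime l -> (forall r, stalk_vanish (@everywhere k n d B) (K r) x i) ->
  (forall r, is_sheaf (K r i)) ->
  stalk_dim l K x i m -> m = 0%N.
Proof.
move=> l_pr van shf [e []]; case: m e => // m e /= indep _.
have sec0 r (U : etale) t (s : K r i U) : U (x, t) -> cdiff (K r) i U s = 0 ->
    same_class x t s t (0 : K r i U).
  move=> Ut ds; have [|U' [f [t' [U't' ft']]]] := van r U t s Ut ds.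
    (* A scheme V without points is covered by the empty family, so by the sheaf condition its only
       section is 0; thus every section is supported in the whole space. *)
    move=> V f VS; have sV : surjective_family (I := False) (V := fun _ => V)
        (fun i : False => match i with end) (U := V).
      by move=> y u /VS []; exact: I.
    have [|u [_ uu]] := shf r V False (fun _ => V) _ sV (fun i => match i with end).
      by case.
    by rewrite -(uu 0) ?(uu (res _ f s)) // => -[].
  by exists U', f, f, t'; split=> //; rewrite raddf0 subr0.
have := indep (fun j r => (j == ord0)%:R) _ _ ord0 1%N.
rewrite eqxx expn1 => h; have : (l%:Z %| 1)%Z.
  apply: h => [j r|r]; first by [].
  rewrite big_ord_recl big1 => [|j _]; last by rewrite mulr0z.
  by rewrite addr0; apply: sec0; [exact: lf_mem|exact: lf_cocycle].
by rewrite dvdzE /= dvdn1 => /eqP l1; rewrite l1 in l_pr.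
Qed.

Lemma stalk_dim0_uniq (l : nat) (K : adic_complex n B) (x : pt) (m : nat)
    (Om : etale) (sigma : forall r, K r 0%N Om) :
  prime l -> Om (x, 0) ->
  (forall r, cdiff (K r) 0 Om (sigma r) = 0) ->
  (forall r, atr K r 0 Om (sigma r.+1) = sigma r) ->
  (forall r (a : int), same_class x 0 (sigma r *~ a) 0 (0 : K r 0%N Om) <->
     ((l ^ r)%:Z %| a)%Z) ->
  (forall r (U : etale) t (s : K r 0%N U), U (x, t) -> cdiff (K r) 0 U s = 0 ->
     exists a : int, same_class x t s 0 (sigma r *~ a)) ->
  stalk_dim l K x 0 m -> m = 1%N.
Proof.
move=> l_pr Om0 dsigma tsigma ker gen [e /= [indep span]].
have l_gt1 := prime_gt1 l_pr.
case: m e indep span => [|[|m]] e indep span //.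
- have [y yE] : exists y : limit_family K x 0 1,
      forall r, same_class x (lf_pt y r) (lf_sec y r ord0) 0 (sigma r).
    have comp r (j : 'I_1) : same_class x 0 (atr K r 0 Om (sigma r.+1)) 0 (sigma r).
      by apply/same_class0; rewrite tsigma; apply: germ_refl.
    exists (LimitFamily (lf_nbhd := fun=> Om) (lf_pt := fun=> 0)
      (fun=> Om0) (fun r (_ : 'I_1) => dsigma r) comp) => r /=.
    by apply/same_class0; apply: germ_refl.
  (* With no basis elements some l^c would annihilate the system sigma. At level c + 1 this
     contradicts the order l^(c+1) of sigma. *)
  have [c [a [_ H]]] := span y.
  have /ker : same_class x 0 (sigma c.+1 *~ (l ^ c)%:Z) 0 (0 : K c.+1 0%N Om).
    apply/same_class0; apply: (@germ_trans _ _ _ _ _ _ _ _ _ _ (lf_pt y c.+1)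
      (lf_sec y c.+1 ord0 *+ l ^ c)).
      rewrite pmulrn; apply/germ_mulz/germ_sym; exact/same_class0.
    have /same_class0 := H c.+1; rewrite big_ord0 => h; apply: germ_trans h _.
    by apply: germ0; [exact: lf_mem|].
  rewrite dvdzE /= => /dvdn_leq; rewrite expn_gt0 prime_gt0 // => /(_ isT).
  by rewrite expnS leqNgt -{1}(mul1n (l ^ c)%N) ltn_pmul2r ?l_gt1 // expn_gt0 prime_gt0.
- have pick r (j : 'I_m.+2) : exists al : int,
      germ_eq x (lf_pt e r) (lf_sec e r j) 0 (sigma r *~ al).
    have [al /same_class0 h] := gen r _ _ _ (lf_mem e r) (lf_cocycle e r j).
    by exists al.
  pose al j r := projT1 (cid (pick r j)).
  have alP j r : germ_eq x (lf_pt e r) (lf_sec e r j) 0 (sigma r *~ al j r).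
    by rewrite /al; case: cid.
  have ker0 r (a : int) : germ_eq x 0 (sigma r *~ a) 0 (0 : K r 0%N Om) ->
      ((l ^ r)%:Z %| a)%Z.
    by move=> h; apply/ker/same_class0.
  have al_coh j : is_adic_int l (al j).
    move=> r; apply/eqP; rewrite eqz_mod_dvd; apply: ker0; rewrite mulrzBr.
    rewrite -(subrr (sigma r *~ al j r)); apply: germ_sub; last exact: germ_refl.
    apply: germ_trans (alP j r); apply: germ_sym.
    have /same_class0 h := lf_compat e r j; apply: germ_trans (germ_sym h) _.
    have := germ_mor (atr K r 0) (alP j r.+1).
    by rewrite raddfMz tsigma.
  pose j0 : 'I_m.+2 := ord0; pose j1 : 'I_m.+2 := lift ord0 ord0.
  pose a (j : 'I_m.+2) r : int :=
    if j == j0 then al j1 r else if j == j1 then - al j0 r else 0.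
  have a_coh j : is_adic_int l (a j).
    move=> r; rewrite /a; case: eqP => _; first exact: al_coh.
    case: eqP => _ //; apply/eqP; rewrite eqz_mod_dvd -opprD rpredN.
    by rewrite -eqz_mod_dvd; apply/eqP; apply: al_coh.
  have zero_gen r : germ_eq x (lf_pt e r) (0 : K r 0%N (lf_nbhd e r)) 0 (0 : K r 0%N Om).
    by apply: germ0; [exact: lf_mem|].
  have combE r : germ_eq x (lf_pt e r) (\sum_(j < m.+2) lf_sec e r j *~ a j r)
      (lf_pt e r) (0 : K r 0%N (lf_nbhd e r)).
    apply: germ_trans (germ_sym (zero_gen r)).
    rewrite 2!big_ord_recl big1 ?addr0 => [|j _]; last first.
      by rewrite /a !(inj_eq lift_inj) /= mulr0z.
    have := germ_add (germ_mulz (a j0 r) (alP j0 r)) (germ_mulz (a j1 r) (alP j1 r)).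
    rewrite /a eqxx /= -!mulrzA -mulrzDr mulrN [al j1 r * _]mulrC.
    by rewrite subrr.
  (* The relation between two basis elements forces the coefficient of the first one to vanish
     modulo l^r for every r. That element is then zero at every level, against independence. *)
  have al_dvd r : ((l ^ r)%:Z %| al j0 r)%Z.
    have := indep a a_coh _ j1 r; rewrite /a eqxx /= rpredN; apply.
    by move=> r'; apply/same_class0.
  have := indep (fun j r => (j == j0)%:R) _ _ j0 1%N.
  rewrite eqxx expn1 => h; have : (l%:Z %| 1)%Z.
    apply: h => [j r|r]; first by [].
    apply/same_class0; apply: germ_trans (germ_sym (zero_gen r)).
    rewrite big_ord_recl big1 ?addr0 => [|j _]; last by rewrite mulr0z.
    rewrite eqxx mulr1z; apply: germ_trans (alP j0 r) _.
    by apply/same_class0/ker.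
  by rewrite dvdzE /= dvdn1 => /eqP l1; rewrite l1 in l_pr.
Qed.

End StalkRank.

(** * Expansions in powers of 1/v *)

Lemma lvalM (x y : laurent) : lval (x * y) = lval x * lval y.
Proof. exact: (rmorphM (\val : laurent -> Qv)). Qed.
Lemma lval0 : lval 0 = 0.
Proof. exact: (rmorph0 (\val : laurent -> Qv)). Qed.
Lemma lval1 : lval 1 = 1.
Proof. exact: (rmorph1 (\val : laurent -> Qv)). Qed.
Lemma lvalN (x : laurent) : lval (- x) = - lval x.
Proof. exact: (rmorphN (\val : laurent -> Qv)). Qed.
Lemma lvalMn (x : laurent) m : lval (x *+ m) = lval x *+ m.
Proof. exact: (rmorphMn (\val : laurent -> Qv)). Qed.
Lemma lval_sum (I : Type) (r : seq I) (p : pred I) (F : I -> laurent) :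
  lval (\sum_(i <- r | p i) F i) = \sum_(i <- r | p i) lval (F i).
Proof. exact: (rmorph_sum (\val : laurent -> Qv)). Qed.

Lemma lval_inj : injective lval.
Proof. exact: val_inj. Qed.

Definition in_Zvinv (z : Qv) : Prop :=
  exists p : {poly int}, z = (map_poly intr p).[vQ^-1].

Lemma in_ZvinvD x y : in_Zvinv x -> in_Zvinv y -> in_Zvinv (x + y).
Proof.
by move=> [p ->] [q ->]; exists (p + q); rewrite rmorphD hornerD.
Qed.
Lemma in_ZvinvM x y : in_Zvinv x -> in_Zvinv y -> in_Zvinv (x * y).
Proof.
by move=> [p ->] [q ->]; exists (p * q); rewrite rmorphM hornerM.
Qed.
Lemma in_Zvinv_int (m : int) : in_Zvinv m%:~R.
Proof. by exists m%:P; rewrite map_polyC hornerC. Qed.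

Lemma in_vinvE z :
  in_vinv_Zvinv z <-> exists2 y, in_Zvinv y & z = vQ^-1 * y.
Proof. by split=> [[p ->]|[y [p ->] ->]]; [eexists; [exists p|]|exists p]. Qed.

Lemma in_vinv0 : in_vinv_Zvinv 0.
Proof. by exists 0; rewrite rmorph0 horner0 mulr0. Qed.

Lemma in_vinvD x y :
  in_vinv_Zvinv x -> in_vinv_Zvinv y -> in_vinv_Zvinv (x + y).
Proof.
move=> /in_vinvE[a ha ->] /in_vinvE[b hb ->]; apply/in_vinvE.
by exists (a + b); [exact: in_ZvinvD|rewrite mulrDr].
Qed.

Lemma in_vinvM x y : in_vinv_Zvinv x -> in_Zvinv y -> in_vinv_Zvinv (x * y).
Proof.
move=> /in_vinvE[a ha ->] hb; apply/in_vinvE.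
by exists (a * y); [exact: in_ZvinvM|rewrite mulrA].
Qed.

Lemma in_vinvW x : in_vinv_Zvinv x -> in_Zvinv x.
Proof.
move=> [p ->]; exists ('X * p).
by rewrite rmorphM hornerM /= map_polyX hornerX.
Qed.

Lemma in_vinvN x : in_vinv_Zvinv x -> in_vinv_Zvinv (- x).
Proof.
by move=> h; rewrite -mulrN1; apply: in_vinvM h _; exact: (in_Zvinv_int (-1)).
Qed.

Lemma in_vinv_sum (I : Type) (r : seq I) (p : pred I) (F : I -> Qv) :
  (forall i, p i -> in_vinv_Zvinv (F i)) ->
  in_vinv_Zvinv (\sum_(i <- r | p i) F i).
Proof. by move=> h; elim/big_ind: _ => //; [exact: in_vinv0|exact: in_vinvD]. Qed.

Lemma in_vinv_pow (m : nat) : in_vinv_Zvinv (vQ ^- m.+1).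
Proof.
by exists 'X^m; rewrite map_polyXn hornerXn exprVn exprS invfM.
Qed.

(** * What the support condition says about the polynomials P *)

Section ICPoly.
Variables (k : closedFieldType) (n d : nat) (B : 'M[k]_(odim d)).
Variables (l : nat) (dimO : Xi n d -> nat) (A : Xi n d) (K : adic_complex n B).
Hypotheses (l_prime : prime l) (K_IC : is_IC l dimO A K).

(** The chain witnessing the dimension starts with an irreducible, hence nonempty, subset. A point
    is required because the conditions on stalks are stated point by point. *)
Lemma orbit_nonempty (A' : Xi n d) (m : nat) : is_orbit_dim B A' m ->
  exists x : flag n B * flag n B, Defs.in_orbit A' x.
Proof.
case=> -[F [/(_ 0%N (leq0n m)) [[C _ FC] [[x Fx] _]] _]] _.
by exists x; have [] := (FC x).1 Fx.
Qed.

Lemma IC_poly_diag (x : flag n B * flag n B) (P : laurent) :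
  Defs.in_orbit A x -> is_IC_poly l dimO K A A P -> P = 1.
Proof.
case: K_IC => inj _ [van [Om [sigma [Om0 dsig tsig ker gen]]]] _ _ Ax.
move=> [h [b [hd hb ->]]].
have h0 : h 0%N = 1%N.
  apply: (stalk_dim0_uniq l_prime (Om0.2 x Ax) dsig tsig) (hd 0%N x Ax).
    by move=> r a; apply: ker.
  by move=> r U t s; apply: gen.
have hi i : (0 < i)%N -> h i = 0%N.
  move=> i0; apply: (stalk_dim_vanish l_prime) (hd i x Ax) => r.
    exact: van.
  by have [] := inj r i.
case: b hb => [|b] hb; first by rewrite hb in h0.
rewrite big_ord_recl big1 => [|i _]; last by rewrite hi.
rewrite addr0 h0 mulr1n; apply: lval_inj.
by rewrite lval1 /= sub0r addrC subrr expr0z.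
Qed.

(** Only degrees i below the codimension survive, and for these the exponent of v is negative. If
    the dimension does not drop, every degree i is excluded; this second conclusion provides the
    triangularity of the canonical basis. *)
Lemma IC_poly_off (A' : Xi n d) (x : flag n B * flag n B) (P : laurent) :
  leXi B A' A -> A' != A -> Defs.in_orbit A' x -> is_IC_poly l dimO K A' A P ->
  in_vinv_Zvinv (lval P) /\ ((dimO A <= dimO A')%N -> P = 0).
Proof.
case: K_IC => inj _ _ supp _ le neq A'x [h [b [hd hb ->]]].
have hi i : (dimO A <= i + dimO A')%N -> h i = 0%N.
  move=> i0; apply: (stalk_dim_vanish l_prime) (hd i x A'x) => r.
    exact: supp le neq A'x i0.
  by have [] := inj r i.
split=> [|dd]; last by apply: big1 => i _; rewrite hi // (leq_trans dd) // leq_addl.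
rewrite lval_sum; apply: in_vinv_sum => i _.
case: (leqP (dimO A) (i + dimO A')) => [/hi ->|lt]; first by rewrite lvalMn; exact: in_vinv0.
rewrite lvalMn -mulr_natr; apply: in_vinvM; last exact: (in_Zvinv_int (h i)).
have [c cE] : exists c, (dimO A = c.+1 + (i + dimO A'))%N.
  by exists (dimO A - (i + dimO A')).-1; lia.
have -> : lval (vpow (i%:Z - (dimO A)%:Z + (dimO A')%:Z)) = vQ ^- c.+1.
  rewrite /= exprnN; congr (_ ^ _); rewrite cE; lia.
exact: in_vinv_pow.
Qed.

End ICPoly.

Local Notation vev p := (map_poly intr p).[vQ^-1].

Lemma tofrac_int (z : int) : tofrac (z%:P : {poly int}) = z%:~R.
Proof.
have -> : (z%:P : {poly int}) = z%:~R by rewrite -[z in LHS]intz rmorph_int.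
by rewrite rmorph_int.
Qed.

Lemma tofrac_horner (p : {poly int}) : tofrac p = (map_poly intr p).[vQ].
Proof.
rewrite (@horner_coef_wide _ (size p)); last exact: size_poly.
rewrite -{1}[p]coefK poly_def rmorph_sum; apply: eq_bigr => i _.
by rewrite -mul_polyC /= tofracM tofrac_int tofracXn coef_map.
Qed.

(** Reversing the coefficients trades powers of v^-1 for an element of Z[v], where identities can be
    compared coefficient by coefficient. *)
Lemma vev_rev (p : {poly int}) s : (size p <= s.+1)%N ->
  vQ ^+ s * vev p = tofrac (\poly_(i < s.+1) p`_(s - i)).
Proof.
move=> ps; rewrite tofrac_horner.
rewrite (@horner_coef_wide _ s.+1); last exact: leq_trans (size_poly _ _) ps.
rewrite (@horner_coef_wide _ s.+1 (map_poly _ _)); last first.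
  exact: leq_trans (size_poly _ _) (size_poly _ _).
rewrite mulr_sumr [RHS](reindex_inj rev_ord_inj) /=; apply: eq_bigr => i _.
have is' : (i <= s)%N by rewrite -ltnS.
rewrite !coef_map coef_poly /= subSS ltnS leq_subr subKn // mulrCA.
congr (_ * _); rewrite exprVn -{1}(subnK is') exprD mulfK //.
by rewrite expf_neq0 // vQ_neq0.
Qed.

Lemma vev_eq0 (p : {poly int}) : vev p = 0 -> p = 0.
Proof.
move=> p0; have := @vev_rev p (size p) (leqnSn _).
rewrite p0 mulr0 => /esym/eqP; rewrite tofrac_eq0 => /eqP/polyP rev0.
apply/polyP => i; rewrite coef0; case: (ltnP i (size p)) => [ip|]; last first.
  by move/(nth_default 0).
have := rev0 (size p - i)%N.
by rewrite coef_poly ltnS leq_subr subKn ?coef0 // ltnW.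
Qed.

Lemma vevB (p q : {poly int}) : vev (p - q) = vev p - vev q.
Proof. by rewrite rmorphB hornerD hornerN. Qed.
Lemma vevM (p q : {poly int}) : vev (p * q) = vev p * vev q.
Proof. by rewrite rmorphM hornerM. Qed.
Lemma vevC (z : int) : vev z%:P = z%:~R.
Proof. by rewrite map_polyC hornerC. Qed.
Lemma vevX : vev 'X = vQ^-1.
Proof. by rewrite map_polyX hornerX. Qed.

Lemma in_vinv_int (z : int) : in_vinv_Zvinv z%:~R -> z = 0.
Proof.
case=> q zq; pose r : {poly int} := z%:P - 'X * q.
have : vev r = 0 by rewrite vevB vevM vevC vevX -zq subrr.
move/vev_eq0/(congr1 (fun p : {poly int} => p`_0)).
by rewrite coefB coefC coefXM coef0 subr0.
Qed.

(** Multiplication by v^s, s = deg p, turns the left side into a polynomial of degree at most s and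
    the right side into one of degree 2s. *)
Lemma vev_sym_const (p : {poly int}) : vev p = tofrac p -> p = (p`_0)%:P.
Proof.
have [-> _|p0 hp] := eqVneq p 0; first by rewrite coef0.
apply/size1_polyC; have := @vev_rev p (size p).-1 (leqSpred _).
rewrite hp -tofracXn -tofracM => /eqP; rewrite tofrac_eq => /eqP E.
have := size_poly (size p).-1.+1 (fun i => p`_((size p).-1 - i)).
rewrite -E mulrC size_mulXn //; rewrite -size_poly_gt0 in p0; lia.
Qed.

(** In other words, x lies in Z[v^-1] and z is its value at v = infinity. *)
Definition vcong (x : Qv) (z : int) := in_vinv_Zvinv (x - z%:~R).

Lemma vcongW x z : vcong x z -> in_Zvinv x.
Proof.
by move=> h; rewrite -(subrK z%:~R x); apply: in_ZvinvD (in_Zvinv_int _); exact: in_vinvW.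
Qed.

Lemma vcongM x y a b : vcong x a -> vcong y b -> vcong (x * y) (a * b).
Proof.
move=> hx hy; rewrite /vcong; have -> : x * y - (a * b)%:~R = (x - a%:~R) * y + (y - b%:~R) * a%:~R.
  by rewrite rmorphM /=; ring.
by apply: in_vinvD; apply: in_vinvM => //; [exact: vcongW hy|exact: in_Zvinv_int].
Qed.

Lemma vcong_sum (I : Type) (r : seq I) (p : pred I) (F : I -> Qv) (G : I -> int) :
  (forall i, vcong (F i) (G i)) ->
  vcong (\sum_(i <- r | p i) F i) (\sum_(i <- r | p i) G i).
Proof.
by move=> h; rewrite /vcong rmorph_sum -sumrB; apply: in_vinv_sum => i _; apply: h.
Qed.

Lemma vcong_vev (p : {poly int}) : vcong (vev p) p`_0.
Proof.
pose q : {poly int} := \poly_(i < size p) p`_i.+1.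
have E : p - (p`_0)%:P = 'X * q.
  apply/polyP => -[|i]; rewrite coefB coefC coefXM /= ?subrr // subr0 coef_poly.
  by case: ltnP => // h; rewrite nth_default // leqW.
by exists q; rewrite -vevC -vevB E vevM vevX.
Qed.

Lemma laurent_shift (F : fieldType) (a b g e : F) : a != 0 -> b != 0 ->
  a^-1 * (g * e) = g * b * (b^-1 * a^-1 * e).
Proof. by move=> a0 b0; field; rewrite a0 b0. Qed.

Lemma laurent_vev (c : laurent) : exists m, forall m', (m <= m')%N ->
  exists p : {poly int}, lval c = vQ ^+ m' * vev p.
Proof.
have /asboolP[m [q cq]] : lval c \in laurent_pred by case: c.
pose s := size q; exists s => m' sm'.
pose p : {poly int} := 'X^(m' - s) * 'X^m * \poly_(i < s.+1) q`_(s - i).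
exists p; have v0 := vQ_neq0.
have e1 : lval c = vQ ^- m * tofrac q by rewrite -cq mulrC mulfK ?expf_neq0.
have e2 : vQ ^+ s * vev (\poly_(i < s.+1) q`_(s - i)) = tofrac q.
  rewrite vev_rev ?size_poly //; congr tofrac; apply/polyP => i; rewrite coef_poly.
  case: ltnP => h; last by rewrite nth_default // (leq_trans _ h) // leqnSn.
  by rewrite coef_poly ltnS leq_subr subKn.
rewrite e1 -e2 /p !rmorphM !hornerM /= !map_polyXn !hornerXn !exprVn.
rewrite -{1}(subnKC sm') exprD; have := expf_neq0 (m' - s) v0.
have := expf_neq0 m v0.
exact: laurent_shift.
Qed.

(** * Almost orthonormality *)

Section AlmostOrthonormal.
Variables (n d : nat) (dimO : Xi n d -> nat) (le : Xi n d -> Xi n d -> Prop).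
Variables (P : Xi n d -> Xi n d -> laurent) (f : Xi n d -> laurent).
Hypothesis le_refl : forall A, le A A.
Hypothesis P_diag : forall A, P A A = 1.
Hypothesis P_off : forall A' A, le A' A -> A' != A ->
  in_vinv_Zvinv (lval (P A' A)) /\ ((dimO A <= dimO A')%N -> P A' A = 0).
Hypothesis f_lead : forall A,
  vcong (vQ ^ (- (2 * (dXi (trXi A))%:Z)) * lval (f A)) 1.

Local Notation can := (canon_elt le P).
Local Notation form := (Sj_form f).

Let Q (A' A : Xi n d) : laurent := if `[< le A' A >] then P A' A else 0.
Let nrm (A : Xi n d) : Qv := vQ ^ (- (2 * (dXi (trXi A))%:Z)) * lval (f A).

Lemma canE A A' : (can A : Sj n d) A' = Q A' A * vpow (- (dXi A')%:Z).
Proof.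
rewrite /canon_elt big_mkcond sum_ffunE (bigD1 A') //= big1 => [|A'' nA].
  rewrite addr0 /Q; case: ifP => _; rewrite !ffunE ?mul0r // eqxx.
  by rewrite /= [_ *: 1]mulr1.
by case: ifP => _; rewrite !ffunE // eq_sym (negbTE nA) !scaler0.
Qed.

Lemma Q_cong A' A : vcong (lval (Q A' A)) (A' == A)%:R.
Proof.
rewrite /vcong /Q; have [->|nA] := eqVneq A' A.
  by rewrite asboolT // P_diag lval1 subrr; exact: in_vinv0.
case: asboolP => [h|_]; last by rewrite lval0 subr0; exact: in_vinv0.
by rewrite subr0; have [] := P_off h nA.
Qed.

Lemma Q_tri A' A : A' != A -> (dimO A <= dimO A')%N -> Q A' A = 0.
Proof.
by rewrite /Q => nA dd; case: asboolP => // h; have [_ ->] := P_off h nA.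
Qed.

(** The two factors v^(-d_C) of the standard basis cancel v^(2 d_C) in the form. What remains,
    [nrm C], is congruent to 1 by the leading term of f_C. *)
Lemma form_can A A' :
  form (can A) (can A') = \sum_C lval (Q C A) * lval (Q C A') * nrm C.
Proof.
apply: eq_bigr => C _; rewrite !canE !lvalM /nrm /=.
have v0 := vQ_neq0; rewrite -!mulrA; congr (_ * _).
rewrite mulrCA; congr (_ * _); rewrite !mulrA -!expfzDr //.
by congr (_ ^ _ * _); lia.
Qed.

Lemma form_can_cong A A' : vcong (form (can A) (can A')) (A == A')%:R.
Proof.
rewrite form_can.
have -> : (A == A')%:R = \sum_(C : Xi n d) (C == A)%:R * (C == A')%:R * 1 :> int.
  rewrite (bigD1 A) //= eqxx big1 => [|C /negbTE ->]; last by rewrite !mul0r.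
  by rewrite addr0 mul1r mulr1.
apply: vcong_sum => C; apply: vcongM; last exact: f_lead.
by apply: vcongM; exact: Q_cong.
Qed.

Lemma form_lin (c c' : Xi n d -> laurent) :
  form (\sum_A c A *: can A) (\sum_A c' A *: can A) =
    \sum_A \sum_A' lval (c A) * lval (c' A') * form (can A) (can A').
Proof.
transitivity (\sum_C \sum_A \sum_A' lval (c A) * lval (c' A') *
  (lval (can A C) * lval (can A' C) *
    (vQ ^ (2 * ((dXi C)%:Z - (dXi (trXi C))%:Z)) * lval (f C)))).
  apply: eq_bigr => C _; rewrite !sum_ffunE !lval_sum mulr_suml mulr_suml.
  apply: eq_bigr => A _; rewrite mulr_sumr mulr_suml; apply: eq_bigr => A' _.
  by rewrite !ffunE ![_ *: _]/(_ * _) !lvalM -!mulrA [lval (_ C) * (lval (c' A') * _)]mulrCA.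
rewrite exchange_big; apply: eq_bigr => A _; rewrite exchange_big.
by apply: eq_bigr => A' _; rewrite /Sj_form mulr_sumr.
Qed.

(** Induction on [dimO]: [std A] differs from [can A] by terms of smaller dimension, since P
    vanishes on the others. *)
Lemma can_span (b : Sj n d) : exists c : Xi n d -> laurent, b = \sum_A c A *: can A.
Proof.
pose span (b : Sj n d) := exists c : Xi n d -> laurent, b = \sum_A c A *: can A.
have spanD x y : span x -> span y -> span (x + y).
  move=> [c ->] [c' ->]; exists (fun A => c A + c' A).
  by rewrite -big_split; apply: eq_bigr => A _; rewrite scalerDl.
have spanZ a x : span x -> span (a *: x).
  move=> [c ->]; exists (fun A => a * c A).
  by rewrite scaler_sumr; apply: eq_bigr => A _; rewrite scalerA.
have span0 : span 0 by exists (fun=> 0); rewrite big1 // => A _; rewrite scale0r.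
have span_sum (p : pred (Xi n d)) (F : Xi n d -> Sj n d) :
    (forall A, p A -> span (F A)) -> span (\sum_(A | p A) F A).
  by move=> h; elim/big_ind: _.
have span_can A : span (can A).
  exists (fun A' => (A' == A)%:R); rewrite (bigD1 A) //= eqxx scale1r big1 ?addr0 //.
  by move=> A' /negbTE ->; rewrite scale0r.
have span_std : forall m A, (dimO A < m)%N -> span (std A).
  elim=> // m IH A Am.
  have -> : std A = can A + (-1) *: \sum_(A' | `[< le A' A >] && (A' != A)) P A' A *: std A'.
    rewrite /canon_elt (bigD1 A) ?asboolT //= P_diag scale1r scaleN1r.
    by rewrite addrK.
  apply: spanD => //; apply/spanZ/span_sum => A' /andP[/asboolP leA nA].
  have [_ h] := P_off leA nA; case: (leqP (dimO A) (dimO A')) => [/h ->|lt].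
    by rewrite scale0r.
  by apply/spanZ/IH; rewrite (leq_trans lt).
rewrite -/(span b).
have -> : b = \sum_A (b A * vpow (dXi A)%:Z) *: std A.
  apply/ffunP => A; rewrite sum_ffunE (bigD1 A) //= big1 => [|A' nA].
    rewrite !ffunE eqxx addr0; apply: lval_inj.
    rewrite ![_ *: _]/(_ * _) !lvalM lval1 mulr1 /= -mulrA -expfzDr ?vQ_neq0 //.
    by rewrite subrr expr0z mulr1.
  by rewrite !ffunE eq_sym (negbTE nA) !scaler0.
by apply: span_sum => A _; apply/spanZ/(span_std (dimO A).+1).
Qed.

Lemma can_free (c : Xi n d -> laurent) : \sum_A c A *: can A = 0 -> forall A, c A = 0.
Proof.
move=> c0 A1; apply/eqP/negP => /negP cA1.
pose A := [arg max_(A > A1 | c A != 0) dimO A].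
have [cA Amax] : c A != 0 /\ forall A', c A' != 0 -> (dimO A' <= dimO A)%N.
  by rewrite /A; case: arg_maxnP.
move/ffunP/(_ A): c0; rewrite sum_ffunE (bigD1 A) //= big1 => [|A' nA].
  rewrite !ffunE canE addr0 /Q asboolT // P_diag mul1r => /(congr1 lval).
  rewrite [_ *: _]/(_ * _) lvalM lval0 => /eqP; rewrite mulf_eq0 /=.
  rewrite (negbTE (expfz_neq0 _ vQ_neq0)) orbF => /eqP h.
  by move/eqP: cA; apply; apply: lval_inj; rewrite lval0.
rewrite ffunE canE; have [->|cA'] := eqVneq (c A') 0; first by rewrite scale0r.
by rewrite Q_tri ?mul0r ?scaler0 ?Amax // eq_sym.
Qed.

Lemma formN (x : Sj n d) : form (- x) (- x) = form x x.
Proof. by apply: eq_bigr => A _; rewrite !ffunE !lvalN mulrNN. Qed.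

Lemma form_vev_cong (p : Xi n d -> {poly int}) :
  vcong (\sum_A \sum_A' vev (p A) * vev (p A') * form (can A) (can A'))
    (\sum_A (p A)`_0 ^+ 2).
Proof.
have -> : \sum_A (p A)`_0 ^+ 2 =
    \sum_A \sum_A' (p A)`_0 * (p A')`_0 * (A == A')%:R :> int.
  apply: eq_bigr => A _; rewrite (bigD1 A) //= eqxx mulr1 -expr2.
  by rewrite big1 ?addr0 // => A' /negbTE nA; rewrite eq_sym nA mulr0.
apply: vcong_sum => A; apply: vcong_sum => A'; apply: vcongM.
  by apply: vcongM; exact: vcong_vev.
exact: form_can_cong.
Qed.

(** [is_bar] controls only additivity and multiplication by powers of v, so each coefficient is
    expanded into monomials; bar then replaces v by v^-1 in it, and freeness of the canonical basis
    allows coefficients to be compared. *)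
Lemma bar_coord (bar : Sj n d -> Sj n d) (m : nat) (p : Xi n d -> {poly int})
    (c : Xi n d -> laurent) :
  is_bar can bar -> (forall A, lval (c A) = vQ ^+ m * vev (p A)) ->
  bar (\sum_A c A *: can A) = \sum_A c A *: can A ->
  forall A, vQ ^+ m * vev (p A) = vQ ^- m * tofrac (p A).
Proof.
move=> [barD barZ barC] cE barb A.
have bar0 : bar 0 = 0 by apply: (addrI (bar 0)); rewrite -barD !addr0.
have barN x : bar (- x) = - bar x.
  by apply: (addrI (bar x)); rewrite -barD !subrr.
have barz x z : bar (x *~ z) = bar x *~ z.
  have barn (i : nat) : bar (x *+ i) = bar x *+ i.
    by elim: i => [|i IH]; rewrite ?mulr0n // !mulrS barD IH.
  by case: z => i; rewrite ?NegzE ?mulrNz ?barN -!pmulrn barn.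
have bar_sum (I : finType) (F : I -> Sj n d) : bar (\sum_i F i) = \sum_i bar (F i).
  exact: (big_morph bar barD bar0).
pose cb A := \sum_(i < size (p A)) vpow (i%:Z - m%:Z) *~ (p A)`_i.
have lvalMz (x : laurent) z : lval (x *~ z) = lval x * z%:~R.
    by rewrite mulrzr; case: z => i; rewrite ?NegzE ?mulrNz ?lvalN -!pmulrn lvalMn.
have cE' A' : c A' = \sum_(i < size (p A')) vpow (m%:Z - i%:Z) *~ (p A')`_i.
  apply: lval_inj; rewrite cE lval_sum (@horner_coef_wide _ (size (p A'))) ?size_poly //.
  rewrite mulr_sumr; apply: eq_bigr => i _; rewrite lvalMz coef_map mulrCA mulrC /=.
  by rewrite exprVn expfzDr ?vQ_neq0 // -exprnN.
have barcan A' : bar (c A' *: can A') = cb A' *: can A'.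
  rewrite cE' !scaler_suml bar_sum; apply: eq_bigr => i _.
  by rewrite -scalerMzl barz barZ opprB barC scalerMzl.
have /can_free/(_ A)/eqP : \sum_A (cb A - c A) *: can A = 0.
  transitivity (bar (\sum_A c A *: can A) - \sum_A c A *: can A).
    rewrite bar_sum -sumrB; apply: eq_bigr => A' _.
    by rewrite barcan scalerBl.
  by rewrite barb subrr.
rewrite subr_eq0 => /eqP cbc; rewrite -cE -cbc lval_sum tofrac_horner.
rewrite (@horner_coef_wide _ (size (p A))) ?size_poly // mulr_sumr.
apply: eq_bigr => i _; rewrite lvalMz coef_map mulrCA mulrC /=.
by rewrite addrC expfzDr ?vQ_neq0 // -exprnN.
Qed.

Lemma signed_canonical_basis (bar : Sj n d -> Sj n d) : is_bar can bar ->
  (forall A A' : Xi n d,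
     in_vinv_Zvinv (form (can A) (can A') - (A == A')%:R)) /\
  (forall b : Sj n d,
     (exists A, b = can A \/ b = - can A) <->
     (bar b = b /\ in_vinv_Zvinv (form b b - 1))).
Proof.
move=> hbar; have [barD barZ barC] := hbar.
have orth A A' : in_vinv_Zvinv (form (can A) (can A') - (A == A')%:R).
  by have := form_can_cong A A'; rewrite /vcong; case: (A == A').
split=> // b; split.
  have bar0 : bar 0 = 0 by apply: (addrI (bar 0)); rewrite -barD !addr0.
  have barN x : bar (- x) = - bar x.
    by apply: (addrI (bar x)); rewrite -barD !subrr.
  by case=> A [->|->]; rewrite ?barN barC ?formN; split=> //; have := orth A A;
     rewrite eqxx.
move=> [barb]; have [c bE] := can_span b; rewrite -[1]/(1%:~R) => fb1.
have fb : in_Zvinv (form b b) := vcongW fb1.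
pose good m := `[< exists p : Xi n d -> {poly int},
  forall A, lval (c A) = vQ ^+ m * vev (p A) >].
have exm : exists m, good m.
  have h A := cid (laurent_vev (c A)); pose m A := projT1 (h A).
  exists (\sum_A m A)%N; apply/asboolP.
  have h' A : exists p : {poly int}, lval (c A) = vQ ^+ (\sum_A m A)%N * vev p.
    apply: (projT2 (h A)); rewrite (bigD1 A) //=; exact: leq_addr.
  by exists (fun A => projT1 (cid (h' A))) => A; case: cid.
case: (ex_minnP exm) => m /asboolP[p pE] mmin.
have formE : form b b = vQ ^+ m * vQ ^+ m *
    (\sum_A \sum_A' vev (p A) * vev (p A') * form (can A) (can A')).
  rewrite bE form_lin mulr_sumr; apply: eq_bigr => A _; rewrite mulr_sumr.
  by apply: eq_bigr => A' _; rewrite !pE -!mulrA [vev _ * (vQ ^+ m * _)]mulrCA.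
have S_cong := form_vev_cong p; set S := (\sum_A _ ^+ 2) in S_cong.
have p_sq0 A : S = 0 -> (p A)`_0 = 0.
  move=> S0; have /eqP := psumr_eq0P (fun A _ => sqr_ge0 ((p A)`_0)) S0 (i := A) isT.
  by rewrite expf_eq0 /= => /eqP.
set T := (\sum_A \sum_A' _) in formE S_cong.
(* For a positive exponent m, T = v^(-2m) (b, b) lies in v^-1 Z[v^-1], which forces S = 0. All [p A]
   are then divisible by v^-1, against the minimality of m. *)
case: m => [|m] in pE mmin formE *; last first.
  exfalso; have S0 : S = 0.
    apply: in_vinv_int; have -> : S%:~R = T - (T - S%:~R) by rewrite opprB addrC subrK.
    apply: in_vinvD; last exact: in_vinvN.
    have -> : T = vQ ^- (m + m).+2 * form b b.
      rewrite formE mulrA -exprD addSn addnS mulVf ?mul1r //.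
      by rewrite expf_neq0 ?vQ_neq0.
    by apply: in_vinvM fb; exact: in_vinv_pow.
  suff /mmin : good m by rewrite ltnn.
  apply/asboolP; exists (fun A => \poly_(i < size (p A)) (p A)`_i.+1) => A.
  rewrite pE exprSr -mulrA; congr (_ * _).
  set q := \poly_(i < _) _; have -> : p A = 'X * q.
    apply/polyP => -[|i]; rewrite coefXM /= ?p_sq0 // coef_poly.
    by case: ltnP => // h; rewrite nth_default // leqW.
  by rewrite vevM vevX mulrA divff ?mul1r ?vQ_neq0.
(* For m = 0 bar-invariance says that p(1/v) = p(v). *)
have p_const A : p A = ((p A)`_0)%:P.
  apply: vev_sym_const; have := bar_coord hbar pE _ A; rewrite -bE barb => /(_ erefl).
  by rewrite expr0 invr1 !mul1r.
have S1 : S = 1.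
  apply/eqP; rewrite -subr_eq0; apply/eqP/in_vinv_int; rewrite rmorphB /=.
  have -> : S%:~R - 1%:~R = (form b b - 1%:~R) - (T - S%:~R).
    by rewrite formE expr0 !mul1r opprB [RHS]addrC subrKA.
  by apply: in_vinvD => //; apply: in_vinvN.
have cE A : c A = ((p A)`_0)%:~R.
  apply: lval_inj; rewrite pE expr0 mul1r p_const vevC coefC /=.
  by case: (_`_0) => i; rewrite ?NegzE ?mulrNz ?lvalN -!pmulrn lvalMn lval1.
have [A pA] : exists A, (p A)`_0 != 0.
  apply: contrapT => /forallNP h; move: S1; rewrite /S big1 // => A _.
  by have /negP := h A; rewrite negbK => /eqP ->; rewrite expr0n.
have sq1 z : z != 0 -> 1 <= z ^+ 2 :> int.
  by move=> z0; rewrite -gtz0_ge1 exprn_even_gt0.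
have [pA1 pA0] : (p A)`_0 ^+ 2 = 1 /\ forall A', A' != A -> (p A')`_0 = 0.
  move: S1; rewrite /S (bigD1 A) //= => S1.
  have r0 : 0 <= \sum_(A' | A' != A) (p A')`_0 ^+ 2 by apply: sumr_ge0 => *; exact: sqr_ge0.
  have r1 : \sum_(A' | A' != A) (p A')`_0 ^+ 2 = 0.
    apply/eqP; rewrite eq_le r0 andbT -(lerD2l ((p A)`_0 ^+ 2)) S1 addr0.
    exact: sq1.
  split=> [|A' nA]; first by move: S1; rewrite r1 addr0.
  have /eqP := psumr_eq0P (fun A _ => sqr_ge0 ((p A)`_0)) r1 (i := A') nA.
  by rewrite expf_eq0 /= => /eqP.
exists A; rewrite bE (bigD1 A) //= big1 ?addr0 => [|A' nA]; last first.
  by rewrite cE pA0 // scale0r.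
move/eqP: pA1; rewrite sqrf_eq1 cE => /orP[/eqP ->|/eqP ->].
  by left; rewrite scale1r.
by right; rewrite scaleN1r.
Qed.

End AlmostOrthonormal.

(** * Leading terms of the counting polynomials *)

Local Notation ev p z := (map_poly intr (p : {poly int})).[z : algC].

Lemma coefM_top (R : nzRingType) (p q : {poly R}) a b :
  (size p <= a.+1)%N -> (size q <= b.+1)%N -> (p * q)`_(a + b) = p`_a * q`_b.
Proof.
move=> pa qb; rewrite coefM (bigD1 (inord a)) //= inordK ?ltnS ?leq_addr // addKn.
rewrite big1 ?addr0 // => i /eqP ia; case: (ltngtP i a) => [lt|gt|E].
- by rewrite [q`__]nth_default ?mulr0 // (leq_trans qb) //; move: lt; clear; lia.
- by rewrite nth_default ?mul0r // (leq_trans pa).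
by case: ia; apply: val_inj; rewrite /= inordK // ltnS leq_addr.
Qed.

(** Cauchy's bound on roots: the leading coefficient is a negative integer, hence at most -1, and
    beyond 1 plus the absolute values of the lower coefficients the leading term dominates. *)
Lemma ev_neg (R : {poly int}) s (z : algC) : (size R <= s.+1)%N -> R`_s < 0 ->
  1 + \sum_(i < s) `|R`_i|%:~R <= z -> ev R z < 0.
Proof.
move=> Rs Rneg hz; rewrite (@horner_coef_wide _ s.+1); last exact: leq_trans (size_poly _ _) Rs.
set S := \sum_(i < s) _ in hz.
have S0 : 0 <= S by apply: sumr_ge0 => i _; rewrite ler0z normr_ge0.
have z1 : 1 <= z by apply: le_trans hz; rewrite lerDl.
have z0 : 0 < z := lt_le_trans ltr01 z1.
have lead : (R`_s)%:~R <= -1 :> algC.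
  by rewrite -[-1]/((-1)%:~R) ler_int; move: Rneg; clear; lia.
rewrite big_ord_recr /= coef_map /=; case: s => [|s] in Rs Rneg S hz S0 lead *.
  by rewrite big_ord0 add0r expr0 mulr1 ltrz0.
apply: (@le_lt_trans _ _ (S * z ^+ s + -1 * z ^+ s.+1)).
  rewrite lerD ?ler_wpM2r ?exprn_ge0 ?(ltW z0) // mulr_suml.
  apply: ler_sum => i _; rewrite coef_map /=.
  apply: (@le_trans _ _ (`|R`_i|%:~R * z ^+ i)).
    by rewrite ler_wpM2r ?exprn_ge0 ?(ltW z0) // ler_int ler_norm.
  by rewrite ler_wpM2l ?ler0z ?normr_ge0 // ler_weXn2l // -ltnS.
rewrite exprS mulN1r -mulrBl nmulr_rlt0 ?exprn_gt0 // subr_lt0.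
by apply: lt_le_trans hz; rewrite ltrDr ltr01.
Qed.

Lemma ev_top_ge0 (R : {poly int}) s :
  (forall p, prime p -> (2 < p)%N -> 0 <= ev R (sqrtC p%:R)) ->
  (size R <= s.+1)%N -> 0 <= R`_s.
Proof.
move=> Rz Rs; rewrite leNgt; apply/negP => Rneg.
(* S is the bound of [ev_neg]. The square root of a prime above S^2 exceeds it, and the 2 makes that
   prime odd. *)
pose S := (1 + \sum_(i < s) `|(R`_i)%R|)%N.
have [p pS p_pr] := prime_above (maxn 2 (S ^ 2)).
move: pS; rewrite gtn_max => /andP[p2 pS].
have := Rz p p_pr p2; rewrite lt_geF // (ev_neg Rs) //.
have -> : 1 + \sum_(i < s) `|R`_i|%:~R = S%:R :> algC.
  by rewrite natrD natr_sum; congr (_ + _); apply: eq_bigr => i _.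
rewrite -(@ler_pXn2r _ 2) ?nnegrE ?ler0n ?sqrtC_ge0 //.
by rewrite sqrtCK -natrX ler_nat ltnW.
Qed.

Section Squeeze.
Variables (P : {poly int}) (m t : nat).
Local Notation M c := (('X^2 - c%:P) ^+ m : {poly int}).

Lemma size_M (c : int) : size (M c) = (m.*2).+1.
Proof.
have := size_exp ('X^2 - c%:P : {poly int}) m; rewrite size_XnsubC //= => E.
rewrite -mul2n -E prednK // size_poly_gt0 monic_neq0 //.
by apply: monic_exp; apply: monicXnsubC.
Qed.

Lemma M_top (c : int) : (M c)`_(m.*2) = 1.
Proof.
have /monicP := monic_exp m (monicXnsubC c (isT : (0 < 2)%N)).
by rewrite /lead_coef size_M.
Qed.

Lemma evM_top (U : {poly int}) (c : int) s : (size U <= s.+1)%N ->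
  (size (U * M c)%R <= (s + m.*2).+1)%N /\ (U * M c)`_(s + m.*2) = U`_s.
Proof.
move=> Us; split; last by rewrite coefM_top ?size_M // M_top mulr1.
by apply: leq_trans (size_polyMleq _ _) _; rewrite size_M addnS /= -addSn leq_add2r.
Qed.

(* The two products have the same degree growth, so the squeeze can be read off
   the coefficient in degree max(deg P, t) + 2m. *)
Lemma squeeze_lead (a b c : int) :
  (forall p, prime p -> (2 < p)%N ->
     ev ('X^t * M a) (sqrtC p%:R) <= ev (P * M 0) (sqrtC p%:R) /\
     ev (P * M b) (sqrtC p%:R) <= ev ('X^t * M c) (sqrtC p%:R)) ->
  (size P <= t.+1)%N /\ P`_t = 1.
Proof.
move=> sq; pose s := maxn (size P).-1 t.
have Ps : (size P <= s.+1)%N by rewrite (leq_trans (leqSpred _)) // ltnS leq_maxl.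
have Xs : (size ('X^t : {poly int}) <= s.+1)%N by rewrite size_polyXn ltnS leq_maxr.
have le (U V : {poly int}) (x y : int) : (size U <= s.+1)%N -> (size V <= s.+1)%N ->
    (forall p, prime p -> (2 < p)%N -> ev (U * M x) (sqrtC p%:R) <= ev (V * M y) (sqrtC p%:R)) ->
    U`_s <= V`_s.
  move=> Us Vs h; rewrite -subr_ge0.
  have [hU <-] := evM_top x Us; have [hV <-] := evM_top y Vs.
  rewrite -coefB; apply: ev_top_ge0 => [p p_pr p2|].
    by rewrite rmorphB hornerD hornerN subr_ge0 h.
  by apply: leq_trans (size_polyD _ _) _; rewrite size_polyN geq_max hV hU.
have E : P`_s = (s == t)%:R.
  apply/eqP; rewrite -coefXn eq_le (le _ _ b c) ?(le _ _ a 0) // => p p_pr p2.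
    by have [] := sq p p_pr p2.
  by have [] := sq p p_pr p2.
have st : s = t.
  apply/eqP/negP => /negP st; move: E; rewrite (negbTE st).
  have -> : s = (size P).-1 by move: st; rewrite /s; clear; lia.
  move/eqP; rewrite -/(lead_coef P) lead_coef_eq0 => /eqP P0.
  by move: st; rewrite /s P0 size_poly0 max0n eqxx.
by split; first rewrite -st //; move: E; rewrite st eqxx.
Qed.

End Squeeze.

(** [laurent_eval] asserts the value through some representation P v^-m; two representations agree
    after multiplication by a power of v, which can be cancelled at z <> 0. *)
Lemma laurent_eval_rep (x : laurent) (z y : algC) m (P : {poly int}) : z != 0 ->
  lval x * vQ ^+ m = tofrac P -> laurent_eval x z y -> y * z ^+ m = ev P z.
Proof.
move=> z0 xP [m' [P' [xP' yP']]].
have E : P' * 'X^m = P * 'X^m'.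
  by apply/eqP; rewrite -tofrac_eq !tofracM !tofracXn -xP -xP' mulrAC.
have := congr1 (fun p : {poly int} => ev p z) E; rewrite /= !rmorphM !hornerM /=.
rewrite !map_polyXn !hornerXn -yP' mulrAC.
by move/(mulIf (expf_neq0 m' z0)).
Qed.

(** [is_count] holds for all forms and base flags, so it may be applied over F_p to the antidiagonal
    form and a coordinate flag. The transpose turns the column sums of A, which fix the base flag,
    into row sums of C. *)
Lemma count_lead n d (A : Xi n d) (f : laurent) : is_count A f ->
  vcong (vQ ^ (- (2 * (dXi (trXi A))%:Z)) * lval f) 1.
Proof.
move=> fA; have /asboolP[m0 [P fP]] : lval f \in laurent_pred by case: f {fA}.
set C := trXi A; set e := dXi C; pose m := size (labs (nentry C) (odim n) n).
(* At v = sqrt p the factor [('X^2 - c) ^ m] is (p - c)^m: the constants 2, 1, -2 reproduce the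
   factors p - 2, p - 1, p + 2 of [fiber_bounds]. The exponent is that of v^(2 d_C) after clearing
   the denominator v^m0 of f. *)
have [] := @squeeze_lead P m (m0 + e.*2) 2 1 (-2) _.
  move=> p p_pr p2; have cF : #|'F_p| = p by rewrite card_Fp.
  have two_neq0 : (2%:R : 'F_p) != 0.
    rewrite -(dvdn_pcharf (pchar_Fp p_pr)) gtnNdvd //.
  have odd_F : odd #|'F_p| by rewrite cF; case: (even_prime p_pr) p2 => // ->.
  pose W : flag n (antidiag_mx 'F_p (odim d)) := base_flag 'F_p C.
  have [lo hi iso rk] := base_lagrangian 'F_p C.
  have sym := antidiag_sym 'F_p (odim d); have un := antidiag_unit 'F_p (odim d).
  have rows := base_flag_rows 'F_p C.
  have rowsA i : (\rank (flag_hi W i) - \rank (flag_lo W i))%N = (\sum_k entry A k i)%N.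
    by rewrite rows; apply: eq_bigr => k _; rewrite /entry /= mxE.
  have := fA 'F_p _ odd_F sym un W rowsA.
  have := fiber_bounds two_neq0 sym un rows lo hi iso rk.
  rewrite cF -/C -/W -/e -/m /=; set k := #|_|.
  set z := sqrtC p%:R => -[bnd1 bnd2] fk.
  have zK : z ^+ 2 = p%:R by rewrite sqrtCK.
  have z0 : 0 < z by rewrite sqrtC_gt0 ltr0n prime_gt0.
  have kP := laurent_eval_rep (lt0r_neq0 z0) fP fk.
  have zt : z ^+ (m0 + e.*2) = z ^+ m0 * (p ^ e)%:R by rewrite exprD -mul2n exprM zK natrX.
  have zm : 0 <= z ^+ m0 by rewrite exprn_ge0 // ltW.
  have evM (c : int) : ev ((('X^2 - c%:P) ^+ m)) z = (p%:R - c%:~R) ^+ m.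
    by rewrite rmorphXn horner_exp rmorphB /= map_polyXn map_polyC hornerD hornerN hornerXn hornerC zK.
  have evX : ev 'X^(m0 + e.*2) z = z ^+ m0 * (p ^ e)%:R by rewrite map_polyXn hornerXn zt.
  rewrite !rmorphM !hornerM !evM evX -kP; split.
    have -> : p%:R - 2%:~R = (p - 2)%:R :> algC by rewrite natrB // ltnW.
    rewrite subr0 -!natrX [_%:R * z ^+ m0]mulrC -!mulrA ler_wpM2l // -!natrM ler_nat.
    by rewrite mulnC.
  have -> : p%:R - 1%:~R = (p - 1)%:R :> algC by rewrite natrB // prime_gt0.
  have -> : p%:R - (-2)%:~R = (p + 2)%:R :> algC by rewrite mulrNz opprK natrD.
  rewrite -!natrX [_%:R * z ^+ m0]mulrC -!mulrA ler_wpM2l // -!natrM ler_nat.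
  by rewrite mulnC [(p ^ e * _)%N]mulnC.
move=> sP P1; set t := (m0 + e.*2)%N in sP P1.
pose r := \poly_(i < t.+1) P`_(t - i).
have Er : vQ ^+ t * vev r = tofrac P.
  rewrite vev_rev ?size_poly //; congr tofrac; apply/polyP => i; rewrite coef_poly.
  case: ltnP => h; last by rewrite nth_default // (leq_trans _ h).
  by rewrite coef_poly ltnS leq_subr subKn.
have -> : vQ ^ (- (2 * e%:Z)) * lval f = vev r.
  have v0 := vQ_neq0; apply: (mulfI (expf_neq0 t v0)); rewrite Er -fP.
  rewrite mulrA !exprnP -expfzDr // mulrC; congr (_ * _ ^ _).
  by rewrite /t; clear; lia.
have := vcong_vev r; rewrite coef_poly /= subn0 P1; exact.
Qed.

Theorem proposition3p17 (n d : nat) (n_ge1 : (1 <= n)%N) (d_ge1 : (1 <= d)%N)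
  (* k is an algebraic closure of F_q, q a power of the odd prime p *)
  (p : nat) (p_odd : odd p) (k : closedFieldType) (k_char : p \in [pchar k])
  (k_alg : forall x : k, exists2 m, (0 < m)%N & x ^+ (p ^ m) = x)
  (B : 'M[k]_(odim d)) (B_sym : B^T = B) (B_nondeg : B \in unitmx)
  (l : nat) (l_prime : prime l) (l_neq_p : l != p)
  (dimO : Xi n d -> nat) (dimO_def : forall A, is_orbit_dim B A (dimO A))
  (IC : Xi n d -> adic_complex n B) (IC_def : forall A, is_IC l dimO A (IC A))
  (P : Xi n d -> Xi n d -> laurent)
  (P_def : forall A' A, leXi B A' A -> is_IC_poly l dimO (IC A) A' A (P A' A))
  (f : Xi n d -> laurent) (f_def : forall A, is_count A (f A))
  (bar : Sj n d -> Sj n d) (bar_def : is_bar (canon_elt (leXi B) P) bar) :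
  let can := canon_elt (leXi B) P in
  (forall A A' : Xi n d,
     in_vinv_Zvinv (Sj_form f (can A) (can A') - (A == A')%:R)) /\
  (forall b : Sj n d,
     (exists A, b = can A \/ b = - can A) <->
     (bar b = b /\ in_vinv_Zvinv (Sj_form f b b - 1))).
Proof.
have le_refl (A : Xi n d) : leXi B A A by move=> x Ax C _; apply.
apply: (@signed_canonical_basis n d dimO) bar_def => // [A|A' A leA nA|A].
- have [x Ax] := orbit_nonempty (dimO_def A).
  exact: (IC_poly_diag l_prime (IC_def A) Ax (P_def _ _ (le_refl A))).
- have [x Ax] := orbit_nonempty (dimO_def A').
  exact: (IC_poly_off l_prime (IC_def A) leA nA Ax (P_def _ _ leA)).
- exact: count_lead.
Qed.
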